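(* Let $a,\underline\gamma,\sigma>0$, $t_0\ge0$, and let $\underline X$ be the classical CIR process $$d\underline X(t)=a(\underline\gamma-\underline X(t))\,dt+\sigma\sqrt{\underline X(t)}\,dW(t),\quad t\ge t_0,\qquad \underline X(t_0)=\underline X_0,$$ where $\underline X_0$ is a positive random variable independent of the Brownian motion $W$. Assume $\frac{2a\underline\gamma}{\sigma^2}>1$. If $p\ge\frac{2a\underline\gamma}{\sigma^2}$, then $\mathbb{E}\big[\underline X(t)^{-p}\big]=+\infty$ for all $t>t_0$. If $1\le p<\frac{2a\underline\gamma}{\sigma^2}$ and $\mathbb{E}[\underline X_0^{-p}]<+\infty$, then there exists a constant $L_p$ such that, for every $t\ge t_0$, $$\mathbb{E}\Big[\frac{1}{\underline X^p(t)}\Big]\le L_p\,e^{apt}\,\mathbb{E}\Big[\frac1{\underline X_0^p}\Big].$$ Moreover, in the latter case: 1. if $\frac{2a\underline\gamma}{\sigma^2}\ge2$ and $1\le p\le\frac{2a\underline\gamma}{\sigma^2}-1$, one can take $L_p=1$; 2. if $\frac{2a\underline\gamma}{\sigma^2}\ge2$ and $\frac{2a\underline\gamma}{\sigma^2}-1<p<\frac{2a\underline\gamma}{\sigma^2}$, one can take $$L_p=2^{\,p+1-\frac{2a\underline\gamma}{\sigma^2}}\left(1+\frac{2^{p-1}p^pe^{-p}}{\Gamma(p)\big(\frac{2a\underline\gamma}{\sigma^2}-p\big)}\right);$$ 3. if $\frac{2a\underline\gamma}{\sigma^2}<2$, one can take $L_p$ as in the formula of item 2.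
   Context: $W$ is a standard Brownian motion on $[t_0,\infty)$ with $W(t_0)=0$ with respect to a filtration $\{\mathcal F_t\}_{t\ge t_0}$ satisfying the usual conditions, and $\underline X_0$ is $\mathcal F_{t_0}$-measurable. $\Gamma$ is the Euler Gamma function. *)

(* Defs.v *)
From HB Require Import structures.
From mathcomp Require Import all_boot all_order all_algebra.
From mathcomp Require Import all_classical all_reals all_analysis.

Set Implicit Arguments.
Unset Strict Implicit.
Unset Printing Implicit Defensive.

Import Order.TTheory GRing.Theory Num.Theory.
Import numFieldNormedType.Exports.

Local Open Scope classical_set_scope.
Local Open Scope ring_scope.

(* Processes have type [R -> T -> R] (time first); filtrations have type
   [R -> set (set T)]. Only times [t >= t0] are ever constrained. *)

Definition sigma_of_process d (T : measurableType d) (R : realType) (t0 : R)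
    (W : R -> T -> R) : set (set T) :=
  <<s \bigcup_(t in `[t0, +oo[) g_sigma_algebra_preimage (W t) >>.

Definition independent_systems d (T : measurableType d) (R : realType)
    (P : probability T R) (G H : set (set T)) : Prop :=
  forall A B, G A -> H B -> P (A `&` B) = (P A * P B)%E.

Definition filtration d (T : measurableType d) (R : realType) (t0 : R)
    (F : R -> set (set T)) : Prop :=
  (forall t, t0 <= t -> sigma_algebra setT (F t) /\ F t `<=` measurable) /\
  (forall s t, t0 <= s -> s <= t -> F s `<=` F t).

(* Null sets are the P-negligible ones, not only the measurable ones: together
   with [F t0 `<=` measurable] this makes the probability space complete. *)
Definition usual_conditions d (T : measurableType d) (R : realType)
    (P : probability T R) (t0 : R) (F : R -> set (set T)) : Prop :=
  (forall A, P.-negligible A -> F t0 A) /\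
  (forall t, t0 <= t -> F t = \bigcap_(s in `]t, +oo[) F s).

Definition adapted d (T : measurableType d) (R : realType) (t0 : R)
    (F : R -> set (set T)) (X : R -> T -> R) : Prop :=
  forall t, t0 <= t -> g_sigma_algebra_preimage (X t) `<=` F t.

Definition as_continuous d (T : measurableType d) (R : realType)
    (P : probability T R) (t0 : R) (X : R -> T -> R) : Prop :=
  {ae P, forall w, {within `[t0, +oo[, continuous (fun t => X t w)}}.

(* The second argument of [normal_prob] is the standard deviation. *)
Definition brownian_motion d (T : measurableType d) (R : realType)
    (P : probability T R) (t0 : R) (F : R -> set (set T)) (W : R -> T -> R) :
    Prop :=
  [/\ adapted t0 F W,
      {ae P, forall w, W t0 w = 0},
      as_continuous P t0 W,
      forall s t, t0 <= s -> s < t -> forall B : set R, measurable B ->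
        P ((fun w => W t w - W s w) @^-1` B)
          = normal_prob 0 (Num.sqrt (t - s)) B
    & forall s t, t0 <= s -> s < t ->
        independent_systems P (F s)
          (g_sigma_algebra_preimage (fun w => W t w - W s w))].

(* The step process [\sum_(i < n) xi_i 1_(]time_i, time_(i+1)]]]. *)
Record step_process (T : Type) (R : realType) := StepProcess {
  step_size : nat;
  step_time : nat -> R;
  step_coef : nat -> T -> R }.

Definition simple_process d (T : measurableType d) (R : realType) (t0 : R)
    (F : R -> set (set T)) (t : R) (h : step_process T R) : Prop :=
  [/\ step_time h 0%N = t0,
      step_time h (step_size h) = t,
      forall i, (i < step_size h)%N -> step_time h i <= step_time h i.+1
    & forall i, (i < step_size h)%N ->
        g_sigma_algebra_preimage (step_coef h i) `<=` F (step_time h i) /\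
        exists M : R, forall w, `|step_coef h i w| <= M].

Definition step_value (T : Type) (R : realType) (h : step_process T R)
    (s : R) (w : T) : R :=
  \sum_(i < step_size h)
    step_coef h i w * \1_`]step_time h i, step_time h i.+1] s.

Definition step_integral (T : Type) (R : realType) (W : R -> T -> R)
    (h : step_process T R) (w : T) : R :=
  \sum_(i < step_size h)
    step_coef h i w * (W (step_time h i.+1) w - W (step_time h i) w).

(* Extended-real valued so that an infinite distance is not read as 0. *)
Definition cvg0_in_probability d (T : measurableType d) (R : realType)
    (P : probability T R) (D : nat -> T -> \bar R) : Prop :=
  forall e : R, 0 < e ->
    (fun n => P [set w | (e%:E <= D n w)%E]) @ \oo --> 0%E.

(* [I] is (a version of) the Ito integral of [H] against [W] over [[t0, t]]:
   the limit in probability of the integrals of bounded simple processes that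
   approximate [H], in probability, in L^2([t0, t], ds). Such an [I] is unique
   up to a null set. *)
Definition is_ito_integral d (T : measurableType d) (R : realType)
    (P : probability T R) (t0 : R) (F : R -> set (set T)) (W : R -> T -> R)
    (t : R) (H : R -> T -> R) (I : T -> R) : Prop :=
  measurable_fun setT I /\
  exists h : nat -> step_process T R,
    [/\ forall n, simple_process t0 F t (h n),
        cvg0_in_probability P (fun n w =>
          \int[lebesgue_measure]_(s in `[t0, t])
            ((step_value (h n) s w - H s w) ^+ 2)%:E)%E
      & cvg0_in_probability P (fun n w =>
          `|step_integral W (h n) w - I w|%:E)].

(* dX = a (g - X) dt + sigma sqrt(X) dW on [t0, +oo[, X(t0) = X0. *)
Definition cir_process d (T : measurableType d) (R : realType)
    (P : probability T R) (t0 : R) (F : R -> set (set T)) (W : R -> T -> R)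
    (a g sigma : R) (X0 : T -> R) (X : R -> T -> R) : Prop :=
  [/\ adapted t0 F X,
      as_continuous P t0 X,
      {ae P, forall w, forall t, t0 <= t -> 0 <= X t w},
      {ae P, forall w, X t0 w = X0 w}
    & forall t, t0 <= t -> exists I : T -> R,
        is_ito_integral P t0 F W t
          (fun s w => sigma * Num.sqrt (X s w)) I /\
        {ae P, forall w,
          X t w = X0 w
            + \int[lebesgue_measure]_(s in `[t0, t]) (a * (g - X s w))
            + I w}].

(* E[Y^{-p}] for Y >= 0 and p > 0. The inverse is taken in [\bar R], where
   0^-1 = +oo; the real power [0 `^ (- p)] would be 0. *)
Definition inverse_moment d (T : measurableType d) (R : realType)
    (P : probability T R) (Y : T -> R) (p : R) : \bar R :=
  (\int[P]_w ((Y w `^ p)%:E)^-1)%E.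

Definition Gamma (R : realType) (p : R) : R :=
  \int[lebesgue_measure]_(x in `]0, +oo[) (x `^ (p - 1) * expR (- x)).

Definition cir_Lp (R : realType) (theta p : R) : R :=
  2 `^ (p + 1 - theta)
  * (1 + 2 `^ (p - 1) * p `^ p * expR (- p) / (Gamma p * (theta - p))).

(* Main.v *)
(* Let c(tau) = sigma^2 (1 - e^(-a tau)) / (2 a), psi(s) = u e^(-a (t - s)) / (1 + u c(t - s))
   and phi(s) = theta ln (1 + u c(t - s)); they solve psi' = a psi + sigma^2 psi^2 / 2 and
   phi' = - a g psi, so exp(- psi(s) X(s) - phi(s)) is the stochastic exponential of
   - int psi sigma sqrt(X) dW. No Ito formula is needed: along a uniform grid the exponential
   of the Euler sum, corrected by half its quadratic variation, is an exact martingale, and it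
   converges in probability. Fatou's lemma gives
     E[e^(-u X(t))] <= E[e^(-psi(t0) X(t0) - phi(t0))],
   and an L^2 bound gives the converse inequality on the events {X(t0) <= K}.
   Since Gamma(p) x^(-p) is the integral of u^(p-1) e^(-u x) over u >= 0, integrating against
   u^(p-1) leaves the integral of
     u^(p-1) (1 + c u)^(-theta) exp(- u y / (1 + c u)),  y = e^(-a (t - t0)) X(t0).
   At infinity it behaves like u^(p-1-theta), so it diverges when theta <= p. When p + 1 <= theta
   the substitution v = u / (1 + c u) bounds it by Gamma(p) y^(-p); otherwise the integral is cut
   at u = 1/c. *)

Require Import Defs.
From HB Require Import structures.
From mathcomp Require Import all_boot all_order all_algebra.
From mathcomp Require Import all_classical all_reals all_analysis.
From mathcomp Require Import measurable_realfun exponential_distribution ring lra.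

Set Implicit Arguments.
Unset Strict Implicit.
Unset Printing Implicit Defensive.

Import Order.TTheory GRing.Theory Num.Theory.
Import numFieldNormedType.Exports.

Local Open Scope classical_set_scope.
Local Open Scope ring_scope.

(** * Exponential martingales of elementary integrals *)

(** The stochastic integral is given only as a limit in probability at each fixed time, so there is
    no process of integrals to which a calculus could apply. Two facts replace it. Since [psi] is
    deterministic, the Euler sum of [psi sigma sqrt(X)] only has to be compared with increments of
    the integrals of [sigma sqrt(X)] between grid times, taken with constant coefficients, and the
    equation expresses these increments through [X] and its drift. And the exponential martingale
    turns a small energy off an event into a small integral off a slightly larger event. The lower
    bound on the Laplace transform needs uniform integrability, hence exponential moments of [X].
    These come from the same supermartingale with [u] negative, down to [- a / sigma^2], where
    [1 + u c] is still at least [1/2]. The cut [u = 1/c] is the point where [1 + c u = 2]: below it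
    the factor [(1 + c u)^(p + 1 - theta)] left by the substitution is at most [2^(p + 1 - theta)];
    above it [v] stays between [1/(2c)] and [1/c]. The two ranges produce the two summands of
    [cir_Lp]. *)

Lemma indep_integral d d' d'' (T : measurableType d) (T' : measurableType d')
    (U : measurableType d'')
    (R : realType) (P : probability T R) (Y : T -> T') (V : T -> U)
    (nu : {sigma_finite_measure set U -> \bar R}) (f : T' * U -> \bar R) :
  measurable_fun setT Y -> measurable_fun setT V ->
  (forall B, measurable B -> P (V @^-1` B) = nu B) ->
  (forall A B, measurable A -> measurable B ->
    P (Y @^-1` A `&` V @^-1` B) = P (Y @^-1` A) * P (V @^-1` B))%E ->
  measurable_fun setT f -> (forall z, 0 <= f z)%E ->
  (\int[P]_w f (Y w, V w)
   = \int[P]_w \int[nu]_v f (Y w, v))%E.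
Proof.
move=> mY mV Vnu indep mf f0.
pose Y' : {RV P >-> T'} := HB.pack Y (isMeasurableFun.Build _ _ _ _ _ mY).
have mYV : measurable_fun setT (fun w => (Y w, V w)).
  exact: measurable_fun_pair.
pose Z' : {RV P >-> (T' * U)%type} :=
  HB.pack (fun w => (Y w, V w)) (isMeasurableFun.Build _ _ _ _ _ mYV).
(* A finite product measure is determined by its values on rectangles, so independence identifies
   the joint law with a product; Tonelli then integrates [V] out with [Y] frozen. *)
have muniq : forall X, measurable X ->
    (distribution P Y' \x nu)%E X = distribution P Z' X.
  apply: product_measure_unique => A B mA mB.
  by rewrite /distribution /pushforward -(Vnu B mB) -indep.
transitivity (\int[distribution P Z']_z f z)%E.
  by rewrite ge0_integral_distribution.
transitivity (\int[(distribution P Y' \x nu)%E]_z f z)%E.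
  by apply: eq_measure_integral => A mA _; apply/esym/muniq.
rewrite fubini_tonelli1// ge0_integral_distribution//.
  exact: measurable_fun_fubini_tonelli_F.
by move=> x; apply: integral_ge0 => v _.
Qed.

(** The Radon-Nikodym derivative and [normal_pdf] have the same integral over every measurable set,
    hence agree almost everywhere. *)
Lemma ge0_integral_normal_prob (R : realType) (m s : R) (f : R -> \bar R) :
  measurable_fun setT f -> (forall x, 0 <= f x)%E ->
  (\int[normal_prob m s]_x f x
   = \int[lebesgue_measure]_x (f x * (normal_pdf m s x)%:E))%E.
Proof.
move=> mf f0.
have dom := @normal_prob_dominates R m s.
rewrite -(Radon_Nikodym_SigmaFinite.change_of_variables dom)//.
have mpdf : measurable_fun [set: R] (fun x => (normal_pdf m s x)%:E).
  by apply/measurable_EFinP; exact: measurable_normal_pdf.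
have mrn := measurable_int _ (Radon_Nikodym_SigmaFinite.f_integrable dom).
have rn_ge0 := Radon_Nikodym_SigmaFinite.f_ge0 dom.
apply: ge0_ae_eq_integral => //.
- exact: emeasurable_funM.
- exact: emeasurable_funM.
- by move=> x _; rewrite mule_ge0.
- by move=> x _; rewrite mule_ge0// lee_fin normal_pdf_ge0.
- have [N [mN N0 sub]] : ae_eq lebesgue_measure setT
      (Radon_Nikodym_SigmaFinite.f (normal_prob m s) lebesgue_measure)
      (fun x => (normal_pdf m s x)%:E).
    apply: integral_ae_eq => //.
      exact: Radon_Nikodym_SigmaFinite.f_integrable.
    by move=> E _ mE; rewrite -Radon_Nikodym_SigmaFinite.f_integral.
  exists N; split => // x /= nx; apply: sub => /= h; apply: nx => ?.
  by rewrite h.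
Qed.

(** Completing the square: the exponential times the centred density of variance [t] is the density
    of mean [x * t] with the same variance. *)
Lemma normal_prob_exp_martingale (R : realType) (x t : R) : 0 < t ->
  (\int[normal_prob 0 (Num.sqrt t)]_v (expR (x * v - x ^+ 2 * t / 2))%:E
   = 1)%E.
Proof.
move=> t0; rewrite ge0_integral_normal_prob//; last first.
  apply/measurable_EFinP; apply: measurableT_comp => //.
  by apply: measurable_funB => //; exact: measurable_funM.
have st0 : Num.sqrt t != 0 :> R by rewrite gt_eqF// sqrtr_gt0.
rewrite -(integral_normal_pdf (x * t) (Num.sqrt t)).
apply: eq_integral => v _; rewrite -EFinM !normal_pdfE//; congr EFin.
rewrite mulrCA; congr (_ * _).
rewrite /normal_fun -expRD sqr_sqrtr ?ltW//; congr expR.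
by field; rewrite gt_eqF.
Qed.

(** Measurability with respect to [F s] is encoded by changing the measurable structure of the
    domain, so that the closure properties of measurable functions apply to adapted variables as
    they stand. *)
Definition Fmeas d (T : measurableType d) (R : realType)
    (F : R -> set (set T)) (s : R) (f : T -> R) :=
  measurable_fun (setT : set (g_sigma_algebraType (F s)))
    (f : g_sigma_algebraType (F s) -> R).

Section adapted_functions.
Context d (T : measurableType d) (R : realType) (t0 : R)
  (F : R -> set (set T)).
Hypothesis hF : filtration t0 F.

Lemma FmeasP (s : R) (f : T -> R) : t0 <= s ->
  Fmeas F s f <-> g_sigma_algebra_preimage f `<=` F s.
Proof.
move=> t0s; have [sF _] := hF.1 s t0s; split.
  move=> mf A [B mB <-].
  have := mf measurableT B mB.
  by rewrite [X in X _]measurable_g_measurableTypeE.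
move=> sub _ B mB.
by rewrite [X in X _]measurable_g_measurableTypeE//; apply: sub; exists B.
Qed.

Lemma Fmeas_set (s : R) (f : T -> R) (B : set R) : t0 <= s ->
  Fmeas F s f -> measurable B -> F s (f @^-1` B).
Proof.
by move=> t0s /(FmeasP _ t0s) h mB; apply: h; exists B => //; rewrite setTI.
Qed.

Lemma Fmeas_le (s t : R) (f : T -> R) : t0 <= s -> s <= t ->
  Fmeas F s f -> Fmeas F t f.
Proof.
move=> t0s st /(FmeasP _ t0s) h; apply/FmeasP; first exact: le_trans st.
exact: subset_trans h (hF.2 _ _ t0s st).
Qed.

Lemma Fmeas_measurable (s : R) (f : T -> R) : t0 <= s ->
  Fmeas F s f -> measurable_fun setT f.
Proof.
move=> t0s mf _ B mB; rewrite setTI; apply: (hF.1 s t0s).2.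
exact: Fmeas_set.
Qed.

Lemma Fmeas_indic (s : R) (A : set T) : t0 <= s -> F s A ->
  Fmeas F s (\1_A : T -> R).
Proof.
move=> t0s FA; have [sF _] := hF.1 s t0s.
have mA : measurable (A : set (g_sigma_algebraType (F s))).
  by rewrite [X in X _]measurable_g_measurableTypeE.
exact: (@measurable_indic _ (g_sigma_algebraType (F s)) R setT A mA).
Qed.

End adapted_functions.

Lemma grid_le (R : realType) (n : nat) (s : nat -> R) :
  (forall i, (i < n)%N -> s i <= s i.+1) ->
  forall j k, (j <= k)%N -> (k <= n)%N -> s j <= s k.
Proof.
move=> ns j; elim=> [|k IH]; first by rewrite leqn0 => /eqP ->.
rewrite leq_eqVlt => /predU1P[->//|jk] kn.
by apply: (le_trans (IH jk (ltnW kn))); exact: ns.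
Qed.

Section simple_exponential_martingale.
Context d (T : measurableType d) (R : realType) (P : probability T R) (t0 : R)
  (F : R -> set (set T)) (W : R -> T -> R).
Hypotheses (hF : filtration t0 F) (hW : brownian_motion P t0 F W).

Lemma Fmeas_brownian (s : R) : t0 <= s -> Fmeas F s (W s).
Proof.
by move=> t0s; apply/(FmeasP hF) => //; case: hW => + _ _ _ _; exact.
Qed.

Lemma measurable_brownian (s : R) : t0 <= s -> measurable_fun setT (W s).
Proof. by move=> t0s; apply: (Fmeas_measurable hF t0s); exact: Fmeas_brownian. Qed.

(** The pair [(z, x)] is measurable at time [s], hence independent of the increment after [s];
    integrating the increment first leaves a Gaussian exponential of mean 1. *)
Lemma exponential_martingale_step (s t : R) (z x : T -> R) :
  t0 <= s -> s <= t -> Fmeas F s z -> Fmeas F s x -> (forall w, 0 <= z w) ->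
  (\int[P]_w (z w * expR (x w * (W t w - W s w) - x w ^+ 2 * (t - s) / 2))%:E
   = \int[P]_w (z w)%:E)%E.
Proof.
move=> t0s; rewrite le_eqVlt => /predU1P[<-|st] mz mx z0.
  by apply: eq_integral => w _; rewrite !subrr !mulr0 mul0r subrr expR0 mulr1.
have [adW _ _ nW iW] := hW.
have mz' := Fmeas_measurable hF t0s mz.
have mx' := Fmeas_measurable hF t0s mx.
have mV : measurable_fun setT (fun w => W t w - W s w).
  by apply: measurable_funB; apply: measurable_brownian => //; lra.
(* [indep_integral] asks for nonnegativity on the whole product space, not only on the range of [z];
   hence the absolute value. *)
pose f (y : (R * R) * measurableTypeR R) : \bar R :=
  (`|y.1.1| * expR (y.1.2 * y.2 - y.1.2 ^+ 2 * (t - s) / 2))%:E.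
have m1 : measurable_fun setT (fun y : (R * R) * measurableTypeR R => y.1.2).
  by apply: measurableT_comp => //; exact: measurable_snd.
have m11 : measurable_fun setT (fun y : (R * R) * measurableTypeR R => y.1.1).
  by apply: measurableT_comp => //; exact: measurable_fst.
have mf : measurable_fun setT f.
  apply/measurable_EFinP/measurable_funM; first exact: measurableT_comp.
  apply: measurableT_comp => //; apply: measurable_funB.
    exact: measurable_funM.
  by apply: measurable_funM => //; apply: measurable_funM => //;
    apply: measurable_funX.
have mY : measurable_fun setT (fun w => (z w, x w)).
  exact: measurable_fun_pair.
transitivity (\int[P]_w f ((z w, x w), (W t w - W s w)%R))%E.
  by apply: eq_integral => w _; rewrite /f/= ger0_norm.
rewrite (@indep_integral _ _ _ _ _ (measurableTypeR R) _ _ _ _ (normal_prob 0 (Num.sqrt (t - s)))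
  f mY mV (nW s t t0s st))//; last 2 first.
- move=> A B mA mB; apply: (iW s t) => //; last first.
    by exists B => //; rewrite setTI.
  have mYF : measurable_fun (setT : set (g_sigma_algebraType (F s)))
      (fun w : g_sigma_algebraType (F s) => (z w, x w)).
    exact: measurable_fun_pair.
  have := mYF measurableT A mA.
  by rewrite [X in X _]measurable_g_measurableTypeE ?setTI//; exact: (hF.1 s t0s).1.
- by move=> y; rewrite lee_fin mulr_ge0// expR_ge0.
apply: eq_integral => w _.
rewrite /f/= ger0_norm//.
under eq_integral do rewrite EFinM.
rewrite ge0_integralZl_EFin//.
- by rewrite normal_prob_exp_martingale ?mule1// subr_gt0.
- apply/measurable_EFinP; apply: measurableT_comp => //.
  by apply: measurable_funB => //; exact: measurable_funM.
Qed.

(** Induction peels off the last increment: all earlier factors are absorbed into the nonnegative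
    weight, which is measurable at time [s n]. *)
Lemma exponential_martingale_grid (n : nat) (s : nat -> R)
    (c : nat -> T -> R) (z : T -> R) :
  t0 <= s 0%N -> (forall i, (i < n)%N -> s i <= s i.+1) ->
  (forall i, (i < n)%N -> Fmeas F (s i) (c i)) ->
  Fmeas F (s 0%N) z -> (forall w, 0 <= z w) ->
  (\int[P]_w (z w * expR (\sum_(i < n) (c i w * (W (s i.+1) w - W (s i) w)
     - c i w ^+ 2 * (s i.+1 - s i) / 2)))%:E
   = \int[P]_w (z w)%:E)%E.
Proof.
move=> t0s; elim: n => [|n IH] ns mc mz z0.
  by apply: eq_integral => w _; rewrite big_ord0 expR0 mulr1.
have mono := grid_le ns.
rewrite -IH//; last 2 first.
- by move=> i ni; apply: ns; exact: ltnW.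
- by move=> i ni; apply: mc; exact: ltnW.
pose e w := expR (\sum_(i < n) (c i w * (W (s i.+1) w - W (s i) w)
     - c i w ^+ 2 * (s i.+1 - s i) / 2)).
rewrite -(@exponential_martingale_step (s n) (s n.+1) (fun w => z w * e w) (c n)).
- apply: eq_integral => w _; rewrite -mulrA /e -expRD.
  by rewrite big_ord_recr.
- by apply: (le_trans t0s); apply: mono.
- exact: ns.
- apply: measurable_funM.
    by apply: (Fmeas_le hF t0s _ mz); apply: mono.
  apply: measurableT_comp => //.
  apply: measurable_sum => i.
  have t0i k : (k <= n)%N -> t0 <= s k.
    by move=> kn; apply: (le_trans t0s); apply: mono => //; exact: leqW.
  have mci : Fmeas F (s n) (c i).
    have i_n := ltn_ord i.
    apply: (Fmeas_le hF (t0i _ (ltnW i_n)) _ (mc _ (ltnW _))) => //.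
    by apply: mono; exact: ltnW.
  have mW k : (k <= n)%N -> Fmeas F (s n) (W (s k)).
    by move=> kn; apply: (Fmeas_le hF _ _ (Fmeas_brownian _)); [exact: t0i|apply: mono; [|exact: leqnSn]|exact: t0i].
  apply: measurable_funB.
    apply: measurable_funM => //; apply: measurable_funB; apply: mW => //.
    exact: ltnW.
  by apply: measurable_funM => //; apply: measurable_funM => //; exact: measurable_funX.
- exact: mc.
- by move=> w; rewrite mulr_ge0// expR_ge0.
Qed.

End simple_exponential_martingale.

Lemma sorted_grid (R : realType) (x0 : R) (pts : seq R) :
  exists n (s : nat -> R), [/\ forall i, (i < n)%N -> s i <= s i.+1,
    forall x, x \in x0 :: pts -> exists2 k, (k <= n)%N & s k = x
  & s 0%N \in x0 :: pts].
Proof.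
pose l := sort <=%O (x0 :: pts).
have sl : size l = (size pts).+1 by rewrite size_sort.
exists (size pts), (nth x0 l); split.
- move=> i ni; apply: sorted_leq_nth => //.
  + exact: le_trans.
  + exact: sort_le_sorted.
  + by rewrite inE sl; exact: ltnW.
  + by rewrite inE sl.
- move=> x; rewrite -(mem_sort <=%O) -/l => xl.
  exists (index x l); last exact: nth_index.
  by rewrite -ltnS -sl index_mem.
- by rewrite -(mem_sort <=%O) mem_nth// sl.
Qed.

Section grid_sums.
Context (R : realType) (n : nat) (s : nat -> R).
Hypothesis ns : forall i, (i < n)%N -> s i <= s i.+1.

(** The sum runs over the whole grid, so that an interval can be selected by a condition on [s j.+1]
    alone. Grid points may repeat: an index beyond [k] that passes the test has a zero increment. *)
Lemma telescope_le (f : R -> R) (k : nat) : (k <= n)%N ->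
  \sum_(j < n) (s j.+1 <= s k)%R%:R * (f (s j.+1) - f (s j))
  = f (s k) - f (s 0%N).
Proof.
move=> kn; rewrite -(big_mkord predT (fun j => (s j.+1 <= s k)%R%:R * (f (s j.+1) - f (s j)))).
rewrite (big_cat_nat (leq0n k) kn)//= [X in _ + X]big1_seq ?addr0; last first.
  move=> j /andP[_]; rewrite mem_index_iota => /andP[kj jn].
  have [jk|] := boolP (s j.+1 <= s k); last by rewrite mul0r.
  have h1 : s k <= s j by apply: (grid_le ns) => //; exact: ltnW.
  have -> : s j.+1 = s j by apply/le_anti; rewrite (ns jn) (le_trans jk h1).
  by rewrite subrr mulr0.
under eq_big_nat => j /andP[_ jk].
  rewrite (_ : s j.+1 <= s k) ?mul1r; last exact: (grid_le ns).
  over.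
by rewrite telescope_sumr.
Qed.

Lemma telescope_indic (f : R -> R) (k l : nat) : (k <= n)%N -> (l <= n)%N ->
  s k <= s l ->
  \sum_(j < n) \1_`]s k, s l] (s j.+1) * (f (s j.+1) - f (s j))
  = f (s l) - f (s k).
Proof.
move=> kn ln kl.
have -> : f (s l) - f (s k) = (f (s l) - f (s 0%N)) - (f (s k) - f (s 0%N)).
  by ring.
rewrite -!telescope_le// -sumrB; apply: eq_bigr => j _.
rewrite -mulrBl indicE mem_setE/= in_itv/=; congr (_ * _).
case: (leP (s j.+1) (s k)) => jk; last by rewrite subr0.
by rewrite (le_trans jk kl) subrr.
Qed.

End grid_sums.

Section elementary_processes.
Context (T : Type) (R : realType).

(* Unlike in [step_process], the intervals may overlap and the coefficients need
   not be bounded, which makes the integral visibly linear in the integrand. *)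
Record eproc := EProc {
  eidx : finType;
  eleft : eidx -> R;
  eright : eidx -> R;
  ecoef : eidx -> T -> R }.

Definition evalue (E : eproc) (s : R) (w : T) : R :=
  \sum_i @ecoef E i w * \1_`]eleft i, eright i] s.

Definition eint (W : R -> T -> R) (E : eproc) (w : T) : R :=
  \sum_i @ecoef E i w * (W (eright i) w - W (eleft i) w).

End elementary_processes.

Section elementary_integral.
Context d (T : measurableType d) (R : realType) (P : probability T R) (t0 : R)
  (F : R -> set (set T)) (W : R -> T -> R).
Hypotheses (hF : filtration t0 F) (hW : brownian_motion P t0 F W).

Definition eadapted (E : eproc T R) := forall i : eidx E,
  [/\ t0 <= eleft i, eleft i <= eright i & Fmeas F (eleft i) (ecoef i)].

Lemma measurable_evalue (E : eproc T R) (w : T) :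
  measurable_fun setT (evalue E ^~ w).
Proof. by apply: measurable_sum => i; apply: measurable_funM. Qed.

Lemma measurable_eint (E : eproc T R) : eadapted E ->
  measurable_fun setT (eint W E).
Proof.
move=> aE; apply: measurable_sum => i; have [t0i lr mi] := aE i.
apply: measurable_funM; first exact: (Fmeas_measurable hF t0i).
by apply: measurable_funB; apply: (measurable_brownian hF hW) => //;
  exact: le_trans lr.
Qed.

(** The intervals are open on the left and closed on the right, so the right end of a cell with no
    endpoint inside it represents the whole cell. *)
Lemma evalue_const (E : eproc T R) (x y : R) (w : T) : x <= y ->
  (forall i : eidx E, (eleft i <= x) || (y <= eleft i)) ->
  (forall i : eidx E, (eright i <= x) || (y <= eright i)) ->
  forall s, x < s -> s <= y -> evalue E s w = evalue E y w.
Proof.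
move=> xy hl hr s xs sy; apply: eq_bigr => i _; congr (_ * _).
rewrite !indicE !mem_setE/= !in_itv/=; congr (nat_of_bool _)%:R.
congr andb.
- have /orP[h|h] := hl i; first by rewrite !(le_lt_trans h)// (lt_le_trans xs).
  by rewrite !ltNge h (le_trans sy h).
- have /orP[h|h] := hr i; last by rewrite h (le_trans sy h).
  rewrite !leNgt (le_lt_trans h xs)/=; apply/esym.
  by rewrite (le_lt_trans h)// (lt_le_trans xs).
Qed.

(** Overlapping intervals are cut along the sorted list of all their endpoints. This recovers a
    genuine step process, for which the integral is a martingale sum and the energy is a finite
    sum. *)
Lemma eproc_grid (E : eproc T R) : eadapted E ->
  exists n (s : nat -> R) (c : nat -> T -> R),
  [/\ t0 <= s 0%N, forall i, (i < n)%N -> s i <= s i.+1,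
      forall i, (i < n)%N -> Fmeas F (s i) (c i),
      forall w, eint W E w = \sum_(i < n) c i w * (W (s i.+1) w - W (s i) w)
    & forall w, (\int[lebesgue_measure]_s ((evalue E s w) ^+ 2)%:E
                = (\sum_(i < n) c i w ^+ 2 * (s i.+1 - s i))%:E)%E].
Proof.
move=> aE.
have [n [s [ns gs s0]]] := sorted_grid t0
  ([seq eleft i | i : eidx E] ++ [seq eright i | i : eidx E]).
have gl i : exists2 k, (k <= n)%N & s k = @eleft _ _ E i.
  by apply: gs; rewrite inE mem_cat map_f ?orbT// mem_enum.
have gr i : exists2 k, (k <= n)%N & s k = @eright _ _ E i.
  by apply: gs; rewrite inE mem_cat map_f ?orbT// mem_enum.
have t0s : t0 <= s 0%N.
  move: s0; rewrite inE mem_cat => /or3P[/eqP ->//|/mapP[i _ ->]|/mapP[i _ ->]].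
    by have [] := aE i.
  by have [t0i lr _] := aE i; exact: le_trans lr.
have sep j x : (j < n)%N -> (exists2 k, (k <= n)%N & s k = x) ->
    (x <= s j) || (s j.+1 <= x).
  move=> jn [k kn <-]; have [kj|jk] := leqP k j.
    by rewrite (grid_le ns)// ltnW.
  by rewrite (grid_le ns jk kn) orbT.
(* The coefficient on cell [j] is read at its right end, yet is known at its left end: an interval
   containing [s j.+1] starts strictly before it, hence at [s j] or earlier. *)
exists n, s, (fun j => evalue E (s j.+1)); split => //.
- move=> j jn; apply: measurable_sum => i.
  have [t0i lr mi] := aE i.
  rewrite indicE mem_setE/= in_itv/=.
  have [ij|] := boolP (eleft i < s j.+1); last first.
    move=> _ /=; under eq_fun do rewrite mulr0.
    exact: measurable_cst.
  have /orP[h|h] := sep j _ jn (gl i); last by rewrite ltNge h in ij.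
  apply: measurable_funM => //.
  exact: (Fmeas_le hF t0i h mi).
- move=> w; transitivity (\sum_(i : eidx E) \sum_(j < n)
      ecoef i w * (\1_`]eleft i, eright i] (s j.+1) * (W (s j.+1) w - W (s j) w))).
    apply: eq_bigr => i _; rewrite -big_distrr/=; congr (_ * _).
    have [k kn sk] := gl i; have [l ln sl] := gr i.
    rewrite -sk -sl (telescope_indic ns (fun x => W x w))// sk sl.
    by have [] := aE i.
  rewrite exchange_big; apply: eq_bigr => j _.
  by rewrite /evalue big_distrl/=; apply: eq_bigr => i _; rewrite mulrA.
- move=> w.
  have mE2 : measurable_fun setT (fun x => ((evalue E x w) ^+ 2)%:E).
    apply/measurable_EFinP; apply: measurable_funX.
    exact: measurable_evalue.
  have E20 x : (0 <= ((evalue E x w) ^+ 2)%:E)%E by rewrite lee_fin sqr_ge0.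
  have key k : (k <= n)%N ->
      (\int[lebesgue_measure]_(x in `]s 0%N, s k]) ((evalue E x w) ^+ 2)%:E
       = (\sum_(j < k) (evalue E (s j.+1) w) ^+ 2 * (s j.+1 - s j))%:E)%E.
    elim: k => [|k IH] kn.
      by rewrite big_ord0 set_itv_ge ?bnd_simp ?ltxx// integral_set0.
    have s0k : s 0%N <= s k by apply: (grid_le ns) => //; exact: ltnW.
    have skk := ns _ kn.
    rewrite (@itv_bndbnd_setU _ _ _ (BRight (s k))) ?bnd_simp//.
    rewrite ge0_integral_setU//=; last 2 first.
    + exact: measurable_funTS.
    + rewrite disj_set2E; apply/eqP/seteqP; split => // x [] /=.
      rewrite !in_itv/= => /andP[_ h] /andP[h' _].
      by move: (le_lt_trans h h'); rewrite ltxx.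
    rewrite IH 1?ltnW// big_ord_recr/= EFinD; congr (_ + _)%E.
    rewrite (eq_integral (fun=> ((evalue E (s k.+1) w) ^+ 2)%:E)); last first.
      move=> x; rewrite inE/= in_itv/= => /andP[kx xk].
      congr (_ ^+ 2)%:E; apply: evalue_const kx xk => // i; exact: sep.
    rewrite integral_cst//= lebesgue_measure_itv/= lte_fin.
    move: skk; rewrite le_eqVlt => /predU1P[->|->].
      by rewrite ltxx subrr mulr0 mule0.
    by rewrite -EFinB -EFinM.
  rewrite -key// [RHS]integral_mkcond; apply: eq_integral => x _.
  rewrite patchE; case: ifPn => //; rewrite notin_setE/= in_itv/= => /negP h.
  rewrite /evalue big1 ?expr0n// => i _.
  have [k kn sk] := gl i; have [l ln sl] := gr i.
  rewrite indicE mem_setE/= in_itv/= -sk -sl.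
  have [|_] := boolP (_ && _); last by rewrite mulr0.
  move=> /andP[kx xl]; exfalso; move/negP : h; apply; apply/andP; split.
    by apply: le_lt_trans kx; exact: (grid_le ns).
  by apply: (le_trans xl); exact: (grid_le ns).
Qed.

(** [Q] is the energy as a real-valued measurable function, so that it can stand in an exponent and
    define an event; it is chosen before [l]. *)
Lemma eproc_exp_martingale (E : eproc T R) : eadapted E ->
  exists Q : T -> R, [/\ measurable_fun setT Q,
    forall w, (\int[lebesgue_measure]_s ((evalue E s w) ^+ 2)%:E = (Q w)%:E)%E
  & forall l : R,
    (\int[P]_w (expR (l * eint W E w - l ^+ 2 * Q w / 2))%:E = 1)%E].
Proof.
move=> /eproc_grid[n [s [c [t0s ns mc iE QE]]]].
have t0i k : (k <= n)%N -> t0 <= s k.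
  by move=> kn; apply: (le_trans t0s); exact: (grid_le ns).
exists (fun w => \sum_(i < n) c i w ^+ 2 * (s i.+1 - s i)); split => //.
  apply: measurable_sum => i; apply: measurable_funM => //.
  apply: measurable_funX; apply: (Fmeas_measurable hF (s := s i)) => //.
    by apply: t0i; exact: ltnW.
  exact: mc.
move=> l; rewrite -[RHS](@probability_setT _ _ _ P) -[RHS]mul1e -integral_cst//.
rewrite -[RHS](@exponential_martingale_grid _ _ _ _ _ _ _ hF hW n s
  (fun i w => l * c i w) (cst 1))//.
- apply: eq_integral => w _; rewrite mul1r iE; congr (expR _)%:E.
  rewrite mulr_sumr mulr_sumr mulr_suml -sumrB; apply: eq_bigr => i _.
  by rewrite exprMn; ring.
- by move=> i ni; apply: measurable_funM => //; exact: mc.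
- exact: measurable_cst.
Qed.

End elementary_integral.

(** * Stochastic integrals as limits in probability *)

Lemma measureU_le d (T : measurableType d) (R : realType)
    (P : probability T R) (A B : set T) (a b : \bar R) :
  measurable A -> measurable B -> (P A <= a -> P B <= b ->
    P (A `|` B) <= a + b)%E.
Proof.
by move=> mA mB Aa Bb; apply: (le_trans (measureU2 _ _ _)) => //; exact: leeD.
Qed.

Lemma ge0_markov d (T : measurableType d) (R : realType)
    (P : probability T R) (f : T -> R) (c : R) (B : set T) :
  measurable_fun setT f -> (forall w, 0 <= f w) -> 0 <= c -> measurable B ->
  (forall w, B w -> c <= f w) -> (c%:E * P B <= \int[P]_w (f w)%:E)%E.
Proof.
move=> mf f0 c0 mB Bf.
rewrite -integral_cst//.
apply: (@le_trans _ _ (\int[P]_(w in B) (f w)%:E)%E).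
  apply: ge0_le_integral => //.
  by apply/measurable_EFinP; exact: measurable_funTS.
apply: ge0_subset_integral => //.
  exact/measurable_EFinP.
by move=> w _; rewrite lee_fin.
Qed.

Section ito_limits.
Context d (T : measurableType d) (R : realType) (P : probability T R) (t0 : R)
  (F : R -> set (set T)) (W : R -> T -> R).
Hypotheses (hF : filtration t0 F) (hW : brownian_motion P t0 F W).
Implicit Types (G H K : R -> T -> R) (I : T -> R).

(** The integral is over the whole line: the time horizon is carried by an indicator in the
    integrand, which lets integrals over different horizons be combined linearly. *)
Definition energy G (w : T) : \bar R :=
  (\int[lebesgue_measure]_s ((G s w) ^+ 2)%:E)%E.

Lemma energy_le G H w : measurable_fun setT (G ^~ w) ->
  measurable_fun setT (H ^~ w) -> (forall s, `|G s w| <= `|H s w|) ->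
  (energy G w <= energy H w)%E.
Proof.
move=> mG mH GH; apply: ge0_le_integral => //.
- by move=> s _; rewrite lee_fin sqr_ge0.
- by apply/measurable_EFinP; exact: measurable_funX.
- by apply/measurable_EFinP; exact: measurable_funX.
- by move=> s _; rewrite lee_fin -(real_normK (num_real (G s w)))
    -(real_normK (num_real (H s w))) lerXn2r// nnegrE.
Qed.

Lemma energy_lin (c : R) G H K w (g h : R) : measurable_fun setT (G ^~ w) ->
  measurable_fun setT (H ^~ w) -> (forall s, K s w = c * G s w + H s w) ->
  (energy G w <= g%:E)%E -> (energy H w <= h%:E)%E ->
  (energy K w <= (2 * c ^+ 2 * g + 2 * h)%:E)%E.
Proof.
move=> mG mH KE Gg Hh.
have mG2 : measurable_fun setT (fun s => ((G s w) ^+ 2)%:E).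
  by apply/measurable_EFinP; exact: measurable_funX.
have mH2 : measurable_fun setT (fun s => ((H s w) ^+ 2)%:E).
  by apply/measurable_EFinP; exact: measurable_funX.
have G20 s : (0 <= ((G s w) ^+ 2)%:E)%E by rewrite lee_fin sqr_ge0.
have H20 s : (0 <= ((H s w) ^+ 2)%:E)%E by rewrite lee_fin sqr_ge0.
apply: (@le_trans _ _ (\int[lebesgue_measure]_s
   ((2 * c ^+ 2)%:E * ((G s w) ^+ 2)%:E + 2%:E * ((H s w) ^+ 2)%:E))%E).
  apply: ge0_le_integral => //.
  - by move=> s _; rewrite lee_fin sqr_ge0.
  - apply/measurable_EFinP; apply: measurable_funX.
    under eq_fun do rewrite KE.
    by apply: measurable_funD => //; exact: measurable_funM.
  - by apply: emeasurable_funD; exact: measurable_funeM.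
  - move=> s _; rewrite KE -!EFinM -EFinD lee_fin.
    have := sqr_ge0 (c * G s w - H s w); rewrite !expr2; lra.
have c2 : 0 <= 2 * c ^+ 2 by rewrite mulr_ge0// sqr_ge0.
rewrite ge0_integralD//; last 4 first.
- by move=> s _; rewrite mule_ge0.
- exact: measurable_funeM.
- by move=> s _; rewrite mule_ge0.
- exact: measurable_funeM.
rewrite !ge0_integralZl_EFin//.
have -> : (2 * c ^+ 2 * g + 2 * h)%:E = ((2 * c ^+ 2)%:E * g%:E + 2%:E * h%:E)%E.
  by [].
by apply: leeD; apply: lee_wpmul2l; rewrite // lee_fin.
Qed.

(** An epsilon form of joint convergence in probability, of the integrands in energy and of the
    elementary integrals. A single [e] and a single exceptional event serve for both. *)
Definition ito_limit G I := (forall w, measurable_fun setT (G ^~ w)) /\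
  forall e : R, 0 < e -> exists E : eproc T R, eadapted t0 F E /\
    exists B : set T, [/\ measurable B, (P B <= e%:E)%E
      & forall w, ~ B w -> (energy (fun s w => evalue E s w - G s w)%R w <= e%:E)%E
          /\ `|eint W E w - I w| <= e].

Lemma ito_limit_eproc (E : eproc T R) : eadapted t0 F E ->
  ito_limit (evalue E) (eint W E).
Proof.
move=> aE; split; first by move=> w; exact: measurable_evalue.
move=> e e0; exists E; split => //; exists set0; split => //.
  by rewrite measure0 lee_fin ltW.
move=> w _; rewrite subrr normr0; split; last exact: ltW.
rewrite /energy; under eq_integral do rewrite subrr expr0n/=.
by rewrite integral0 lee_fin ltW.
Qed.

(** The disjoint union of the index types gives linear combinations with no common refinement of the
    intervals. *)
Definition elin (c : R) (E1 E2 : eproc T R) : eproc T R :=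
  @EProc _ _ (eidx E1 + eidx E2)%type
    (fun i => match i with inl i => eleft i | inr i => eleft i end)
    (fun i => match i with inl i => eright i | inr i => eright i end)
    (fun i => match i with inl i => fun w => c * ecoef i w | inr i => ecoef i end).

Lemma evalue_elin c E1 E2 s w :
  evalue (elin c E1 E2) s w = c * evalue E1 s w + evalue E2 s w.
Proof.
rewrite /evalue big_sumType/= mulr_sumr; congr (_ + _).
by apply: eq_bigr => i _; rewrite mulrA.
Qed.

Lemma eint_elin c E1 E2 w :
  eint W (elin c E1 E2) w = c * eint W E1 w + eint W E2 w.
Proof.
rewrite /eint big_sumType/= mulr_sumr; congr (_ + _).
by apply: eq_bigr => i _; rewrite mulrA.
Qed.

Lemma eadapted_elin c E1 E2 : eadapted t0 F E1 -> eadapted t0 F E2 ->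
  eadapted t0 F (elin c E1 E2).
Proof.
move=> a1 a2 [i|i]/=; last exact: a2.
have [? ? ?] := a1 i; split => //; exact: measurable_funM.
Qed.

Lemma ito_limit_lin c G1 G2 I1 I2 : ito_limit G1 I1 -> ito_limit G2 I2 ->
  ito_limit (fun s w => c * G1 s w + G2 s w) (fun w => c * I1 w + I2 w).
Proof.
move=> [mG1 h1] [mG2 h2]; split.
  by move=> w; apply: measurable_funD => //; exact: measurable_funM.
(* With [e1 = e / k], the budget [e] covers the probability [2 e1], the energy [2 c^2 e1 + 2 e1] and
   the integral error [|c| e1 + e1]. *)
move=> e e0; have k0 : 0 < 2 * c ^+ 2 + `|c| + 4.
  by have := sqr_ge0 c; have := normr_ge0 c; lra.
set k := 2 * c ^+ 2 + `|c| + 4 in k0.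
have e1k : e / k * k = e by rewrite divfK// gt_eqF.
have e10 : 0 < e / k by exact: divr_gt0.
set e1 := e / k in e1k e10.
have ce0 : 0 <= c ^+ 2 * e1 by rewrite mulr_ge0 ?sqr_ge0// ltW.
have ne0 : 0 <= `|c| * e1 by rewrite mulr_ge0// ltW.
have ek : 2 * (c ^+ 2 * e1) + `|c| * e1 + 4 * e1 = e.
  by rewrite -e1k /k; ring.
have [E1 [a1 [B1 [mB1 PB1 H1]]]] := h1 _ e10.
have [E2 [a2 [B2 [mB2 PB2 H2]]]] := h2 _ e10.
exists (elin c E1 E2); split; first exact: eadapted_elin.
exists (B1 `|` B2); split; first exact: measurableU.
  apply: (le_trans (measureU_le mB1 mB2 PB1 PB2)).
  by rewrite -EFinD lee_fin; lra.
move=> w /not_orP[/H1[g1 i1] /H2[g2 i2]]; split.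
  apply: (@le_trans _ _ (2 * c ^+ 2 * e1 + 2 * e1)%:E); last first.
    by rewrite lee_fin; lra.
  apply: (energy_lin _ _ _ g1 g2).
  - by apply: measurable_funB => //; exact: measurable_evalue.
  - by apply: measurable_funB => //; exact: measurable_evalue.
  - by move=> s; rewrite evalue_elin; ring.
rewrite eint_elin (_ : _ - _ = c * (eint W E1 w - I1 w) + (eint W E2 w - I2 w)); last by ring.
apply: (le_trans (ler_normD _ _)); rewrite normrM.
have := ler_wpM2l (normr_ge0 c) i1; lra.
Qed.

(* By the exponential martingale with parameter [l] and [- l], an elementary
   integral is large with small probability where its energy is small; no
   localisation by stopping times is required. *)
Lemma ito_limit_small (e : R) : 0 < e -> exists2 dl : R, 0 < dl &
  forall G I, ito_limit G I -> forall B0, measurable B0 ->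
    (forall w, ~ B0 w -> (energy G w <= dl%:E)%E) ->
    exists B, [/\ measurable B, (P B <= P B0 + e%:E)%E
      & forall w, ~ B w -> `|I w| <= e].
Proof.
move=> e0.
(* Chosen so that [l * (e / 2) = 1 + 8 / e], while [dl] below makes [l^2 * (4 dl) / 2 = 1]. On the
   bad event the exponent is then at least [8 / e], and Markov's inequality with
   [exp(8 / e) >= 8 / e] bounds its probability by [e / 8] for each sign. *)
pose l := 2 * (1 + 8 / e) / e.
have e80 : 0 < 8 / e by exact: divr_gt0.
have l0 : 0 < l by rewrite divr_gt0// mulr_gt0//; lra.
pose dl := (2 * l ^+ 2)^-1.
have l20 : 0 < 2 * l ^+ 2 by rewrite mulr_gt0// exprn_gt0.
have dl0 : 0 < dl by rewrite invr_gt0.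
exists dl => // G I [mG hGI] B0 mB0 GB0.
pose e1 := Num.min dl (e / 4).
have e10 : 0 < e1 by rewrite lt_min dl0 divr_gt0.
have e1dl : e1 <= dl by rewrite ge_min lexx.
have e1e : e1 <= e / 4 by rewrite ge_min lexx orbT.
have [E [aE [B1 [mB1 PB1 H1]]]] := hGI _ e10.
have [Q [mQ QE ZE]] := eproc_exp_martingale hF hW aE.
have mI := measurable_eint hF hW aE.
pose S (u : R) := [set w | e / 2 < u * eint W E w] `&` [set w | Q w <= 4 * dl].
have mS u : measurable (S u).
  apply: measurableI.
    rewrite -[X in measurable X]setTI -preimage_itvoy.
    by apply: measurable_funM.
  by rewrite -[X in measurable X]setTI -preimage_itvNyc; exact: mQ.
have PS u : u = 1 \/ u = -1 -> (P (S u) <= (e / 8)%:E)%E.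
  move=> u1; have u2 : u ^+ 2 = 1 by case: u1 => ->; rewrite ?sqrrN expr1n.
  pose m := expR (8 / e).
  have m0 : 0 < m by exact: expR_gt0.
  have : (m%:E * P (S u) <= 1)%E.
    rewrite -(ZE (l * u)); apply: ge0_markov => //.
    - apply: measurableT_comp => //; apply: measurable_funB.
        exact: measurable_funM.
      by apply: measurable_funM => //; exact: measurable_funM.
    - exact: ltW.
    - move=> w [/= uE Qw]; rewrite ler_expR exprMn u2 mulr1.
      have h1 : l * (e / 2) <= l * (u * eint W E w) by rewrite ler_pM2l// ltW.
      have h2 : l * (e / 2) = 1 + 8 / e.
        by rewrite /l; field; rewrite gt_eqF.
      have h3 : l ^+ 2 * Q w <= l ^+ 2 * (4 * dl) by rewrite ler_pM2l// exprn_gt0.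
      have h4 : l ^+ 2 * (4 * dl) = 2.
        by rewrite /dl; field; rewrite gt_eqF.
      by rewrite -mulrA; lra.
  rewrite -(@fineK _ (P (S u))) ?fin_num_measure// -EFinM !lee_fin => mP.
  have P0 : 0 <= fine (P (S u)) by exact: fine_ge0.
  have : (8 / e) * fine (P (S u)) <= 1.
    apply: le_trans mP; apply: ler_wpM2r => //.
    by apply: le_trans (expR_ge1Dx _); lra.
  by move=> h; rewrite -ler_pdivlMl// mulr1 invf_div in h.
exists (B0 `|` (B1 `|` (S 1 `|` S (-1)))); split.
- by do 3? apply: measurableU.
- apply: measureU_le => //; first by do 2? apply: measurableU.
  have -> : e = e / 4 + (e / 8 + e / 8) + e / 2 by field.
  rewrite 2!EFinD; apply: (@le_trans _ _ ((e / 4)%:E + (e / 8 + e / 8)%:E)%E).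
    apply: measureU_le => //; first exact: measurableU.
      by apply: (le_trans PB1); rewrite lee_fin.
    by rewrite EFinD; apply: measureU_le => //; apply: PS; [left|right].
  by rewrite leeDl// lee_fin; lra.
- move=> w /not_orP[nB0 /not_orP[/H1[gE iE] /not_orP[n1 n2]]].
  have Qw : Q w <= 4 * dl.
    (* The approximant is [G] plus an error of energy at most [e1 <= dl], so its energy is at most
       [4 dl], the threshold in [S]. *)
    rewrite -lee_fin -QE; apply: (@le_trans _ _ (2 * 1 ^+ 2 * e1 + 2 * dl)%:E).
      apply: (energy_lin _ _ _ gE (GB0 _ nB0)) => //.
        by apply: measurable_funB => //; exact: measurable_evalue.
      by move=> s /=; ring.
    by rewrite lee_fin; lra.
  have a1 : eint W E w <= e / 2.
    rewrite leNgt; apply/negP => h; apply: n1; split => //=.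
    by rewrite mul1r.
  have a2 : - (eint W E w) <= e / 2.
    rewrite leNgt; apply/negP => h; apply: n2; split => //=.
    by rewrite mulN1r.
  move: iE; rewrite !ler_norml => /andP[i1 i2]; apply/andP; split; lra.
Qed.

End ito_limits.

(** * Uniform grids and joint measurability of continuous processes *)

Definition ugrid (R : realType) (r r' : R) (n i : nat) : R :=
  r + i%:R * ((r' - r) / n%:R).

Section uniform_grids.
Context (R : realType).
Implicit Types (r x : R).

Lemma ugrid0 r r' n : ugrid r r' n 0 = r.
Proof. by rewrite /ugrid mul0r addr0. Qed.

Lemma ugridn r r' n : (0 < n)%N -> ugrid r r' n n = r'.
Proof.
by move=> n0; rewrite /ugrid mulrC divfK ?pnatr_eq0 -?lt0n//; ring.
Qed.

Lemma ugrid_step r r' n i :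
  ugrid r r' n i.+1 = ugrid r r' n i + (r' - r) / n%:R.
Proof. by rewrite /ugrid -natr1; ring. Qed.

Lemma ugrid_leS r r' n i : r <= r' -> ugrid r r' n i <= ugrid r r' n i.+1.
Proof. by move=> rr'; rewrite ugrid_step lerDl divr_ge0// subr_ge0. Qed.

Lemma ugrid_le r r' n i j : r <= r' -> (i <= j)%N ->
  ugrid r r' n i <= ugrid r r' n j.
Proof.
by move=> rr' ij; apply: (@grid_le _ j) => // k _; exact: ugrid_leS.
Qed.

Lemma ugrid_bounds r r' n i : r <= r' -> (0 < n)%N -> (i <= n)%N ->
  r <= ugrid r r' n i <= r'.
Proof.
move=> rr' n0 ni; rewrite -{1}(ugrid0 r r' n) ugrid_le//=.
by rewrite -{2}(ugridn r r' n0) ugrid_le.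
Qed.

Lemma grid_locate (n : nat) (s : nat -> R) x : s 0%N < x -> x <= s n ->
  exists2 i, (i < n)%N & s i < x <= s i.+1.
Proof.
elim: n => [|n IH] s0 sn; first by move: (lt_le_trans s0 sn); rewrite ltxx.
have [xn|xn] := leP x (s n); last by exists n; rewrite ?xn.
by have [i ni ix] := IH s0 xn; exists i => //; exact: ltnW.
Qed.

Lemma grid_step_value (n : nat) (s : nat -> R) (c : nat -> R) x (i : nat) :
  (forall j, (j < n)%N -> s j <= s j.+1) -> (i < n)%N -> s i < x <= s i.+1 ->
  \sum_(j < n) c j * \1_`]s j, s j.+1] x = c i.
Proof.
move=> ns ni ix; rewrite (bigD1 (Ordinal ni))//= big1 ?addr0.
  by rewrite indicE mem_setE/= in_itv/= ix mulr1.
move=> j ij; rewrite indicE mem_setE/= in_itv/=.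
have /andP[ix1 ix2] := ix.
have [ji|ij'|jE] := ltngtP j i.
- have h := grid_le ns ji (ltnW ni).
  by rewrite [x <= _]leNgt (le_lt_trans h ix1) andbF mulr0.
- have h := grid_le ns ij' (ltnW (ltn_ord j)).
  by rewrite ltNge (le_trans ix2 h) mulr0.
- by move: ij; rewrite -val_eqE /= jE eqxx.
Qed.

Lemma grid_step_value_out (n : nat) (s : nat -> R) (c : nat -> R) x :
  (forall j, (j < n)%N -> s j <= s j.+1) -> ~~ (s 0%N < x <= s n) ->
  \sum_(j < n) c j * \1_`]s j, s j.+1] x = 0.
Proof.
move=> ns h; rewrite big1// => j _; rewrite indicE mem_setE/= in_itv/=.
have [|_] := boolP (_ && _); last by rewrite mulr0.
move=> /andP[jx xj]; exfalso; move/negP : h; apply; apply/andP; split.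
  by apply: le_lt_trans jx; apply: (grid_le ns) => //; exact: ltnW.
by apply: (le_trans xj); exact: (grid_le ns).
Qed.

End uniform_grids.

Lemma inv_natr_near (R : realType) (K e : R) : 0 < e ->
  \forall n \near \oo, K / n.+1%:R <= e.
Proof.
move=> e0; near=> n.
have nK : K / e <= n.+1%:R.
  near: n; exists (Num.Def.trunc `|K / e|) => // m /= km.
  apply: (le_trans (ler_norm _)); rewrite ltW//.
  by rewrite -truncn_lt_nat// ltnS.
by rewrite ler_pdivrMr// mulrC -ler_pdivrMr.
Unshelve. all: by end_near. Qed.

Lemma cvg0e_le (R : realType) (u : (\bar R)^nat) (e : R) : 0 < e ->
  u @ \oo --> 0%E -> \forall n \near \oo, (u n <= e%:E)%E.
Proof.
move=> e0 hu; have : \forall n \near \oo, (u n < e%:E)%E.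
  apply: (hu [set y | (y < e%:E)%E]); apply: open_nbhs_nbhs.
  by split; [exact: open_ereal_lt_ereal|rewrite /= lte_fin].
by apply: filterS => n; exact: ltW.
Qed.

Section measurable_paths.
Context d (T : measurableType d) (R : realType).

(** By path continuity, [H] is the pointwise limit of its left-endpoint step approximations, which
    are jointly measurable. The indicator confines the sampling to times at least [r], where [H] is
    known to be measurable. *)
Lemma measurable_path (H : R -> T -> R) (r r' : R) :
  (forall w, continuous (H ^~ w)) ->
  (forall v, r <= v -> measurable_fun setT (H v)) ->
  measurable_fun setT
    (fun y : measurableTypeR R * T => \1_`]r, r'] y.1 * H y.1 y.2).
Proof.
move=> cH mH.
have [rr'|r'r] := ltP r r'; last first.
  rewrite (_ : (fun _ => _) = cst 0); first exact: measurable_cst.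
  apply/funext => y; rewrite indicE mem_setE/= in_itv/=.
  have [|] := boolP (_ && _); last by rewrite mul0r.
  by move=> /andP[ry yr']; move: (lt_le_trans ry (le_trans yr' r'r)); rewrite ltxx.
pose K n (y : measurableTypeR R * T) :=
  \sum_(j < n.+1) H (ugrid r r' n.+1 j) y.2
    * \1_`]ugrid r r' n.+1 j, ugrid r r' n.+1 j.+1] y.1.
have mono n j : (j < n.+1)%N -> ugrid r r' n.+1 j <= ugrid r r' n.+1 j.+1.
  by move=> _; exact/ugrid_leS/ltW.
apply: (@measurable_fun_cvg _ _ _ _ K).
  move=> n; apply: measurable_sum => j; apply: measurable_funM.
    apply: measurableT_comp; last exact: measurable_snd.
    by apply: mH; have /andP[] := ugrid_bounds (ltW rr') (ltn0Sn n) (ltnW (ltn_ord j)).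
  apply: (@measurableT_comp _ _ _ _ _ _ (\1_(`]ugrid r r' n.+1 j, ugrid r r' n.+1 j.+1]) : measurableTypeR R -> R)).
    by apply: measurable_indic.
  exact: measurable_fst.
move=> [v w] _ /=; rewrite indicE mem_setE/= in_itv/=.
have [|nv] := boolP (_ && _); last first.
  rewrite mul0r (_ : (fun _ => _) = cst 0); first exact: cvg_cst.
  apply/funext => n; rewrite /K (grid_step_value_out (fun j => H (ugrid r r' n.+1 j) w) (mono n))//.
  by rewrite ugrid0 ugridn.
rewrite mul1r => /andP[rv vr'].
apply/cvgrPdist_le => e e0.
have := cH w v; move/cvgrPdist_le => /(_ e e0) /nbhs_ballP[dl /= dl0 hdl].
have dl20 : 0 < dl / 2 by exact: divr_gt0.
near=> n.
have nd : (r' - r) / n.+1%:R <= dl / 2.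
  by near: n; exact: inv_natr_near.
have [i ni ix] : exists2 i, (i < n.+1)%N &
    ugrid r r' n.+1 i < v <= ugrid r r' n.+1 i.+1.
  by apply: grid_locate; rewrite ?ugrid0 ?ugridn.
rewrite /K/= (grid_step_value (fun j => H (ugrid r r' n.+1 j) w) (mono n) ni ix).
apply: hdl => /=; rewrite /ball/=; move: ix; rewrite ugrid_step.
move: (ugrid _ _ _ _) => u /andP[uv vu].
rewrite gtr0_norm ?subr_gt0//.
apply: (@le_lt_trans _ _ (dl / 2)); last by lra.
by apply: le_trans nd; rewrite lerBlDl.
Unshelve. all: by end_near. Qed.

End measurable_paths.

Lemma dist_maxr_le (R : realType) (a x y : R) :
  `|Num.max a x - Num.max a y| <= `|x - y|.
Proof.
have h1 := ler_norm (x - y); have h2 := ler_norm (y - x).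
rewrite distrC in h2; rewrite ler_norml.
by case: (leP a x) => ax; case: (leP a y) => ay; apply/andP; split; lra.
Qed.

(** * An everywhere continuous version of the CIR process *)

Section cir_core.
Context d (T : measurableType d) (R : realType) (P : probability T R) (t0 : R)
  (F : R -> set (set T)) (W : R -> T -> R).
Hypotheses (hF : filtration t0 F) (hFu : usual_conditions P t0 F)
  (hW : brownian_motion P t0 F W).

Lemma negligible_measurable (A : set T) : P.-negligible A -> measurable A.
Proof. by move=> nA; apply: (hF.1 t0 (lexx _)).2; exact: hFu.1. Qed.

(** Passes from the given notion of integral to [ito_limit], replacing the integrand by a version
    that is continuous and measurable everywhere. Step processes are read as elementary processes,
    and convergence in probability supplies one good index for each [e]. *)
Lemma ito_limit_of_integral (N : set T) (t : R) (H H' : R -> T -> R)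
    (I : T -> R) : t0 <= t ->
  measurable N -> P N = 0 ->
  (forall w, continuous (H' ^~ w)) ->
  (forall v, t0 <= v -> measurable_fun setT (H' v)) ->
  (forall w v, ~ N w -> t0 <= v -> H v w = H' v w) ->
  is_ito_integral P t0 F W t H I ->
  ito_limit P t0 F W (fun v w => \1_`]t0, t] v * H' v w) I.
Proof.
move=> t0t mN N0 cH' mH' HH' [mI [h [sh cvE cvI]]].
have mH'w w : measurable_fun setT (H' ^~ w).
  exact: continuous_measurable_fun.
have mG w : measurable_fun setT (fun v => \1_`]t0, t] v * H' v w).
  by apply: measurable_funM => //; apply: measurable_indic.
split => // e e0.
pose E n := @EProc T R 'I_(step_size (h n)) (fun i => step_time (h n) i)
  (fun i => step_time (h n) i.+1) (fun i => step_coef (h n) i).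
have aE n : eadapted t0 F (E n).
  have [s0 st sm sc] := sh n => i; have i_n := ltn_ord i.
  have t0i : t0 <= step_time (h n) i.
    by rewrite -s0; apply: (grid_le sm) => //; exact: ltnW.
  by split => //; [exact: sm|apply/(FmeasP hF) => //; have [] := sc i i_n].
have EE n v w : evalue (E n) v w = step_value (h n) v w by [].
have EI n w : eint W (E n) w = step_integral W (h n) w by [].
pose D n w := (\int[lebesgue_measure]_(s in `[t0, t])
            ((step_value (h n) s w - H s w) ^+ 2)%:E)%E.
pose D' n w := energy (fun s w => evalue (E n) s w - \1_`]t0, t] s * H' s w) w.
have DD' n w : ~ N w -> D n w = D' n w.
  move=> Nw; rewrite /D /D' /energy.
  have mf : measurable_fun setT (fun s => ((step_value (h n) s w - H' s w) ^+ 2)%:E).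
    apply/measurable_EFinP; apply: measurable_funX; apply: measurable_funB => //.
    exact: (measurable_evalue (E n)).
  transitivity (\int[lebesgue_measure]_(s in `[t0, t])
      ((step_value (h n) s w - H' s w) ^+ 2)%:E)%E.
    by apply: eq_integral => s; rewrite inE/= in_itv/= => /andP[t0s _]; rewrite HH'.
  (* The energy is integrated over a closed interval, whereas step processes live on left-open ones;
     the missing point [t0] is Lebesgue-null. *)
  rewrite -integral_itv_obnd_cbnd; last exact: measurable_funTS.
  rewrite integral_mkcond; apply: eq_integral => s _.
  rewrite patchE EE indicE; case: ifPn => [_|ns]; first by rewrite mul1r.
  rewrite mul0r subr0 /step_value.
  have [s0 st sm sc] := sh n.
  rewrite (grid_step_value_out (fun j => step_coef (h n) j w) sm) ?expr0n//.
  by rewrite s0 st; move: ns; rewrite notin_setE/= in_itv/= => /negP.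
have mD' n : measurable_fun setT (D' n).
  pose f (y : measurableTypeR R * T) : \bar R :=
    ((evalue (E n) y.1 y.2 - \1_`]t0, t] y.1 * H' y.1 y.2) ^+ 2)%:E.
  have mf : measurable_fun setT f.
    apply/measurable_EFinP; apply: measurable_funX; apply: measurable_funB.
      apply: measurable_sum => i; apply: measurable_funM.
        apply: measurableT_comp; last exact: measurable_snd.
        by have [t0i _] := aE n i; exact: (Fmeas_measurable hF t0i).
      apply: (@measurableT_comp _ _ _ _ _ _ (\1_(`](step_time (h n) i), (step_time (h n) i.+1)]) : measurableTypeR R -> R)).
        exact: measurable_indic.
      exact: measurable_fst.
    exact: measurable_path.
  apply: (measurable_fun_fubini_tonelli_G (m1 := lebesgue_measure) f) => //.
  by move=> y; rewrite lee_fin sqr_ge0.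
have e20 : 0 < e / 2 by exact: divr_gt0.
have [n [PD PI]] : exists n, (P [set w | (e%:E <= D n w)%E] <= (e / 2)%:E)%E /\
    (P [set w | (e%:E <= `|step_integral W (h n) w - I w|%:E)%E] <= (e / 2)%:E)%E.
  apply: (@filter_ex _ \oo).
  by apply: filterI; [exact: cvg0e_le e20 (cvE e e0)|exact: cvg0e_le e20 (cvI e e0)].
have mA' : measurable [set w | (e%:E <= D' n w)%E].
  rewrite -[X in measurable X]setTI -preimage_itvcy.
  by apply: (mD' n measurableT); exact: emeasurable_itv.
(* [D n] involves [H] itself, of which no joint measurability is known. It agrees off [N] with
   [D' n], which is measurable by Tonelli, and completeness takes care of the part inside [N]. *)
have mA : measurable [set w | (e%:E <= D n w)%E].
  rewrite (_ : [set _ | _] = ([set w | (e%:E <= D' n w)%E] `\` N) `|`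
    ([set w | (e%:E <= D n w)%E] `&` N)).
    apply: measurableU; first exact: measurableD.
    by apply: negligible_measurable; exists N; split => // w [].
  apply/seteqP; split => w /=.
    by have [Nw|Nw] := pselect (N w); [right|left; rewrite -DD'].
  by move=> [[? Nw]|[]//]; rewrite DD'.
have mA'P : (P [set w | (e%:E <= D' n w)%E] <= (e / 2)%:E)%E.
  apply: (@le_trans _ _ (P ([set w | (e%:E <= D n w)%E] `|` N))).
    apply: le_measure; rewrite ?inE//; first exact: measurableU.
    move=> w /= ew; have [Nw|Nw] := pselect (N w); [by right|left].
    by rewrite /= DD'.
  by rewrite -[leRHS]adde0; apply: measureU_le => //; rewrite N0.
have mB : measurable [set w | (e%:E <= `|step_integral W (h n) w - I w|%:E)%E].
  rewrite -[X in measurable X]setTI -preimage_itvcy.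
  have : measurable_fun setT (fun w => `|step_integral W (h n) w - I w|%:E).
    apply/measurable_EFinP; apply: measurableT_comp => //.
    by apply: measurable_funB => //; exact: (measurable_eint hF hW (aE n)).
  by move=> mm; apply: (mm measurableT); exact: emeasurable_itv.
exists (E n); split; first exact: aE.
exists ([set w | (e%:E <= D' n w)%E] `|` [set w | (e%:E <= `|step_integral W (h n) w - I w|%:E)%E]).
split.
- exact: measurableU.
- rewrite [in leRHS](splitr e) EFinD; exact: measureU_le.
- move=> w /not_orP[/= /negP n1 /negP n2]; split.
    by rewrite -/(D' n w) ltW// ltNge.
  by rewrite EI -lee_fin ltW// ltNge.
Qed.

(** Continuity and positivity hold for every path and on the whole time line, and the equation
    starts from [X t0]; only the integral equation remains almost sure. *)
Definition cir_core (a g sigma : R) (X : R -> T -> R) :=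
  [/\ forall w, continuous (X ^~ w),
      forall s w, 0 <= X s w,
      forall s, t0 <= s -> Fmeas F s (X s)
    & forall s, t0 <= s -> exists2 I : T -> R,
        ito_limit P t0 F W
          (fun v w => \1_`]t0, s] v * (sigma * Num.sqrt (X v w))) I
      & {ae P, forall w, X s w = X t0 w
          + \int[lebesgue_measure]_(v in `[t0, s]) (a * (g - X v w)) + I w}].

(* On a null set the paths of X may be discontinuous or negative; they are
   replaced there by the zero path, which completeness of the filtration keeps
   adapted. *)
Lemma cir_core_version (a g sigma : R) (X0 : T -> R) (X : R -> T -> R) :
  cir_process P t0 F W a g sigma X0 X ->
  exists2 X' : R -> T -> R, cir_core a g sigma X'
    & {ae P, forall w, forall s, t0 <= s -> X' s w = X s w}.
Proof.
move=> [adX cX posX initX sde].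
have [N [mN N0 sub]] : {ae P, forall w,
   ({within `[t0, +oo[, continuous (X ^~ w)} /\ (forall t, t0 <= t -> 0 <= X t w))
   /\ X t0 w = X0 w}.
  by apply: filterI => //; apply: filterI.
have good w : ~ N w -> [/\ {within `[t0, +oo[, continuous (X ^~ w)},
    forall t, t0 <= t -> 0 <= X t w & X t0 w = X0 w].
  move=> Nw; have [[]] : ({within `[t0, +oo[, continuous (X ^~ w)} /\
     (forall t, t0 <= t -> 0 <= X t w)) /\ X t0 w = X0 w.
    by apply: contrapT => h; apply: Nw; exact: sub.
  by [].
(* Before [t0] the path is frozen at its initial value, which turns continuity on the half-line into
   continuity on the real line. *)
pose X' s w := \1_(~` N) w * X (Num.max t0 s) w.
have X'E s w : ~ N w -> t0 <= s -> X' s w = X s w.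
  by move=> Nw t0s; rewrite /X' indicE mem_set// mul1r max_r.
have X'N s w : N w -> X' s w = 0.
  by move=> Nw; rewrite /X' indicE memNset ?mul0r//= => /(_ Nw).
have FN : F t0 (~` N).
  have [[_ sC _] _] := hF.1 t0 (lexx _).
  by rewrite -setTD; apply: sC; apply: hFu.1; apply/negligibleP.
have t0max s : t0 <= Num.max t0 s by rewrite le_max lexx.
have cX' w : continuous (X' ^~ w).
  have [Nw|Nw] := pselect (N w).
    have -> : X' ^~ w = cst 0 by apply/funext => s; rewrite X'N.
    by move=> s; exact: cvg_cst.
  have [cw _ _] := good w Nw.
  have -> : X' ^~ w = (X ^~ w) \o (Num.max t0).
    by apply/funext => s; rewrite /X' indicE mem_set// mul1r.
  move=> s; move/subspace_continuousP : cw => /(_ (Num.max t0 s)).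
  rewrite /= in_itv/= andbT => /(_ (t0max s)) cw.
  apply: cvg_comp cw => A /= [e /= e0 hA].
  exists e => //= u su; apply: hA => /=; last by rewrite in_itv/= andbT.
  by move: su; rewrite /ball/= => su; apply: le_lt_trans su; exact: dist_maxr_le.
exists X'; last first.
  exists N; split => // w /= h; apply: contrapT => Nw; apply: h => s t0s.
  exact: X'E.
split => //.
- move=> s w; have [Nw|Nw] := pselect (N w); first by rewrite X'N.
  have [_ pw _] := good w Nw.
  by rewrite /X' indicE mem_set// mul1r pw.
- move=> s t0s; apply: measurable_funM.
    by apply: (Fmeas_le hF (lexx _) t0s); exact: (Fmeas_indic hF (lexx _)).
  by apply/(FmeasP hF) => //; rewrite max_r//; exact: adX.
- move=> s t0s; have [I [iI aeI]] := sde s t0s; exists I.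
    apply: (@ito_limit_of_integral N s (fun s w => sigma * Num.sqrt (X s w))) => //.
    + move=> w v; apply: cvgM; first exact: cvg_cst.
      apply: (@continuous_comp _ _ _ (X' ^~ w) Num.sqrt); first exact: cX'.
      exact: sqrt_continuous.
    + move=> v t0v; apply: measurable_funM => //.
      apply: (@measurableT_comp _ _ _ _ _ _ (@Num.sqrt R)).
        by apply: continuous_measurable_fun; exact: sqrt_continuous.
      apply: measurable_funM => //; first by apply: measurable_indic; exact: measurableC.
      by apply: (Fmeas_measurable hF (t0max v)); apply/(FmeasP hF) => //; exact: adX.
    + by move=> w v Nw t0v; rewrite X'E.
  have aeN : {ae P, forall w, ~ N w}.
    by exists N; split => // w /=; exact: contrapT.
  apply: filterS2 aeN aeI => w Nw Xsw.
  rewrite !X'E// Xsw; have [_ _ ->] := good w Nw.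
  congr (_ + _ + _); apply: eq_Rintegral => v; rewrite inE/= in_itv/= => /andP[t0v _].
  by rewrite X'E.
Qed.

End cir_core.

(** * Moduli of continuity uniform up to small probability *)

Lemma dist_minr_le (R : realType) (a x y : R) :
  `|Num.min a x - Num.min a y| <= `|x - y|.
Proof.
have h1 := ler_norm (x - y); have h2 := ler_norm (y - x).
rewrite distrC in h2; rewrite ler_norml.
by case: (leP a x) => ax; case: (leP a y) => ay; apply/andP; split; lra.
Qed.

Lemma heine_cantor_seq (R : realType) (f : R -> R) (r r' K e : R) :
  continuous f -> 0 < e ->
  \forall n \near \oo, forall x y, r <= x -> x <= r' ->
    `|x - y| <= K / n.+1%:R -> `|f x - f y| <= e.
Proof.
move=> cf e0.
have /compact_near_coveringP cov := @segment_compact R r r'.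
have : \forall n \near \oo, `[r, r'] `<=`
    (fun x => forall y, `|x - y| <= K / n.+1%:R -> `|f x - f y| <= e).
  apply: cov => x _.
  have /cvgrPdist_le /(_ (e / 2)) := cf x.
  rewrite divr_gt0// => /(_ isT) /nbhs_ballP[dl /= dl0 hdl].
  have dl20 : 0 < dl / 2 by exact: divr_gt0.
  near=> x' n => y x'y.
  have xx' : `|x - x'| < dl / 2.
    by near: x'; apply/nbhs_ballP; exists (dl / 2).
  have nd : K / n.+1%:R <= dl / 2 by near: n; exact: inv_natr_near.
  have h1 : `|f x - f x'| <= e / 2 by apply: hdl; apply: (lt_trans xx'); lra.
  have h2 : `|f x - f y| <= e / 2.
    apply: hdl; rewrite /ball/= (_ : x - y = (x - x') + (x' - y)); last by ring.
    apply: (le_lt_trans (ler_normD _ _)); rewrite (splitr dl).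
    exact: ltr_leD xx' (le_trans x'y nd).
  rewrite (_ : f x' - f y = - (f x - f x') + (f x - f y)); last by ring.
  by apply: (le_trans (ler_normD _ _)); rewrite normrN (splitr e) lerD.
apply: filterS => n h x y rx xr'; apply: h.
by rewrite /= in_itv/= rx.
Unshelve. all: by end_near. Qed.

Lemma bigcap_measurable_rat d (T : sigmaRingType d) (F : rat -> set T)
    (Q : set rat) : measurable [set: T] ->
  (forall q, measurable (F q)) -> measurable (\bigcap_(q in Q) F q).
Proof.
move=> mT mF.
rewrite (_ : \bigcap_(q in Q) F q
    = [set: T] `\` \bigcup_q (if `[< Q q >] then [set: T] `\` F q else set0)).
  apply: measurableD => //; apply: bigcupT_measurable_rat => q.
  by case: ifPn => // _; exact: measurableD.
apply/seteqP; split => w /=.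
  by move=> h; split => // -[q _]; case: ifPn => // /asboolP Qq [_]; apply; exact: h.
move=> [_ h] q Qq; apply: contrapT => nF; apply: h; exists q => //.
by rewrite asboolT.
Qed.

Lemma rat_near (R : realType) (x dl : R) : 0 < dl ->
  exists q : rat, `|x - ratr q| < dl.
Proof.
move=> dl0; have [q] : exists q : rat, ratr q \in `]x, x + dl[.
  by apply: rat_in_itvoo; lra.
by rewrite in_itv/= => /andP[xq qx]; exists q; rewrite ltr0_norm; lra.
Qed.

Lemma rat_dense_le (R : realType) (f : R -> R) (K : R) : continuous f ->
  (forall q : rat, f (ratr q) <= K) -> forall x, f x <= K.
Proof.
move=> cf fK x; apply/ler_addgt0Pr => e e0.
have /cvgrPdist_le /(_ e e0) := cf x => /nbhs_ballP[dl /= dl0 hdl].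
have [q /hdl] := rat_near x dl0.
by rewrite ler_norml => /andP[_]; have := fK q; lra.
Qed.

Lemma rat_dense_modulus (R : realType) (f : R -> R) (b e : R) : continuous f ->
  (forall q q' : rat, `|ratr q - ratr q'| < b ->
    `|f (ratr q) - f (ratr q')| <= e) ->
  forall x y, `|x - y| < b -> `|f x - f y| <= e.
Proof.
move=> cf fe x y xy; apply/ler_addgt0Pr => e1 e10.
have e20 : 0 < e1 / 2 by exact: divr_gt0.
have /cvgrPdist_le /(_ _ e20) := cf x => /nbhs_ballP[d1 /= d10 h1].
have /cvgrPdist_le /(_ _ e20) := cf y => /nbhs_ballP[d2 /= d20 h2].
have b0 : 0 < (b - `|x - y|) / 2 by rewrite divr_gt0// subr_gt0.
have [|q] := @rat_near _ x (Num.min d1 ((b - `|x - y|) / 2)).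
  by rewrite lt_min d10.
rewrite lt_min => /andP[/h1 fq xq].
have [|q'] := @rat_near _ y (Num.min d2 ((b - `|x - y|) / 2)).
  by rewrite lt_min d20.
rewrite lt_min => /andP[/h2 fq' yq'].
have := fe q q'.
rewrite (_ : ratr q - ratr q' = - (x - ratr q) + ((x - y) + (y - ratr q'))); last by ring.
have := ler_normD (- (x - ratr q)) ((x - y) + (y - ratr q')).
have := ler_normD (x - y) (y - ratr q'); rewrite normrN => l1 l2.
have -> : `|- (x - ratr q) + (x - y + (y - ratr q'))| < b by lra.
move=> /(_ isT) l3.
rewrite (_ : f x - f y = (f x - f (ratr q)) + ((f (ratr q) - f (ratr q')) - (f y - f (ratr q')))); last by ring.
apply: (le_trans (ler_normD _ _)).
have := ler_normB (f (ratr q) - f (ratr q')) (f y - f (ratr q')).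
lra.
Qed.

Section uniform_modulus.
Context d (T : measurableType d) (R : realType) (P : probability T R).

(** Each path is bounded and uniformly continuous on the segment, so the events [A n] increase to
    the whole space and some [A N] has probability close to 1. Restricting to rational times makes
    these events measurable, and density with continuity recovers all times. The same [N] bounds the
    path and the mesh. *)
Lemma uniform_modulus (X : R -> T -> R) (r r' e eta : R) : r <= r' ->
  (forall w, continuous (X ^~ w)) ->
  (forall s, r <= s -> measurable_fun setT (X s)) -> 0 < e -> 0 < eta ->
  exists N (B : set T), [/\ measurable B, (P B <= eta%:E)%E
  & forall w, ~ B w -> (forall x, r <= x -> x <= r' -> X x w <= N%:R) /\
     forall n, (N <= n)%N -> forall x y, r <= x -> x <= r' -> r <= y -> y <= r' ->
       `|x - y| <= (r' - r) / n.+1%:R -> `|X x w - X y w| <= e].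
Proof.
move=> rr' cX mX e0 eta0.
(* Clamping to the segment lets rational times range over the whole line; it is 1-Lipschitz, so
   moduli of continuity survive. *)
pose c (x : R) := Num.max r (Num.min r' x).
have rc x : r <= c x by rewrite le_max lexx.
have cr' x : c x <= r' by rewrite ge_max rr' ge_min lexx.
have cE x : r <= x -> x <= r' -> c x = x.
  by move=> rx xr'; rewrite /c min_r// max_r.
have c1 x y : `|c x - c y| <= `|x - y|.
  apply: (le_trans (dist_maxr_le _ _ _)).
  exact: dist_minr_le.
have cc : continuous c.
  move=> x; apply/cvgrPdist_le => e1 e10; near=> y.
  apply: (le_trans (c1 _ _)); near: y.
  by exists e1 => //= y /ltW.
have cXc w : continuous (fun x => X (c x) w).
  by move=> x; apply: (@continuous_comp _ _ _ c (X ^~ w)); [exact: cc|exact: cX].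
(* The extra 1 makes [(r' - r) / n.+1] strictly smaller than [b n], as the strict condition on
   rational pairs requires, also when [r = r']. *)
pose b (n : nat) := (r' - r + 1) / n.+1%:R.
pose A n := (\bigcap_(q in [set: rat]) [set w | X (c (ratr q)) w <= n%:R]) `&`
  (\bigcap_(q in [set: rat]) \bigcap_(q' in [set q' : rat | `|ratr q - ratr q'| < b n])
    [set w | `|X (c (ratr q)) w - X (c (ratr q')) w| <= e]).
have mA n : measurable (A n).
  apply: measurableI.
    apply: bigcap_measurable_rat => // q.
    rewrite -[X in measurable X]setTI -preimage_itvNyc.
    by apply: (mX _ (rc _)).
  apply: bigcap_measurable_rat => // q; apply: bigcap_measurable_rat => // q'.
  rewrite -[X in measurable X]setTI -preimage_itvNyc.
  have mm : measurable_fun setT (fun w => `|X (c (ratr q)) w - X (c (ratr q')) w|).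
    apply: measurableT_comp => //.
    by apply: measurable_funB; apply: mX.
  exact: mm.
have bmono m n : (m <= n)%N -> b n <= b m.
  move=> mn; rewrite /b ler_pM2l ?lef_pV2 ?posrE ?ler_nat ?ltnS//; lra.
have ndA : {homo A : n m / (n <= m)%N >-> (n <= m)%O}.
  move=> m n mn; apply/subsetPset => w [h1 h2]; split.
    by move=> q _; apply: (le_trans (h1 q I)); rewrite ler_nat.
  move=> q _ q' /= qq'; apply: h2 => //=.
  by apply: lt_le_trans qq' _; exact: bmono.
have UA w : exists n, A n w.
  have [K hK] : exists K : R, forall x, r <= x -> x <= r' -> X x w <= K.
    have [x _ hx] := @EVT_max R (X ^~ w) r r' rr' (continuous_subspaceT (cX w)).
    by exists (X x w) => y ry yr'; apply: hx; rewrite in_itv/= ry.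
  have /filter_ex[n [Kn mn]] : \forall n \near \oo, K <= n%:R /\
      forall x y, r <= x -> x <= r' ->
        `|x - y| <= (r' - r + 1) / n.+1%:R -> `|X x w - X y w| <= e.
    apply: filterI; last exact: (@heine_cantor_seq R (X ^~ w)).
    by apply: filterS (nbhs_infty_gtr K) => n /ltW.
  exists n; split.
    by move=> q _ /=; apply: le_trans Kn; exact: hK.
  by move=> q _ q' /= qq'; apply: mn => //; apply: (le_trans (c1 _ _)); exact: ltW.
have cvA : (P \o (fun n => ~` A n)) @ \oo --> 0%E.
  rewrite -(measure0 P) (_ : set0 = \bigcap_n (~` A n)); last first.
    apply/esym/seteqP; split => // w h; have [n Anw] := UA w.
    exact: (h n I).
  apply: nonincreasing_cvg_mu => //.
  - by rewrite (le_lt_trans (probability_le1 _ _)) ?ltry//; exact: measurableC.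
  - by move=> n; exact: measurableC.
  - by apply: bigcap_measurable => // n _; exact: measurableC.
  - by move=> m n mn; apply/subsetPset/subsetC/subsetPset/ndA.
have /filter_ex[N PN] := cvg0e_le eta0 cvA.
exists N, (~` A N); split => //; first exact: measurableC.
move=> w /contrapT AN; split.
  move=> x rx xr'; rewrite -(cE x)//.
  apply: (rat_dense_le (cXc w)) => q.
  by have [h _] := AN; exact: h.
move=> n Nn x y rx xr' ry yr' xy; rewrite -(cE x)// -(cE y)//.
apply: (@rat_dense_modulus R (fun x => X (c x) w) (b N) e (cXc w)).
  by move=> q q' qq'; have [_ h] := AN; exact: h.
apply: (le_lt_trans xy); apply: (lt_le_trans _ (bmono _ _ Nn)).
by rewrite /b ltr_pM2r ?invr_gt0//; lra.
Unshelve. all: by end_near. Qed.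

End uniform_modulus.

(** * The Riccati equations and the Euler scheme *)

Section riccati.
Context (R : realType) (a g sigma u t : R).
Hypotheses (a0 : 0 < a) (g0 : 0 < g) (sigma0 : 0 < sigma)
  (hu : - (a / sigma ^+ 2) <= u).

(** The scale parameter of the Gamma law of shape [2 a g / sigma^2] that the CIR process started
    from 0 has after time [tau]. *)
Definition cir_var (a sigma tau : R) : R :=
  sigma ^+ 2 * (1 - expR (- (a * tau))) / (2 * a).

Definition cir_psi (s : R) : R :=
  u * expR (- (a * (t - s))) / (1 + u * cir_var a sigma (t - s)).

Definition cir_phi (s : R) : R :=
  2 * a * g / sigma ^+ 2 * ln (1 + u * cir_var a sigma (t - s)).

Lemma cir_var_ge0 tau : 0 <= tau -> 0 <= cir_var a sigma tau.
Proof.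
move=> tau0; have e1 : expR (- (a * tau)) <= 1.
  by rewrite expR_le1 oppr_le0 mulr_ge0// ltW.
apply: divr_ge0; last by rewrite mulr_ge0// ltW.
apply: mulr_ge0; [exact: sqr_ge0|lra].
Qed.

Lemma cir_var_le tau : cir_var a sigma tau <= sigma ^+ 2 / (2 * a).
Proof.
rewrite /cir_var ler_pM2r ?invr_gt0 ?mulr_gt0//.
by rewrite ger_pMr ?exprn_gt0// lerBlDr lerDl expR_ge0.
Qed.

Lemma cir_var_gt0 tau : 0 < tau -> 0 < cir_var a sigma tau.
Proof.
move=> tau0; have e1 : expR (- (a * tau)) < 1.
  by rewrite expR_lt1 oppr_lt0 mulr_gt0.
apply: divr_gt0; last exact: mulr_gt0.
by apply: mulr_gt0; [exact: exprn_gt0|rewrite subr_gt0].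
Qed.

(** [cir_var] never exceeds [sigma^2 / (2 a)], and the threshold [- a / sigma^2] on [u] is half the
    value at which the denominator could reach 0 in the limit of large times. *)
Lemma cir_denom_ge tau : 0 <= tau -> 1 / 2 <= 1 + u * cir_var a sigma tau.
Proof.
move=> tau0; have c0 := cir_var_ge0 tau0.
have [u0|u0] := leP 0 u; first by have := mulr_ge0 u0 c0; lra.
have h1 : u * (sigma ^+ 2 / (2 * a)) <= u * cir_var a sigma tau.
  by rewrite ler_nM2l// cir_var_le.
have s20 : 0 < sigma ^+ 2 / (2 * a) by rewrite divr_gt0 ?exprn_gt0 ?mulr_gt0.
have h2 := ler_wpM2r (ltW s20) hu.
have h3 : - (a / sigma ^+ 2) * (sigma ^+ 2 / (2 * a)) = - (1 / 2).
  by field; rewrite !gt_eqF ?exprn_gt0.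
lra.
Qed.

Let M := 2 * `|u|.

Lemma cir_psi_le s : s <= t -> `|cir_psi s| <= M.
Proof.
move=> st; have st0 : 0 <= t - s by lra.
have d12 := cir_denom_ge st0.
have dp : 0 < 1 + u * cir_var a sigma (t - s) by lra.
rewrite /cir_psi normrM normrV ?unitfE ?gt_eqF// (gtr0_norm dp) normrM.
rewrite (gtr0_norm (expR_gt0 _)) ler_pdivrMr// /M.
have e1 : expR (- (a * (t - s))) <= 1.
  by rewrite expR_le1 oppr_le0 mulr_ge0// ltW.
have h1 := ler_wpM2l (normr_ge0 u) e1.
have h2 := ler_wpM2l (normr_ge0 u) d12.
lra.
Qed.

Lemma is_derive_cir_var (s : R) : is_derive s 1 (fun s => cir_var a sigma (t - s))
  (- (sigma ^+ 2 / 2 * expR (- (a * (t - s))))).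
Proof.
rewrite /cir_var.
have -> : (fun s => sigma ^+ 2 * (1 - expR (- (a * (t - s)))) / (2 * a)) =
    (fun s => (sigma ^+ 2 / (2 * a)) *: (1 - expR (a * s - a * t))).
  by apply/funext => x; rewrite /GRing.scale/=
    (_ : - (a * (t - x)) = a * x - a * t); [field; rewrite gt_eqF|ring].
have d1 : is_derive s 1 (fun x : R => a * x - a * t) a.
  have -> : (fun x : R => a * x - a * t) = (a \*: id) - cst (a * t) by [].
  by apply: is_derive_eq; rewrite subr0 /GRing.scale/= mulr1.
have d2 : is_derive s 1 (fun x : R => expR (a * x - a * t)) (expR (a * s - a * t) * a).
  exact: (@is_derive1_comp R expR (fun x => a * x - a * t)).
have d3 : is_derive s 1 ((sigma ^+ 2 / (2 * a)) \*: (cst 1 - (fun x : R => expR (a * x - a * t))))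
   ((sigma ^+ 2 / (2 * a)) *: (0 - expR (a * s - a * t) * a)).
  by apply: is_deriveZ; apply: is_deriveB.
have -> : - (sigma ^+ 2 / 2 * expR (- (a * (t - s)))) =
  (sigma ^+ 2 / (2 * a)) *: (0 - expR (a * s - a * t) * a).
  rewrite /GRing.scale/= (_ : - (a * (t - s)) = a * s - a * t); last by ring.
  by field; rewrite gt_eqF.
exact: d3.
Qed.

Lemma is_derive_cir_psi (s : R) : s <= t -> is_derive s 1 cir_psi
  (a * cir_psi s + sigma ^+ 2 / 2 * cir_psi s ^+ 2).
Proof.
move=> st; have st0 : 0 <= t - s by lra.
have d12 := cir_denom_ge st0.
have dp : 1 + u * cir_var a sigma (t - s) != 0 by rewrite gt_eqF; lra.
have d1 : is_derive s 1 (fun s => 1 + u * cir_var a sigma (t - s))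
    (0 + u *: (- (sigma ^+ 2 / 2 * expR (- (a * (t - s)))))).
  have -> : (fun s => 1 + u * cir_var a sigma (t - s)) =
    (cst 1 + u \*: (fun s => cir_var a sigma (t - s))) by [].
  by apply: is_deriveD; apply: is_deriveZ; exact: is_derive_cir_var.
have de : is_derive s 1 (fun x : R => a * x - a * t) a.
  have -> : (fun x : R => a * x - a * t) = (a \*: id) - cst (a * t) by [].
  by apply: is_derive_eq; rewrite subr0 /GRing.scale/= mulr1.
have d2 : is_derive s 1 (u \*: (fun x : R => expR (a * x - a * t))) (u *: (expR (a * s - a * t) * a)).
  by apply: is_deriveZ; exact: (@is_derive1_comp R expR (fun x => a * x - a * t)).
have d3 : is_derive s 1 (fun x => (1 + u * cir_var a sigma (t - x))^-1)
  (- (1 + u * cir_var a sigma (t - s)) ^- 2 *: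
    (0 + u *: (- (sigma ^+ 2 / 2 * expR (- (a * (t - s))))))).
  exact: (@is_deriveV R (fun x => 1 + u * cir_var a sigma (t - x)) _ _ _ dp d1).
have psiE : cir_psi = (u \*: (fun x : R => expR (a * x - a * t))) * (fun x => (1 + u * cir_var a sigma (t - x))^-1).
  apply/funext => x; rewrite /cir_psi /=.
  by rewrite (_ : - (a * (t - x)) = a * x - a * t)//; ring.
rewrite [X in is_derive _ _ X _]psiE.
apply: is_derive_eq.
rewrite /GRing.scale/= (_ : - (a * (t - s)) = a * s - a * t); last by ring.
rewrite /cir_psi (_ : - (a * (t - s)) = a * s - a * t); last by ring.
rewrite /GRing.scale/=; field.
by rewrite dp.
Qed.

Lemma is_derive_cir_phi (s : R) : s <= t -> is_derive s 1 cir_phi (- (a * g * cir_psi s)).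
Proof.
move=> st; have st0 : 0 <= t - s by lra.
have d12 := cir_denom_ge st0.
have dp : 0 < 1 + u * cir_var a sigma (t - s) by lra.
have d1 : is_derive s 1 (fun s => 1 + u * cir_var a sigma (t - s))
    (0 + u *: (- (sigma ^+ 2 / 2 * expR (- (a * (t - s)))))).
  have -> : (fun s => 1 + u * cir_var a sigma (t - s)) =
    (cst 1 + u \*: (fun s => cir_var a sigma (t - s))) by [].
  by apply: is_deriveD; apply: is_deriveZ; exact: is_derive_cir_var.
have d2 : is_derive s 1 (fun x => ln (1 + u * cir_var a sigma (t - x)))
   ((1 + u * cir_var a sigma (t - s))^-1 * (0 + u *: (- (sigma ^+ 2 / 2 * expR (- (a * (t - s))))))).
  apply: (@is_derive1_comp R (@ln R) (fun s => 1 + u * cir_var a sigma (t - s))).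
  exact: is_derive1_ln.
have -> : cir_phi = (2 * a * g / sigma ^+ 2) \*: (fun x => ln (1 + u * cir_var a sigma (t - x))) by [].
apply: is_derive_eq.
rewrite /GRing.scale/= /cir_psi; field.
by rewrite !gt_eqF.
Qed.

(** No second derivative is computed. The mean value theorem and the bound on [psi] make [psi]
    Lipschitz; the right-hand sides of both equations are then Lipschitz in time, and a second use
    of the theorem gives quadratic remainders. The three bounds are added so that one constant
    serves for all. *)
Lemma cir_psi_phi_taylor : exists2 C : R, 0 <= C &
  forall s s', s <= s' -> s' <= t -> [/\
    `|cir_psi s| <= C,
    `|cir_psi s' - cir_psi s
      - (s' - s) * (a * cir_psi s + sigma ^+ 2 / 2 * cir_psi s ^+ 2)|
      <= C * (s' - s) ^+ 2
  & `|cir_phi s' - cir_phi s + (s' - s) * (a * g * cir_psi s)|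
      <= C * (s' - s) ^+ 2].
Proof.
have M0 : 0 <= M by rewrite mulr_ge0.
pose D x := a * cir_psi x + sigma ^+ 2 / 2 * cir_psi x ^+ 2.
pose M1 := a * M + sigma ^+ 2 / 2 * M ^+ 2.
have s20 : 0 <= sigma ^+ 2 / 2 by rewrite divr_ge0 ?sqr_ge0.
have aM0 : 0 <= a * M by rewrite mulr_ge0// ltW.
have sM0 : 0 <= sigma ^+ 2 / 2 * M ^+ 2 by rewrite mulr_ge0 ?sqr_ge0.
have M10 : 0 <= M1 by rewrite addr_ge0.
have DM x : x <= t -> `|D x| <= M1.
  move=> xt; have p := cir_psi_le xt.
  apply: (le_trans (ler_normD _ _)).
  rewrite [`|a * _|]normrM [`|_ / _ * _|]normrM normrX (gtr0_norm a0).
  rewrite (ger0_norm s20); apply: lerD; first by apply: ler_wpM2l => //; exact: ltW.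
  by apply: ler_wpM2l => //; apply: lerXn2r; rewrite // nnegrE.
have mvt (f f' : R -> R) x y : x <= y -> y <= t ->
    (forall z, z <= t -> is_derive z 1 f (f' z)) ->
    exists2 z, x <= z <= y & f y - f x = f' z * (y - x).
  move=> xy yt df; have [||z] := @MVT_segment R f f' x y xy.
  - move=> z; rewrite in_itv/= => /andP[_ zy]; apply: df.
    exact: le_trans (ltW zy) yt.
  - apply: derivable_within_continuous => z; rewrite in_itv/= => /andP[_ zy].
    by have [] := df z (le_trans zy yt).
  - by rewrite in_itv/= => zxy ->; exists z.
have lip x y : x <= y -> y <= t -> `|cir_psi y - cir_psi x| <= M1 * (y - x).
  move=> xy yt; have [z /andP[xz zy] ->] := mvt _ _ _ _ xy yt is_derive_cir_psi.
  rewrite normrM (ger0_norm (_ : 0 <= y - x)) ?subr_ge0//.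
  by apply: ler_wpM2r; [rewrite subr_ge0|apply: DM; exact: le_trans yt].
pose L := a + sigma ^+ 2 / 2 * (M + M).
have L0 : 0 <= L by rewrite addr_ge0 ?(ltW a0)// mulr_ge0// addr_ge0.
have lipD x y : x <= y -> y <= t -> `|D y - D x| <= L * (M1 * (y - x)).
  move=> xy yt; have -> : D y - D x = (a + sigma ^+ 2 / 2 * (cir_psi y + cir_psi x)) * (cir_psi y - cir_psi x).
    by rewrite /D; ring.
  rewrite normrM; apply: ler_pM => //; last exact: lip.
  apply: (le_trans (ler_normD _ _)); rewrite (gtr0_norm a0) lerD2l normrM (ger0_norm s20).
  apply: ler_wpM2l => //; apply: (le_trans (ler_normD _ _)).
  by apply: lerD; apply: cir_psi_le => //; exact: le_trans yt.
have bnd (K z x y : R) : 0 <= K -> x <= z -> z <= y -> K * (z - x) * (y - x) <= K * (y - x) ^+ 2.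
  move=> K0 xz zy; rewrite expr2 -!mulrA; apply: ler_wpM2l => //.
  by apply: ler_wpM2r; [rewrite subr_ge0 (le_trans xz)|rewrite lerD2r].
exists (M + L * M1 + a * g * M1).
  by rewrite !addr_ge0// !mulr_ge0// ltW.
have LM0 : 0 <= L * M1 by rewrite mulr_ge0.
have agM0 : 0 <= a * g * M1 by rewrite !mulr_ge0// ltW.
move=> x y xy yt; have yx2 := sqr_ge0 (y - x); split.
- apply: (le_trans (cir_psi_le (le_trans xy yt))).
  by rewrite -addrA lerDl addr_ge0.
- have [z /andP[xz zy] ->] := mvt _ _ _ _ xy yt is_derive_cir_psi.
  rewrite -/(D x) -/(D z) (_ : _ - _ = (D z - D x) * (y - x)); last by ring.
  rewrite normrM (ger0_norm (_ : 0 <= y - x)) ?subr_ge0//.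
  apply: (@le_trans _ _ (L * M1 * (z - x) * (y - x))).
    apply: ler_wpM2r; first by rewrite subr_ge0.
    by rewrite -mulrA; apply: lipD => //; exact: le_trans yt.
  apply: (le_trans (bnd _ _ _ _ LM0 xz zy)).
  by apply: ler_wpM2r => //; lra.
- have [z /andP[xz zy] ->] := mvt _ _ _ _ xy yt is_derive_cir_phi.
  rewrite (_ : _ + _ = - (a * g * (cir_psi z - cir_psi x)) * (y - x)); last by ring.
  rewrite normrM normrN normrM (ger0_norm (_ : 0 <= y - x)) ?subr_ge0//.
  rewrite (gtr0_norm (mulr_gt0 a0 g0)).
  apply: (@le_trans _ _ (a * g * M1 * (z - x) * (y - x))).
    apply: ler_wpM2r; first by rewrite subr_ge0.
    rewrite -[leRHS]mulrA; apply: ler_wpM2l; first by rewrite mulr_ge0// ltW.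
    by apply: lip => //; exact: le_trans yt.
  apply: (le_trans (bnd _ _ _ _ agM0 xz zy)).
  by apply: ler_wpM2r => //; lra.
Qed.

End riccati.

(** A deterministic discrete product rule, for one path. Here [e i] stands for the drift increment,
    so [x i.+1 - x i - e i] is the martingale increment, and the left-hand sum is its exponent
    corrected by half the quadratic variation. *)
Lemma riccati_sum_estimate (R : realType) (a g sigma C K dl om : R) (n : nat)
    (ps ph x e : nat -> R) :
  0 < a -> 0 <= C -> 0 <= dl -> 0 <= om ->
  (forall i, (i < n)%N -> `|ps i| <= C) ->
  (forall i, (i < n)%N -> `|ps i.+1 - ps i
     - dl * (a * ps i + sigma ^+ 2 / 2 * ps i ^+ 2)| <= C * dl ^+ 2) ->
  (forall i, (i < n)%N -> `|ph i.+1 - ph i + dl * (a * g * ps i)| <= C * dl ^+ 2) ->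
  (forall i, (i < n)%N -> `|x i.+1 - x i| <= om) ->
  (forall i, (i < n)%N -> `|x i.+1| <= K) ->
  (forall i, (i < n)%N -> `|e i - a * (g - x i) * dl| <= a * om * dl) ->
  `|\sum_(i < n) (- (ps i * (x i.+1 - x i - e i)) - ps i ^+ 2 * sigma ^+ 2 * x i * dl / 2)
    - ((ps 0%N * x 0%N + ph 0%N) - (ps n * x n + ph n))|
  <= n%:R * dl * ((2 * a * C + sigma ^+ 2 / 2 * C ^+ 2) * om + C * dl * (K + 1)).
Proof.
move=> a0 C0 dl0 om0 psC dps dph dx xK de.
pose f i := ps i * x i + ph i.
have -> : (ps 0%N * x 0%N + ph 0%N) - (ps n * x n + ph n)
    = - \sum_(i < n) (f i.+1 - f i).
  by rewrite -(big_mkord predT (fun i => f i.+1 - f i)) telescope_sumr// opprB.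
rewrite opprK -big_split/=; apply: (le_trans (ler_norm_sum _ _ _)).
set B := _ + C * dl * (K + 1).
have -> : n%:R * dl * B = \sum_(i < n) dl * B.
  by rewrite sumr_const card_ord -mulrA mulr_natl.
apply: ler_sum => i _; have ni := ltn_ord i.
(* Adding the increment of [ps * x + ph] cancels every first-order term by the Riccati equations.
   What remains is the Taylor remainder of [ps], the oscillation of [x], the drift error and the
   Taylor remainder of [ph]. *)
have -> : - (ps i * (x i.+1 - x i - e i)) - ps i ^+ 2 * sigma ^+ 2 * x i * dl / 2
    + (f i.+1 - f i)
  = (ps i.+1 - ps i - dl * (a * ps i + sigma ^+ 2 / 2 * ps i ^+ 2)) * x i.+1
    + dl * (a * ps i + sigma ^+ 2 / 2 * ps i ^+ 2) * (x i.+1 - x i)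
    + ps i * (e i - a * (g - x i) * dl)
    + (ph i.+1 - ph i + dl * (a * g * ps i)).
  by rewrite /f; field.
have := ler_pM (normr_ge0 _) (normr_ge0 _) (dps _ ni) (xK _ ni).
rewrite -normrM => h1.
have Q : `|a * ps i + sigma ^+ 2 / 2 * ps i ^+ 2| <= a * C + sigma ^+ 2 / 2 * C ^+ 2.
  have s20 : 0 <= sigma ^+ 2 / 2 by rewrite divr_ge0 ?sqr_ge0.
  apply: (le_trans (ler_normD _ _)).
  rewrite [`|a * _|]normrM [`|_ / _ * _|]normrM normrX (gtr0_norm a0).
  rewrite (ger0_norm s20); apply: lerD.
    by apply: ler_wpM2l; [exact: ltW|exact: psC].
  by apply: ler_wpM2l => //; apply: lerXn2r; rewrite ?nnegrE// psC.
have dQ : `|dl * (a * ps i + sigma ^+ 2 / 2 * ps i ^+ 2)| <= dl * (a * C + sigma ^+ 2 / 2 * C ^+ 2).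
  by rewrite normrM (ger0_norm dl0); exact: ler_wpM2l.
have := ler_pM (normr_ge0 _) (normr_ge0 _) dQ (dx _ ni).
rewrite -normrM => h2.
have := ler_pM (normr_ge0 _) (normr_ge0 _) (psC _ ni) (de _ ni).
rewrite -normrM => h3; have h4 := dph _ ni.
apply: (le_trans (ler_normD _ _)).
have l3 := lerD (le_trans (ler_normD _ _) (lerD (le_trans (ler_normD _ _) (lerD h1 h2)) h3)) h4.
by apply: (le_trans l3); rewrite le_eqVlt; apply/orP; left; apply/eqP; rewrite /B; field.
Qed.

Lemma drift_estimate (R : realType) (f : R -> R) (t0 s s' om : R) :
  continuous f -> t0 <= s -> s <= s' ->
  (forall v, s <= v -> v <= s' -> `|f v - f s| <= om) ->
  `|\int[lebesgue_measure]_(v in `[t0, s']) f v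
    - \int[lebesgue_measure]_(v in `[t0, s]) f v - f s * (s' - s)|
  <= om * (s' - s).
Proof.
move=> cf t0s ss' fom.
have intf x y : lebesgue_measure.-integrable `[x, y] (EFin \o f).
  apply: continuous_compact_integrable; first exact: segment_compact.
  exact: continuous_subspaceT.
have intf' : lebesgue_measure.-integrable `]s, s'] (EFin \o f).
  apply: integrableS (intf s s') => //.
  by move=> x /=; rewrite !in_itv/= => /andP[/ltW -> ->].
rewrite Rintegral_itvB ?bnd_simp//.
have intc (c : R) : lebesgue_measure.-integrable `]s, s'] (EFin \o cst c).
  apply: integrableS (_ : lebesgue_measure.-integrable `[s, s'] _) => //.
    by move=> x /=; rewrite !in_itv/= => /andP[/ltW -> ->].
  apply: continuous_compact_integrable; first exact: segment_compact.
  by apply: continuous_subspaceT => x; exact: cvg_cst.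
have cE (c : R) : \int[lebesgue_measure]_(v in `]s, s']) c = c * (s' - s).
  rewrite Rintegral_cst//= lebesgue_measure_itv/= lte_fin.
  by move: ss'; rewrite le_eqVlt => /predU1P[->|->]//=; rewrite ltxx subrr.
have up : \int[lebesgue_measure]_(v in `]s, s']) f v <= (f s + om) * (s' - s).
  rewrite -cE; apply: le_Rintegral; [by []|exact: intf'|exact: (intc (f s + om))|].
  move=> v /=; rewrite in_itv/= => /andP[/ltW sv vs'].
  by have := fom v sv vs'; rewrite ler_norml => /andP[_]; lra.
have lo : (f s - om) * (s' - s) <= \int[lebesgue_measure]_(v in `]s, s']) f v.
  rewrite -cE; apply: le_Rintegral; [by []|exact: (intc (f s - om))|exact: intf'|].
  move=> v /=; rewrite in_itv/= => /andP[/ltW sv vs'].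
  by have := fom v sv vs'; rewrite ler_norml => /andP[+ _]; lra.
move: up lo; move: (Rintegral _ _ _) => J up lo.
by rewrite ler_norml; apply/andP; split; lra.
Qed.

(** The square root is not Lipschitz at 0, but [(sqrt x - sqrt y)^2 <= |x - y|]; squaring inside the
    energy restores a bound linear in [om]. *)
Lemma dist_sqrt_le (R : realType) (x y om : R) : 0 <= x -> 0 <= y ->
  `|x - y| <= om -> `|Num.sqrt x - Num.sqrt y| <= Num.sqrt om.
Proof.
move=> x0 y0 xy; have om0 : 0 <= om := le_trans (normr_ge0 _) xy.
have sx := sqrtr_ge0 x; have sy := sqrtr_ge0 y.
rewrite -ler_sqr ?nnegrE ?sqrtr_ge0// sqr_sqrtr//; apply: le_trans xy.
rewrite -{2}(sqr_sqrtr x0) -{2}(sqr_sqrtr y0) subr_sqr normrM expr2.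
apply: ler_wpM2l => //; rewrite (ger0_norm (addr_ge0 sx sy)) ler_norml.
by apply/andP; split; lra.
Qed.

(** * Convergence in probability of the Euler exponents *)

Lemma ugrid_ge (R : realType) (r r' : R) n i : r <= r' -> r <= ugrid r r' n i.
Proof. by move=> rr'; rewrite lerDl mulr_ge0// divr_ge0// subr_ge0. Qed.

Section exponent_convergence.
Context d (T : measurableType d) (R : realType) (P : probability T R) (t0 : R)
  (F : R -> set (set T)) (W : R -> T -> R) (a g sigma : R) (X : R -> T -> R).
Hypotheses (hF : filtration t0 F) (hW : brownian_motion P t0 F W)
  (a0 : 0 < a) (g0 : 0 < g) (sigma0 : 0 < sigma)
  (hX : cir_core P t0 F W a g sigma X).

Let cX w : continuous (X ^~ w). Proof. by case: hX. Qed.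
Let X0 s w : 0 <= X s w. Proof. by case: hX. Qed.
Let mX s : t0 <= s -> Fmeas F s (X s). Proof. by case: hX => _ _ + _; exact. Qed.

Lemma ito_limit_sum (m : nat) (c : nat -> R) (G : nat -> R -> T -> R)
    (I : nat -> T -> R) : (forall i, ito_limit P t0 F W (G i) (I i)) ->
  ito_limit P t0 F W (fun s w => \sum_(i < m) c i * (G i.+1 s w - G i s w))
    (fun w => \sum_(i < m) c i * (I i.+1 w - I i w)).
Proof.
move=> hI; elim: m => [|m IH].
  pose E0 : eproc T R := @EProc T R 'I_0 (fun=> 0) (fun=> 0) (fun=> cst 0).
  have aE0 : eadapted t0 F E0 by case.
  have := ito_limit_eproc P W aE0.
  rewrite (_ : evalue E0 = (fun s w => \sum_(i < 0) c i * (G i.+1 s w - G i s w))); last first.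
    by apply/funext => s; apply/funext => w; rewrite /evalue !big_ord0.
  rewrite (_ : eint W E0 = (fun w => \sum_(i < 0) c i * (I i.+1 w - I i w)))//.
  by apply/funext => w; rewrite /eint !big_ord0.
have := ito_limit_lin (c m) (hI m.+1) (ito_limit_lin (- c m) (hI m) IH).
rewrite (_ : (fun s w => c m * _ + _) =
  (fun s w => \sum_(i < m.+1) c i * (G i.+1 s w - G i s w))); last first.
  by apply/funext => s; apply/funext => w; rewrite big_ord_recr/=; ring.
rewrite (_ : (fun w => c m * _ + _) =
  (fun w => \sum_(i < m.+1) c i * (I i.+1 w - I i w)))//.
by apply/funext => w; rewrite big_ord_recr/=; ring.
Qed.

Section exponent.
Variables (u t r r' : R).
Hypotheses (hu : - (a / sigma ^+ 2) <= u) (t0r : t0 <= r) (rr' : r <= r')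
  (r't : r' <= t).

Local Notation psi := (cir_psi a sigma u t).
Local Notation phi := (cir_phi a g sigma u t).
Local Notation grid n := (ugrid r r' n.+1).

Definition euler_proc (n : nat) : eproc T R := @EProc T R 'I_n.+1
  (fun i => grid n i) (fun i => grid n i.+1)
  (fun i w => psi (grid n i) * (sigma * Num.sqrt (X (grid n i) w))).

Definition euler_qvar (n : nat) (w : T) : R :=
  \sum_(i < n.+1) psi (grid n i) ^+ 2 * sigma ^+ 2 * X (grid n i) w
    * ((r' - r) / n.+1%:R).

Lemma euler_adapted n : eadapted t0 F (euler_proc n).
Proof.
move=> i /=; have /andP[ri ir'] := ugrid_bounds rr' (ltn0Sn n) (ltnW (ltn_ord i)).
have t0i : t0 <= grid n i by exact: le_trans ri.
split => //; first exact: ugrid_leS.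
apply: measurable_funM => //; apply: measurable_funM => //.
apply: (@measurableT_comp _ _ _ _ _ _ (@Num.sqrt R)); last exact: mX.
by apply: continuous_measurable_fun; exact: sqrt_continuous.
Qed.

(** [psi] is frozen at the left end of each cell in both processes, so on a cell they differ only by
    [psi sigma] times the oscillation of [sqrt(X)]. *)
Lemma euler_energy (C om : R) (n : nat) (w : T) : 0 <= C ->
  (forall s, r <= s -> s <= r' -> `|psi s| <= C) ->
  (forall x y, r <= x -> x <= r' -> r <= y -> y <= r' ->
     `|x - y| <= (r' - r) / n.+1%:R -> `|X x w - X y w| <= om) -> 0 <= om ->
  (energy (fun v w => 1 * evalue (euler_proc n) v w
     + \sum_(i < n.+1) - psi (grid n i)
         * (\1_`]t0, grid n i.+1] v * (sigma * Num.sqrt (X v w))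
            - \1_`]t0, grid n i] v * (sigma * Num.sqrt (X v w))))%R w
   <= (C ^+ 2 * sigma ^+ 2 * om * (r' - r))%:E)%E.
Proof.
move=> C0 psiC modX om0.
have gle i : grid n i <= grid n i.+1 by exact: ugrid_leS.
have gb i : (i <= n.+1)%N -> r <= grid n i <= r' by exact: ugrid_bounds.
pose k := C * (sigma * Num.sqrt om).
have k0 : 0 <= k by rewrite !mulr_ge0 ?sqrtr_ge0// ltW.
have indE i v : \1_`]t0, grid n i.+1] v - \1_`]t0, grid n i] v
    = \1_`]grid n i, grid n i.+1] v :> R.
  have t0i : t0 <= grid n i by rewrite (le_trans t0r)// ugrid_ge.
  rewrite !indicE !mem_setE/= !in_itv/=.
  have [vi|iv] := leP v (grid n i).
    by rewrite (le_trans vi (gle i)) subrr.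
  by rewrite (le_lt_trans t0i iv)/= subr0.
apply: (@le_trans _ _ (energy (fun v (_ : T) => k * \1_`]r, r'] v) w)).
  apply: energy_le.
  - apply: measurable_funD.
      by apply: measurable_funM => //; exact: measurable_evalue.
    have mS : measurable_fun setT (fun v => sigma * Num.sqrt (X v w)).
      apply: measurable_funM => //; apply: continuous_measurable_fun => v.
      by apply: (@continuous_comp _ _ _ (X ^~ w) Num.sqrt); [exact: cX|exact: sqrt_continuous].
    by apply: measurable_sum => i; apply: measurable_funM => //;
       apply: measurable_funB; apply: measurable_funM.
  - by apply: measurable_funM.
  move=> v.
  rewrite (_ : \sum_(i < n.+1) _ = - (sigma * Num.sqrt (X v w)) *
      \sum_(i < n.+1) psi (grid n i) * \1_`]grid n i, grid n i.+1] v); last first.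
    rewrite mulr_sumr; apply: eq_bigr => i _; rewrite -mulrBl indE; ring.
  rewrite mul1r /evalue/=.
  have [|nv] := boolP (r < v <= r'); last first.
    have nv' : ~~ (grid n 0%N < v <= grid n n.+1) by rewrite ugrid0 ugridn.
    rewrite (grid_step_value_out (fun i => psi (grid n i)) (fun i _ => gle i) nv').
    rewrite (grid_step_value_out (fun i => psi (grid n i) * (sigma * Num.sqrt (X (grid n i) w))) (fun i _ => gle i) nv').
    by rewrite mulr0 addr0 normr0.
  move=> /[dup] rvr' /andP[rv vr'].
  have [i ni ix] : exists2 i, (i < n.+1)%N & grid n i < v <= grid n i.+1.
    by apply: grid_locate; rewrite ?ugrid0 ?ugridn.
  rewrite (grid_step_value (fun i => psi (grid n i)) (fun i _ => gle i) ni ix).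
  rewrite (grid_step_value (fun i => psi (grid n i) * (sigma * Num.sqrt (X (grid n i) w))) (fun i _ => gle i) ni ix).
  rewrite indicE mem_setE/= in_itv/= rvr' mulr1 (ger0_norm k0).
  rewrite (_ : _ + _ = psi (grid n i) * (sigma * (Num.sqrt (X (grid n i) w) - Num.sqrt (X v w)))); last by ring.
  have /andP[ri ir'] := gb i (ltnW ni).
  rewrite /k [`|psi _ * _|]normrM [`|sigma * _|]normrM (gtr0_norm sigma0).
  apply: ler_pM => //; first by rewrite mulr_ge0// ltW.
    exact: psiC.
  apply: ler_wpM2l; first exact: ltW.
  apply: dist_sqrt_le => //; apply: modX => //; first exact: ltW.
  move: ix; rewrite ugrid_step => /andP[iv vi].
  by rewrite ltr0_norm ?subr_lt0// opprB lerBlDl.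
rewrite /energy.
rewrite (_ : (fun s => _) = ((cst (k ^+ 2)%:E) \_ `]r, r'])); last first.
  apply/funext => v; rewrite patchE indicE; case: ifPn => _.
    by rewrite mulr1.
  by rewrite mulr0 expr0n.
rewrite -integral_mkcond integral_cst//= lebesgue_measure_itv/= lte_fin.
rewrite /k !exprMn sqr_sqrtr//.
move: rr'; rewrite le_eqVlt => /predU1P[->|->].
  by rewrite ltxx mule0 subrr mulr0.
by rewrite -EFinB -EFinM !mulrA.
Qed.

(** The Euler integral is compared with [sum psi_i (I_(i+1) - I_i)], where [I_i] is the integral of
    [sigma sqrt(X)] up to grid time [i]. Their difference is an [ito_limit] of small energy, hence
    small. The equation rewrites [I_(i+1) - I_i] as the increment of [X] minus its drift, and the
    rest is the deterministic estimate. *)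
Lemma exponent_cvg (e : R) : 0 < e -> exists N, forall n, (N <= n)%N ->
  exists B : set T, [/\ measurable B, (P B <= e%:E)%E & forall w, ~ B w ->
    `|- eint W (euler_proc n) w - euler_qvar n w / 2
      - ((psi r * X r w + phi r) - (psi r' * X r' w + phi r'))| <= e].
Proof.
move=> e0; have e40 : 0 < e / 4 by exact: divr_gt0.
have [dl dl0 small] := ito_limit_small hF hW e40.
have [C C0 taylor] := cir_psi_phi_taylor t a0 g0 sigma0 hu.
have psiC s : r <= s -> s <= r' -> `|psi s| <= C.
  by move=> _ sr'; have [] := taylor s s (lexx _) (le_trans sr' r't).
pose M := 2 * a * C + sigma ^+ 2 / 2 * C ^+ 2.
have M0 : 0 <= M.
  by rewrite addr_ge0 ?mulr_ge0 ?divr_ge0 ?sqr_ge0// ltW.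
have r0 : 0 <= r' - r by rewrite subr_ge0.
pose k1 := C ^+ 2 * sigma ^+ 2 * (r' - r).
have k10 : 0 <= k1.
  by apply: mulr_ge0 => //; apply: mulr_ge0; exact: sqr_ge0.
pose k2 := (r' - r) * M.
have k20 : 0 <= k2 by rewrite mulr_ge0.
(* The first bound keeps the energy of the comparison below [dl], the second keeps the oscillation
   term of the deterministic estimate below [e / 4]; the added 1 avoids division by zero. *)
pose om := Num.min (dl / (k1 + 1)) (e / 4 / (k2 + 1)).
have k11 : 0 < k1 + 1 by lra.
have k21 : 0 < k2 + 1 by lra.
have om0 : 0 < om by rewrite lt_min !divr_gt0.
have om1 : k1 * om <= dl.
  apply: (@le_trans _ _ ((k1 + 1) * om)).
    by rewrite ler_pM2r// lerDl.
  by rewrite mulrC -ler_pdivlMr// ge_min lexx.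
have om2 : k2 * om <= e / 4.
  apply: (@le_trans _ _ ((k2 + 1) * om)).
    by rewrite ler_pM2r// lerDl.
  by rewrite mulrC -ler_pdivlMr// ge_min lexx orbT.
have [N0 [B0 [mB0 PB0 modX]]] := @uniform_modulus d T R P X r r' om (e / 4) rr' cX
  (fun s rs => Fmeas_measurable hF (le_trans t0r rs) (mX (le_trans t0r rs))) om0 e40.
have [N1 _ hN1] := @inv_natr_near R ((r' - r) * (C * (r' - r) * (N0%:R + 1))) _ e40.
exists (maxn N0 N1) => n; rewrite geq_max => /andP[N0n N1n].
have dln := hN1 n N1n; rewrite /= in dln.
have gle i : grid n i <= grid n i.+1 by exact: ugrid_leS.
have gb i : (i <= n.+1)%N -> r <= grid n i <= r' by exact: ugrid_bounds.
have t0g i : t0 <= grid n i.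
  by rewrite (le_trans t0r)// ugrid_ge.
have /choice[I hI] : forall i : nat, exists I : T -> R,
    ito_limit P t0 F W (fun v w => \1_`]t0, grid n i] v * (sigma * Num.sqrt (X v w))) I
    /\ {ae P, forall w, X (grid n i) w = X t0 w
          + \int[lebesgue_measure]_(v in `[t0, grid n i]) (a * (g - X v w)) + I w}.
  have [_ _ _ sde] := hX.
  by move=> i; have [I ? ?] := sde _ (t0g i); exists I.
(* The grid is countable, so one null set serves for all its times. *)
have [N' [mN' PN' sub]] : {ae P, forall w, forall i : nat, X (grid n i) w = X t0 w
          + \int[lebesgue_measure]_(v in `[t0, grid n i]) (a * (g - X v w)) + I i w}.
  by apply/ae_foralln => i; exact: (hI i).2.
have sdeE w : ~ N' w -> forall i : nat, X (grid n i) w = X t0 w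
          + \int[lebesgue_measure]_(v in `[t0, grid n i]) (a * (g - X v w)) + I i w.
  by move=> nw; apply: contrapT => h; apply: nw; exact: sub.
have itoG := ito_limit_lin 1 (ito_limit_eproc P W (@euler_adapted n))
  (ito_limit_sum n.+1 (fun i => - psi (grid n i)) (fun i => (hI i).1)).
have [B1 [mB1 PB1 hB1]] : exists B, [/\ measurable B, (P B <= P B0 + (e / 4)%:E)%E
      & forall w, ~ B w -> `|1 * eint W (euler_proc n) w
        + \sum_(i < n.+1) - psi (grid n i) * (I i.+1 w - I i w)| <= e / 4].
  apply: (small _ _ itoG B0 mB0) => w nB0; have [_ mod] := modX w nB0.
  apply: (le_trans (euler_energy C0 psiC (mod n N0n) (ltW om0))).
  rewrite lee_fin; apply: le_trans om1; rewrite /k1.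
  by rewrite -!mulrA [om * _]mulrC.
exists (B0 `|` (B1 `|` N')); split.
- by do 2? apply: measurableU.
- apply: (@le_trans _ _ ((e / 4)%:E + ((e / 4)%:E + (e / 4)%:E))%E).
    apply: measureU_le => //; first exact: measurableU.
    apply: (@le_trans _ _ (P B0 + (e / 4)%:E + 0)%E).
      by apply: measureU_le => //; rewrite PN'.
    by rewrite adde0 leeD2r.
  by rewrite -!EFinD lee_fin; lra.
move=> w /not_orP[nB0 /not_orP[nB1 nN']].
have [Xle mod] := modX w nB0.
have {}sdeE := sdeE w nN'; have {}hB1 := hB1 w nB1.
pose D i := \int[lebesgue_measure]_(v in `[t0, grid n i]) (a * (g - X v w)).
pose ee i := D i.+1 - D i.
have IE i : I i.+1 w - I i w = X (grid n i.+1) w - X (grid n i) w - ee i.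
  by rewrite !sdeE /ee /D; ring.
have dlE i : grid n i.+1 - grid n i = (r' - r) / n.+1%:R by rewrite ugrid_step; ring.
have dl0' : 0 <= (r' - r) / n.+1%:R by rewrite divr_ge0.
have modg i : (i < n.+1)%N -> forall v, grid n i <= v -> v <= grid n i.+1 ->
    `|X v w - X (grid n i) w| <= om.
  move=> ni v iv vi; have /andP[ri ir'] := gb i (ltnW ni).
  have /andP[ri' ir''] := gb i.+1 ni.
  apply: (mod n N0n) => //; [exact: le_trans iv|exact: le_trans vi _|].
  by rewrite ger0_norm ?subr_ge0// -(dlE i) lerD2r.
have est : `|\sum_(i < n.+1) (- (psi (grid n i) * (X (grid n i.+1) w - X (grid n i) w - ee i))
      - psi (grid n i) ^+ 2 * sigma ^+ 2 * X (grid n i) w * ((r' - r) / n.+1%:R) / 2)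
    - ((psi r * X r w + phi r) - (psi r' * X r' w + phi r'))| <= e / 4 + e / 4.
  have tay i : (i < n.+1)%N -> [/\
      `|psi (grid n i)| <= C,
      `|psi (grid n i.+1) - psi (grid n i) - (r' - r) / n.+1%:R
        * (a * psi (grid n i) + sigma ^+ 2 / 2 * psi (grid n i) ^+ 2)|
        <= C * ((r' - r) / n.+1%:R) ^+ 2
    & `|phi (grid n i.+1) - phi (grid n i) + (r' - r) / n.+1%:R
        * (a * g * psi (grid n i))| <= C * ((r' - r) / n.+1%:R) ^+ 2].
    move=> ni; have /andP[_ ir'] := gb i.+1 ni.
    by have := taylor _ _ (gle i) (le_trans ir' r't); rewrite dlE.
  have := @riccati_sum_estimate R a g sigma C N0%:R ((r' - r) / n.+1%:R) om n.+1
    (fun i => psi (grid n i)) (fun i => phi (grid n i)) (fun i => X (grid n i) w) ee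
    a0 C0 dl0' (ltW om0).
  rewrite /= ugrid0 ugridn//.
  set lhs := `| _ |; move=> est.
  apply: (@le_trans _ _ (n.+1%:R * ((r' - r) / n.+1%:R) *
    (M * om + C * ((r' - r) / n.+1%:R) * (N0%:R + 1)))).
    apply: est.
    - by move=> i /tay[].
    - by move=> i /tay[].
    - by move=> i /tay[].
    - by move=> i ni; apply: modg.
    - move=> i ni; have /andP[ri ir'] := gb i.+1 ni.
      by rewrite ger0_norm// Xle.
    - move=> i ni.
      have cD : continuous (fun v => a * (g - X v w)).
        move=> v; apply: cvgM; first exact: cvg_cst.
        by apply: cvgB; [exact: cvg_cst|exact: cX].
      have := @drift_estimate R (fun v => a * (g - X v w)) t0 (grid n i) (grid n i.+1)
        (a * om) cD (t0g i) (gle i).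
      rewrite dlE; apply => v iv vi.
      rewrite (_ : _ - _ = - (a * (X v w - X (grid n i) w))); last by ring.
      rewrite normrN normrM (gtr0_norm a0); apply: ler_wpM2l; first exact: ltW.
      exact: (modg i ni).
  rewrite mulrCA divff ?pnatr_eq0// mulr1 mulrDr; apply: lerD.
    by rewrite mulrA.
  by apply: le_trans dln; rewrite le_eqVlt; apply/orP; left; apply/eqP; ring.
have -> : - eint W (euler_proc n) w - euler_qvar n w / 2
      - ((psi r * X r w + phi r) - (psi r' * X r' w + phi r'))
  = - (1 * eint W (euler_proc n) w
        + \sum_(i < n.+1) - psi (grid n i) * (I i.+1 w - I i w))
    + (\sum_(i < n.+1) (- (psi (grid n i) * (X (grid n i.+1) w - X (grid n i) w - ee i))
      - psi (grid n i) ^+ 2 * sigma ^+ 2 * X (grid n i) w * ((r' - r) / n.+1%:R) / 2)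
    - ((psi r * X r w + phi r) - (psi r' * X r' w + phi r'))).
  have -> : euler_qvar n w / 2 = \sum_(i < n.+1)
      psi (grid n i) ^+ 2 * sigma ^+ 2 * X (grid n i) w * ((r' - r) / n.+1%:R) / 2.
    by rewrite /euler_qvar mulr_suml.
  have -> : \sum_(i < n.+1) - psi (grid n i) * (I i.+1 w - I i w)
      = \sum_(i < n.+1) - (psi (grid n i) * (X (grid n i.+1) w - X (grid n i) w - ee i)).
    by apply: eq_bigr => i _; rewrite IE mulNr.
  by rewrite sumrB; ring.
apply: (le_trans (ler_normD _ _)); rewrite normrN; lra.
Qed.

End exponent.

End exponent_convergence.

(** * The Laplace transform of the CIR process *)

Lemma expR_le_1D2x (R : realType) (x : R) : 0 <= x -> x <= 1 / 2 ->
  expR x <= 1 + 2 * x.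
Proof.
move=> x0 x1; have h := expR_ge1Dx (- x).
have p : 0 < 1 - x by lra.
rewrite -[leLHS]invrK -expRN; apply: (@le_trans _ _ (1 - x)^-1).
  by rewrite lef_pV2 ?posrE ?expR_gt0.
rewrite -[leLHS]mul1r ler_pdivrMr//.
have := mulr_ge0 x0 (_ : 0 <= 1 - 2 * x); lra.
Qed.

Section in_probability.
Context d (T : measurableType d) (R : realType) (P : probability T R).

Lemma ge0_le_integral_EFin (f h : T -> R) : measurable_fun setT f ->
  measurable_fun setT h -> (forall w, 0 <= f w) -> (forall w, f w <= h w) ->
  (\int[P]_w (f w)%:E <= \int[P]_w (h w)%:E)%E.
Proof.
move=> mf mh f0 fh; apply: ge0_le_integral => //.
- by move=> w _; rewrite lee_fin.
- exact/measurable_EFinP.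
- exact/measurable_EFinP.
- by move=> w _; rewrite lee_fin.
Qed.

Lemma ge0_integralD_EFin (f h : T -> R) : measurable_fun setT f ->
  measurable_fun setT h -> (forall w, 0 <= f w) -> (forall w, 0 <= h w) ->
  (\int[P]_w (f w + h w)%:E = \int[P]_w (f w)%:E + \int[P]_w (h w)%:E)%E.
Proof.
move=> mf mh f0 h0; under eq_integral do rewrite EFinD.
apply: ge0_integralD => //.
- by move=> w _; rewrite lee_fin.
- exact/measurable_EFinP.
- by move=> w _; rewrite lee_fin.
- exact/measurable_EFinP.
Qed.

Lemma ge0_integralZl_real (c : R) (f : T -> R) : measurable_fun setT f ->
  (forall w, 0 <= f w) -> 0 <= c ->
  (\int[P]_w (c * f w)%:E = c%:E * \int[P]_w (f w)%:E)%E.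
Proof.
move=> mf f0 c0; under eq_integral do rewrite EFinM.
apply: ge0_integralZl_EFin => //.
- by move=> w _; rewrite lee_fin.
- exact/measurable_EFinP.
Qed.

Lemma integral_indic_setT (B : set T) : measurable B ->
  (\int[P]_w (\1_B w)%:E = P B)%E.
Proof. by move=> mB; rewrite integral_indic// setIT. Qed.

Lemma integral_probability_le (f : T -> R) (c : R) : measurable_fun setT f ->
  (forall w, 0 <= f w) -> (forall w, f w <= c) ->
  (\int[P]_w (f w)%:E <= c%:E)%E.
Proof.
move=> mf f0 fc.
have -> : c%:E = (\int[P]_w (cst c%:E) w)%E.
  by rewrite -[LHS]mule1 -(@probability_setT _ _ _ P) -integral_cst.
by apply: ge0_le_integral_EFin => //; exact: measurable_cst.
Qed.

(** Off [B] the function is dominated by [h]; on [B] its truncation at [K] costs at most [K] times a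
    small probability. Monotone convergence then removes the truncation. *)
Lemma fatou_in_probability (f : T -> R) (M : R) : measurable_fun setT f ->
  (forall w, 0 <= f w) -> 0 <= M ->
  (forall e : R, 0 < e -> exists (h : T -> R) (B : set T), [/\ measurable_fun setT h,
     forall w, 0 <= h w, (\int[P]_w (h w)%:E <= M%:E)%E, measurable B
     & (P B <= e%:E)%E /\ forall w, ~ B w -> f w <= expR e * h w]) ->
  (\int[P]_w (f w)%:E <= M%:E)%E.
Proof.
move=> mf f0 M0 hf.
have trunc (K : nat) : (\int[P]_w (Num.min (f w) K%:R)%:E <= M%:E)%E.
  have mmin : measurable_fun setT (fun w => Num.min (f w) K%:R).
    exact: measurable_minr.
  apply/lee_addgt0Pr => e1 e10.
  (* The total error is at most [2 e M + K e], by [exp(e) <= 1 + 2 e]. *)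
  pose C := 2 * M + K%:R + 1.
  have C0 : 0 < C by rewrite /C; have := ler0n R K; lra.
  pose e := Num.min (1 / 2) (e1 / C).
  have e0 : 0 < e by rewrite lt_min; apply/andP; split; [lra|exact: divr_gt0].
  have e12 : e <= 1 / 2 by rewrite ge_min lexx.
  have eC : e * C <= e1 by rewrite -ler_pdivlMr// ge_min lexx orbT.
  have [h [B [mh h0 hM mB [PB fh]]]] := hf e e0.
  apply: (@le_trans _ _ (\int[P]_w (expR e * h w + K%:R * \1_B w)%:E)%E).
    apply: ge0_le_integral_EFin => //.
    - by apply: measurable_funD; apply: measurable_funM => //; exact: measurable_indic.
    - by move=> w; rewrite le_min f0/=.
    - move=> w; rewrite indicE; have [Bw|nB] := pselect (B w).
        rewrite mem_set// mulr1; apply: (@le_trans _ _ K%:R); first by rewrite ge_min lexx orbT.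
        by rewrite lerDr mulr_ge0// expR_ge0.
      rewrite memNset// mulr0 addr0; apply: le_trans (fh w nB).
      by rewrite ge_min lexx.
  have m1 : measurable_fun setT (fun w => expR e * h w) by exact: measurable_funM.
  have m2 : measurable_fun setT (fun w : T => K%:R * \1_B w : R).
    by apply: measurable_funM => //; exact: measurable_indic.
  have p1 w : 0 <= expR e * h w by rewrite mulr_ge0// expR_ge0.
  have p2 (w : T) : 0 <= K%:R * \1_B w :> R by rewrite mulr_ge0.
  rewrite ge0_integralD_EFin// !ge0_integralZl_real ?expR_ge0//.
  rewrite integral_indic_setT//.
  apply: (@le_trans _ _ ((expR e)%:E * M%:E + K%:R%:E * e%:E)%E).
    by apply: leeD; apply: lee_wpmul2l => //; rewrite lee_fin expR_ge0.
  rewrite -!EFinM -!EFinD lee_fin.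
  have h1 := ler_wpM2r M0 (expR_le_1D2x (ltW e0) e12).
  rewrite /C in eC; lra.
have cvg : (fun K : nat => \int[P]_w (Num.min (f w) K%:R)%:E)%E @ \oo -->
    (\int[P]_w (f w)%:E)%E.
  rewrite (_ : (\int[P]_w (f w)%:E)%E
     = (\int[P]_w limn (fun K : nat => (Num.min (f w) K%:R)%:E))%E).
    apply: cvg_monotone_convergence => //.
    - move=> n; apply/measurable_EFinP; exact: measurable_minr.
    - by move=> n w _; rewrite lee_fin le_min f0/=.
    - move=> w _ m n mn; rewrite lee_fin le_min ge_min lexx/=.
      by rewrite ge_min ler_nat mn orbT.
  apply: eq_integral => w _; apply/esym/cvg_lim => //.
  apply: cvg_near_cst.
  by apply: filterS (nbhs_infty_gtr (f w)) => n /ltW fn; rewrite min_l.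
apply: (cvge_le _ cvg) => //; exact: nearW.
Qed.

(** Mass of [h] could escape on the small event [B]; the uniform second moment excludes this. The
    event is taken of probability at most [l^2], so the loss on it is at most [l C + l]. *)
Lemma lower_in_probability (f : T -> R) (M C : R) : measurable_fun setT f ->
  (forall w, 0 <= f w) -> 0 <= C ->
  (forall e : R, 0 < e -> exists (h : T -> R) (B : set T), [/\ measurable_fun setT h,
     forall w, 0 <= h w, (M%:E <= \int[P]_w (h w)%:E)%E,
     (\int[P]_w (h w ^+ 2)%:E <= C%:E)%E
     & [/\ measurable B, (P B <= e%:E)%E
        & forall w, ~ B w -> h w <= expR e * f w]]) ->
  (M%:E <= \int[P]_w (f w)%:E)%E.
Proof.
move=> mf f0 C0 hf.
have int0 : (0 <= \int[P]_w (f w)%:E)%E.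
  by apply: integral_ge0 => w _; rewrite lee_fin.
case IE : (\int[P]_w (f w)%:E)%E int0 => [J| |]//; last by move=> _; rewrite leey.
rewrite lee_fin => J0.
apply/lee_addgt0Pr => e1 e10.
pose D := 2 * J + C + 1.
have D0 : 0 < D by rewrite /D; lra.
pose l := Num.min (1 / 2) (e1 / D).
have l0 : 0 < l.
  rewrite lt_min; apply/andP; split; first by rewrite divr_gt0.
  exact: divr_gt0.
have l12 : l <= 1 / 2 by rewrite ge_min lexx.
have lD : l * D <= e1 by rewrite -ler_pdivlMr// ge_min lexx orbT.
have ll0 : 0 < l ^+ 2 by rewrite exprn_gt0.
have lll : l ^+ 2 <= l by rewrite expr2 ger_pMl//; lra.
have [h [B [mh h0 Mh hC [mB PB hfw]]]] := hf _ ll0.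
have mh2 : measurable_fun setT (fun w => h w ^+ 2) by exact: measurable_funX.
apply: (le_trans Mh).
apply: (@le_trans _ _ (\int[P]_w ((expR l * f w + l * h w ^+ 2) + l^-1 * \1_B w)%:E)%E).
  apply: ge0_le_integral_EFin => //.
  - apply: measurable_funD; last by apply: measurable_funM => //; exact: measurable_indic.
    by apply: measurable_funD; apply: measurable_funM.
  - move=> w; rewrite indicE; have [Bw|nB] := pselect (B w).
      rewrite mem_set// mulr1.
      have h1 : 0 <= expR l * f w by rewrite mulr_ge0// expR_ge0.
      (* Young's inequality: it trades the first moment on [B] for a small multiple of the second
         moment plus [l^-1] times [P B]. *)
      have h2 : h w <= l * h w ^+ 2 + l^-1.
        rewrite -subr_ge0.
        have -> : l * h w ^+ 2 + l^-1 - h w = l^-1 * ((l * h w - 1 / 2) ^+ 2 + 3 / 4).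
          by field; rewrite gt_eqF.
        by rewrite mulr_ge0// ?invr_ge0 ?(ltW l0)// addr_ge0 ?sqr_ge0//; lra.
      lra.
    rewrite memNset// mulr0 addr0; apply: (le_trans (hfw w nB)).
    apply: (@le_trans _ _ (expR l * f w)).
      by apply: ler_wpM2r => //; rewrite ler_expR.
    by rewrite lerDl mulr_ge0// ?sqr_ge0// ltW.
have m1 : measurable_fun setT (fun w => expR l * f w) by exact: measurable_funM.
have m2 : measurable_fun setT (fun w => l * h w ^+ 2) by exact: measurable_funM.
have p1 w : 0 <= expR l * f w by rewrite mulr_ge0// expR_ge0.
have p2 w : 0 <= l * h w ^+ 2 by rewrite mulr_ge0 ?sqr_ge0// ltW.
have m3 : measurable_fun setT (fun w : T => l^-1 * \1_B w).
  by apply: measurable_funM => //; exact: measurable_indic.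
have p3 (w : T) : 0 <= l^-1 * \1_B w by rewrite mulr_ge0// invr_ge0 ltW.
have m12 := measurable_funD m1 m2.
have p12 w := addr_ge0 (p1 w) (p2 w).
rewrite ge0_integralD_EFin// ge0_integralD_EFin//.
rewrite !ge0_integralZl_real ?expR_ge0 ?invr_ge0 ?(ltW l0)//; last first.
  by move=> w; rewrite sqr_ge0.
rewrite IE integral_indic_setT//.
apply: (@le_trans _ _ ((expR l)%:E * J%:E + l%:E * C%:E + l^-1%:E * (l ^+ 2)%:E)%E).
  apply: leeD; first apply: leeD => //.
    by apply: lee_wpmul2l => //; rewrite lee_fin ltW.
  by apply: lee_wpmul2l => //; rewrite lee_fin invr_ge0 ltW.
rewrite -!EFinM -!EFinD lee_fin expr2 mulKf ?gt_eqF//.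
have h1 := ler_wpM2r J0 (expR_le_1D2x (ltW l0) l12).
rewrite /D in lD; lra.
Qed.

End in_probability.

(** Jensen's inequality for a uniform average, from the tangent line of the exponential at the
    mean. *)
Lemma expR_average_le (R : realType) (n : nat) (y : nat -> R) :
  expR (\sum_(i < n.+1) y i / n.+1%:R) <= (\sum_(i < n.+1) expR (y i)) / n.+1%:R.
Proof.
set m := \sum_(i < n.+1) y i / n.+1%:R.
have n0 : n.+1%:R != 0 :> R by rewrite pnatr_eq0.
rewrite ler_pdivlMr ?ltr0n//.
have : \sum_(i < n.+1) (expR m * (1 + (y i - m))) <= \sum_(i < n.+1) expR (y i).
  apply: ler_sum => i _; rewrite -{2}(subrK m (y i)) expRD mulrC.
  by apply: ler_wpM2r; [exact: expR_ge0|exact: expR_ge1Dx].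
rewrite -mulr_sumr big_split/= sumrB !sumr_const card_ord.
have -> : \sum_(i < n.+1) y i = m * n.+1%:R.
  by rewrite /m -mulr_suml divfK.
by rewrite mulr_natr subrr addr0.
Qed.

Section cir_laplace.
Context d (T : measurableType d) (R : realType) (P : probability T R) (t0 : R)
  (F : R -> set (set T)) (W : R -> T -> R) (a g sigma : R) (X : R -> T -> R).
Hypotheses (hF : filtration t0 F) (hW : brownian_motion P t0 F W)
  (a0 : 0 < a) (g0 : 0 < g) (sigma0 : 0 < sigma)
  (hX : cir_core P t0 F W a g sigma X).

Let X0 s w : 0 <= X s w. Proof. by case: hX. Qed.
Let mX s : t0 <= s -> Fmeas F s (X s). Proof. by case: hX => _ _ + _; exact. Qed.
Let mX' s : t0 <= s -> measurable_fun setT (X s).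
Proof. by move=> t0s; exact: (Fmeas_measurable hF t0s (mX t0s)). Qed.

(** The candidate for the conditional expectation of [exp(- u X(t))] given the past up to [s]; at
    [s = t] it is that variable itself. *)
Definition cir_exp (u t s : R) (w : T) : R :=
  expR (- (cir_psi a sigma u t s * X s w + cir_phi a g sigma u t s)).

Lemma Fmeas_cir_exp u t s : t0 <= s -> Fmeas F s (cir_exp u t s).
Proof.
move=> t0s; apply: measurableT_comp => //; apply: measurable_funN.
by apply: measurable_funD => //; apply: measurable_funM => //; exact: mX.
Qed.

Lemma cir_exp_ge0 u t s w : 0 <= cir_exp u t s w.
Proof. exact: expR_ge0. Qed.

Lemma cir_exp_end u t w : cir_exp u t t w = expR (- (u * X t w)).
Proof.
rewrite /cir_exp /cir_psi /cir_phi /cir_var subrr mulr0 oppr0 expR0.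
by rewrite subrr !(mulr0, mul0r) addr0 ln1 divr1 mulr1 mulr0 addr0.
Qed.

Section interval.
Variables (u t r r' : R).
Hypotheses (hu : - (a / sigma ^+ 2) <= u) (t0r : t0 <= r) (rr' : r <= r')
  (r't : r' <= t).

Local Notation psi := (cir_psi a sigma u t).
Local Notation phi := (cir_phi a g sigma u t).
Local Notation grid n := (ugrid r r' n.+1).
Local Notation L n := (eint W (euler_proc a sigma X u t r r' n)).
Local Notation Q n := (euler_qvar a sigma X u t r r' n).

Let t0g n i : t0 <= grid n i.
Proof. by rewrite (le_trans t0r)// ugrid_ge. Qed.

Lemma measurable_euler_qvar n : measurable_fun setT (Q n).
Proof.
apply: measurable_sum => i; apply: measurable_funM => //.
by apply: measurable_funM => //; exact: mX'.
Qed.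

Lemma measurable_euler_int n : measurable_fun setT (L n).
Proof. by apply: (measurable_eint hF hW); exact: (euler_adapted hX t0r rr'). Qed.

(** Used with [k = -1] for the exponential itself and with [k = -4] for its second moment. *)
Lemma euler_exp_martingale (n : nat) (k : R) (z : T -> R) :
  Fmeas F r z -> (forall w, 0 <= z w) ->
  (\int[P]_w (z w * expR (k * L n w - k ^+ 2 / 2 * Q n w))%:E
    = \int[P]_w (z w)%:E)%E.
Proof.
move=> mz z0.
rewrite -(@exponential_martingale_grid _ _ _ _ _ _ _ hF hW n.+1 (grid n)
  (fun i w => k * (psi (grid n i) * (sigma * Num.sqrt (X (grid n i) w)))) z)//.
- apply: eq_integral => w _; congr (_ * expR _)%:E.
  rewrite /eint /euler_qvar/= !mulr_sumr -sumrB; apply: eq_bigr => i _.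
  rewrite ugrid_step (_ : _ + _ - _ = (r' - r) / n.+1%:R); last by ring.
  move: (psi (grid n i)) (_ / n.+1%:R) => y q; rewrite !exprMn sqr_sqrtr//.
  by field.
- by move=> i _; exact: ugrid_leS.
- move=> i _; apply: measurable_funM => //; apply: measurable_funM => //; apply: measurable_funM => //.
  apply: (@measurableT_comp _ _ _ _ _ _ (@Num.sqrt R)); last exact: mX.
  by apply: continuous_measurable_fun; exact: sqrt_continuous.
- by rewrite ugrid0.
Qed.

(** The Euler exponentials started from [z * cir_exp u t r] keep its mean and approach
    [z * cir_exp u t r'] in probability, so Fatou's lemma gives one inequality. Negative [u] is
    allowed. *)
Lemma cir_exp_supermartingale (z : T -> R) (M : R) : Fmeas F r z ->
  (forall w, 0 <= z w) -> 0 <= M ->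
  (\int[P]_w (z w * cir_exp u t r w)%:E <= M%:E)%E ->
  (\int[P]_w (z w * cir_exp u t r' w)%:E <= M%:E)%E.
Proof.
move=> mz z0 M0 zM; have t0r' := le_trans t0r rr'.
have mz' := Fmeas_measurable hF t0r mz.
have mr := Fmeas_measurable hF t0r (Fmeas_cir_exp u t t0r).
have mr' := Fmeas_measurable hF t0r' (Fmeas_cir_exp u t t0r').
apply: fatou_in_probability => //.
- exact: measurable_funM.
- by move=> w; rewrite mulr_ge0// cir_exp_ge0.
move=> e e0; have [N hN] := exponent_cvg hF hW a0 g0 sigma0 hX hu t0r rr' r't e0.
have [B [mB PB hB]] := hN N (leqnn _).
exists (fun w => z w * cir_exp u t r w * expR (- L N w - Q N w / 2)), B; split => //.
- apply: measurable_funM; first exact: measurable_funM.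
  apply: measurableT_comp => //; apply: measurable_funB.
    by apply: measurableT_comp => //; exact: measurable_euler_int.
  by apply: measurable_funM => //; exact: measurable_euler_qvar.
- by move=> w; rewrite !mulr_ge0// ?cir_exp_ge0// expR_ge0.
- apply: le_trans zM.
  rewrite -(@euler_exp_martingale N (-1) (fun w => z w * cir_exp u t r w)).
  + rewrite le_eqVlt; apply/orP; left; apply/eqP; apply: eq_integral => w _.
    by congr (_ * expR _)%:E; field.
  + by apply: measurable_funM => //; exact: Fmeas_cir_exp.
  + by move=> w; rewrite mulr_ge0// cir_exp_ge0.
- split => // w nB; rewrite -mulrA [leRHS]mulrCA; apply: ler_wpM2l => //.
  rewrite /cir_exp -!expRD ler_expR.
  by have := hB w nB; rewrite ler_norml => /andP[+ _]; lra.
Qed.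

(* The exponentials of the Euler sums are bounded in L^2 only over intervals
   short enough for [exp (6 Q)] to be controlled by the moment of
   [exp (a / sigma^2 X)]; longer intervals are obtained by chaining. *)
Lemma cir_exp_submartingale (z : T -> R) (C : R) :
  0 <= u -> Fmeas F r z -> (forall w, 0 <= z w <= 1) -> 0 <= C ->
  6 * (2 * u) ^+ 2 * sigma ^+ 2 * (r' - r) <= a / sigma ^+ 2 ->
  (forall s, t0 <= s ->
     (\int[P]_w (z w * expR (a / sigma ^+ 2 * X s w))%:E <= C%:E)%E) ->
  (\int[P]_w (z w * cir_exp u t r w)%:E
    <= \int[P]_w (z w * cir_exp u t r' w)%:E)%E.
Proof.
move=> u0 mz z01 C0 small hC; have t0r' := le_trans t0r rr'.
have z0 w : 0 <= z w by have /andP[] := z01 w.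
have z1 w : z w <= 1 by have /andP[] := z01 w.
have mz' := Fmeas_measurable hF t0r mz.
have mr := Fmeas_measurable hF t0r (Fmeas_cir_exp u t t0r).
have mr' := Fmeas_measurable hF t0r' (Fmeas_cir_exp u t t0r').
have E1 w : cir_exp u t r w <= 1.
  have rt : 0 <= t - r by rewrite subr_ge0 (le_trans rr').
  have c0 := cir_var_ge0 sigma a0 rt.
  have uc0 : 0 <= u * cir_var a sigma (t - r) by exact: mulr_ge0.
  have dc : 1 <= 1 + u * cir_var a sigma (t - r) by lra.
  rewrite expR_le1 oppr_le0 addr_ge0//; apply: mulr_ge0 => //.
  - by rewrite divr_ge0 ?mulr_ge0 ?expR_ge0//; lra.
  - by rewrite divr_ge0 ?sqr_ge0// !mulr_ge0// ltW.
  - exact: ln_ge0.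
have zEle w : z w * cir_exp u t r w <= 1.
  by rewrite -[leRHS]mul1r; apply: ler_pM => //; exact: cir_exp_ge0.
have fin : (\int[P]_w (z w * cir_exp u t r w)%:E \is a fin_num)%E.
  rewrite ge0_fin_numE; last first.
    by apply: integral_ge0 => w _; rewrite lee_fin mulr_ge0// cir_exp_ge0.
  apply: le_lt_trans (ltry 1); apply: integral_probability_le => //.
  - exact: measurable_funM.
  - by move=> w; rewrite mulr_ge0// cir_exp_ge0.
rewrite -(fineK fin).
apply: (@lower_in_probability _ _ _ _ _ _ ((1 + C) / 2)) => //.
- exact: measurable_funM.
- by move=> w; rewrite mulr_ge0// cir_exp_ge0.
- by rewrite divr_ge0// addr_ge0.
move=> e e0; have [N hN] := exponent_cvg hF hW a0 g0 sigma0 hX hu t0r rr' r't e0.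
have [B [mB PB hB]] := hN N (leqnn _).
have mZ k l : measurable_fun setT (fun w => expR (k * L N w - l * Q N w)).
  apply: measurableT_comp => //; apply: measurable_funB.
    by apply: measurable_funM => //; exact: measurable_euler_int.
  by apply: measurable_funM => //; exact: measurable_euler_qvar.
have mexp i : measurable_fun setT (fun w => expR (a / sigma ^+ 2 * X (grid N i) w)).
  by apply: measurableT_comp => //; apply: measurable_funM => //; exact: mX'.
(* By the smallness hypothesis and [|psi| <= 2 u], [6 Q] is at most the average over the grid of
   [a / sigma^2 * X], to which Jensen's inequality applies. *)
have Q6 w : expR (6 * Q N w)
    <= (\sum_(i < N.+1) expR (a / sigma ^+ 2 * X (grid N i) w)) / N.+1%:R.
  apply: le_trans (expR_average_le N (fun i => a / sigma ^+ 2 * X (grid N i) w)).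
  rewrite ler_expR /euler_qvar mulr_sumr; apply: ler_sum => i _.
  have st : grid N i <= t.
    have /andP[_ ir'] := ugrid_bounds rr' (ltn0Sn N) (ltnW (ltn_ord i)).
    exact: le_trans r't.
  have := cir_psi_le a0 sigma0 hu st; rewrite (ger0_norm u0).
  move: (psi (grid N i)) => y yu.
  have xq0 : 0 <= X (grid N i) w * N.+1%:R^-1 by rewrite mulr_ge0// invr_ge0.
  have k : 6 * y ^+ 2 * sigma ^+ 2 * (r' - r) <= a / sigma ^+ 2.
    apply: le_trans small; apply: ler_wpM2r; first by rewrite subr_ge0.
    apply: ler_wpM2r; first exact: sqr_ge0.
    by apply: ler_wpM2l => //; rewrite -(real_normK (num_real y)) lerXn2r// nnegrE// mulr_ge0.
  have := ler_wpM2r xq0 k.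
  congr (_ <= _); ring.
(* The square of the exponential is [exp(-2 L - Q) = exp(-2 L - 4 Q) * exp(3 Q)]. The product is at
   most half the sum of the squares, and these are the exponential martingale with [k = -4] and
   [exp(6 Q)], whence the constant 6. *)
have sq_le w : (z w * cir_exp u t r w * expR (-1 * L N w - (-1) ^+ 2 / 2 * Q N w)) ^+ 2
  <= 1 / 2 * (z w * expR (-4 * L N w - (-4) ^+ 2 / 2 * Q N w))
      + 1 / 2 * (z w * ((\sum_(i < N.+1) expR (a / sigma ^+ 2 * X (grid N i) w)) / N.+1%:R)).
  set x := expR (-2 * L N w - 4 * Q N w); set y := expR (3 * Q N w).
  have -> : expR (-4 * L N w - (-4) ^+ 2 / 2 * Q N w) = x ^+ 2.
    by rewrite /x -expRM_natl; congr expR; field.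
  have y2 : y ^+ 2 = expR (6 * Q N w) by rewrite /y -expRM_natl; congr expR; ring.
  rewrite exprMn.
  have -> : expR (-1 * L N w - (-1) ^+ 2 / 2 * Q N w) ^+ 2 = x * y.
    by rewrite /x /y -expRM_natl -expRD; congr expR; field.
  have xy0 : 0 <= x * y by rewrite mulr_ge0// expR_ge0.
  have xy : x * y <= 1 / 2 * x ^+ 2 + 1 / 2 * y ^+ 2.
    by have := sqr_ge0 (x - y); rewrite !expr2; lra.
  have zE2 : (z w * cir_exp u t r w) ^+ 2 <= z w.
    rewrite expr2 -[leRHS]mulr1; apply: ler_pM => //.
    - by rewrite mulr_ge0// cir_exp_ge0.
    - by rewrite mulr_ge0// cir_exp_ge0.
    - by rewrite ler_piMr.
  apply: (le_trans (ler_wpM2r xy0 zE2)).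
  have := Q6 w; set A := _ / N.+1%:R => Aw.
  rewrite (_ : _ + _ = z w * (1 / 2 * x ^+ 2 + 1 / 2 * A)); last by ring.
  apply: ler_wpM2l => //.
  apply: (le_trans xy); rewrite lerD2l y2; apply: ler_wpM2l => //.
have avgC : (\int[P]_w (z w * ((\sum_(i < N.+1) expR (a / sigma ^+ 2 * X (grid N i) w)) / N.+1%:R))%:E
    <= C%:E)%E.
  have -> : (fun w => (z w * ((\sum_(i < N.+1) expR (a / sigma ^+ 2 * X (grid N i) w)) / N.+1%:R))%:E)
    = (fun w => (N.+1%:R^-1 * (\sum_(i < N.+1) z w * expR (a / sigma ^+ 2 * X (grid N i) w)))%:E).
    by apply/funext => w; rewrite -mulr_sumr; congr EFin; ring.
  rewrite ge0_integralZl_real ?invr_ge0//; last 2 first.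
  - by apply: measurable_sum => i; exact: measurable_funM.
  - by move=> w; apply: sumr_ge0 => i _; rewrite mulr_ge0// expR_ge0.
  under eq_integral do rewrite -sumEFin.
  rewrite ge0_integral_sum//; last 2 first.
  - by move=> i; apply/measurable_EFinP; exact: measurable_funM.
  - by move=> i w _; rewrite lee_fin mulr_ge0// expR_ge0.
  apply: (@le_trans _ _ (N.+1%:R^-1%:E * (\sum_(i < N.+1) C%:E)%E)%E).
    apply: lee_wpmul2l; first by rewrite lee_fin invr_ge0.
    by apply: lee_sum => i _; exact: hC.
  rewrite sumEFin sumr_const card_ord -EFinM lee_fin -[C *+ _]mulr_natl mulKf//.
have zint : (\int[P]_w (z w)%:E <= 1)%E.
  exact: integral_probability_le.
exists (fun w => z w * cir_exp u t r w * expR (-1 * L N w - (-1) ^+ 2 / 2 * Q N w)), B; split => //.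
- by apply: measurable_funM => //; exact: measurable_funM.
- by move=> w; rewrite !mulr_ge0// ?cir_exp_ge0// expR_ge0.
- rewrite fineK// (@euler_exp_martingale N (-1) (fun w => z w * cir_exp u t r w))//.
  + by apply: measurable_funM => //; exact: Fmeas_cir_exp.
  + by move=> w; rewrite mulr_ge0// cir_exp_ge0.
- apply: (@le_trans _ _ (\int[P]_w (1 / 2 * (z w * expR (-4 * L N w - (-4) ^+ 2 / 2 * Q N w))
      + 1 / 2 * (z w * ((\sum_(i < N.+1) expR (a / sigma ^+ 2 * X (grid N i) w)) / N.+1%:R)))%:E)%E).
    apply: ge0_le_integral_EFin.
    - by apply: measurable_funX; apply: measurable_funM => //; exact: measurable_funM.
    - apply: measurable_funD; apply: measurable_funM => //; apply: measurable_funM => //.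
      by apply: measurable_funM => //; apply: measurable_sum.
    - by move=> w; rewrite sqr_ge0.
    - by move=> w; exact: sq_le.
  rewrite ge0_integralD_EFin; last 4 first.
  - by apply: measurable_funM => //; exact: measurable_funM.
  - apply: measurable_funM => //; apply: measurable_funM => //.
    by apply: measurable_funM => //; apply: measurable_sum.
  - by move=> w; rewrite !mulr_ge0// expR_ge0.
  - by move=> w; rewrite !mulr_ge0// ?invr_ge0// sumr_ge0// => i _; exact: expR_ge0.
  rewrite !ge0_integralZl_real//; last 4 first.
  - apply: measurable_funM => //.
    by apply: measurable_funM => //; apply: measurable_sum.
  - by move=> w; rewrite !mulr_ge0// ?invr_ge0// sumr_ge0// => i _; exact: expR_ge0.
  - exact: measurable_funM.
  - by move=> w; rewrite !mulr_ge0// expR_ge0.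
  rewrite euler_exp_martingale//.
  have -> : (1 + C) / 2 = 1 / 2 * 1 + 1 / 2 * C by field.
  rewrite EFinD 2!(EFinM (1 / 2)); apply: leeD; apply: lee_wpmul2l => //.
- split => // w nB; rewrite -mulrA [leRHS]mulrCA; apply: ler_wpM2l => //.
  rewrite /cir_exp -!expRD ler_expR.
  by have := hB w nB; rewrite ler_norml => /andP[_ +]; lra.
Qed.

End interval.

End cir_laplace.

Section cir_laplace_bounds.
Context d (T : measurableType d) (R : realType) (P : probability T R) (t0 : R)
  (F : R -> set (set T)) (W : R -> T -> R) (a g sigma : R) (X : R -> T -> R).
Hypotheses (hF : filtration t0 F) (hW : brownian_motion P t0 F W)
  (a0 : 0 < a) (g0 : 0 < g) (sigma0 : 0 < sigma)
  (hX : cir_core P t0 F W a g sigma X).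

Let X0 s w : 0 <= X s w. Proof. by case: hX. Qed.
Let mX s : t0 <= s -> Fmeas F s (X s). Proof. by case: hX => _ _ + _; exact. Qed.

Local Notation A K := [set w | X t0 w <= K].

Let FA K : F t0 (A K).
Proof.
rewrite (_ : A K = (X t0) @^-1` `]-oo, K]); last by rewrite preimage_itvNyc.
by apply: (Fmeas_set hF (lexx t0) (mX (lexx t0))); exact: measurable_itv.
Qed.

Let mA K s : t0 <= s -> Fmeas F s (\1_(A K) : T -> R).
Proof.
by move=> t0s; apply: (Fmeas_le hF (lexx t0) t0s); exact: (Fmeas_indic hF (lexx t0)).
Qed.

Let theta0 : 0 < 2 * a * g / sigma ^+ 2.
Proof. by rewrite divr_gt0 ?exprn_gt0 ?mulr_gt0. Qed.

(* This is the supermartingale at the most negative admissible [u]. *)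
Lemma cir_exp_moment (K : R) : exists2 C : R, 0 <= C & forall s, t0 <= s ->
  (\int[P]_w (\1_(A K) w * expR (a / sigma ^+ 2 * X s w))%:E <= C%:E)%E.
Proof.
set eta := a / sigma ^+ 2.
have eta0 : 0 < eta by rewrite divr_gt0 ?exprn_gt0.
(* On the event [X t0 <= K] the exponent at [t0] is bounded by [|psi| <= 2 eta], and
   [- phi <= theta ln 2] because the denominator is at least [1/2]. *)
exists (expR (2 * eta * K + 2 * a * g / sigma ^+ 2 * ln 2)); first exact: expR_ge0.
move=> s t0s; have hu : - (a / sigma ^+ 2) <= - eta by [].
have mz := mA K (lexx t0).
have z0 w : 0 <= (\1_(A K) w : R) by [].
have mE := Fmeas_cir_exp hX (- eta) s (lexx t0).
rewrite (_ : (\int[P]_w _)%E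
    = (\int[P]_w (\1_(A K) w * cir_exp a g sigma X (- eta) s s w)%:E)%E); last first.
  by apply: eq_integral => w _; rewrite cir_exp_end mulNr opprK.
apply: (@cir_exp_supermartingale _ _ _ _ _ _ _ _ _ _ _ hF hW a0 g0 sigma0 hX
  (- eta) s t0 s hu (lexx t0) t0s (lexx s) _ _ mz z0 (expR_ge0 _)).
apply: integral_probability_le.
- apply: measurable_funM; first exact: (Fmeas_measurable hF (lexx t0) mz).
  exact: (Fmeas_measurable hF (lexx t0) mE).
- by move=> w; rewrite mulr_ge0// cir_exp_ge0.
move=> w; rewrite indicE; have [/= wA|wA] := boolP (w \in A K); last by rewrite mul0r expR_ge0.
move: wA; rewrite inE/= => XK; rewrite mul1r ler_expR opprD.
have st0 : 0 <= s - t0 by rewrite subr_ge0.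
have psi2 := cir_psi_le a0 sigma0 hu t0s; rewrite normrN (gtr0_norm eta0) in psi2.
apply: lerD.
  rewrite -mulNr; apply: (@le_trans _ _ (2 * eta * X t0 w)).
    apply: ler_wpM2r => //; move: psi2; rewrite ler_norml => /andP[+ _]; lra.
  by apply: ler_wpM2l => //; rewrite mulr_ge0// ltW.
have d12 := cir_denom_ge a0 sigma0 hu st0.
rewrite /cir_phi -mulrN; apply: ler_wpM2l; first exact: ltW.
rewrite -lnV ?posrE//; last by lra.
rewrite ler_ln ?posrE ?invr_gt0//; last by lra.
rewrite invf_ple ?posrE//; lra.
Qed.

Lemma cir_laplace_le (u t : R) : 0 <= u -> t0 <= t ->
  (\int[P]_w (expR (- (u * X t w)))%:E <= \int[P]_w (cir_exp a g sigma X u t t0 w)%:E)%E.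
Proof.
move=> u0 t0t; have hu : - (a / sigma ^+ 2) <= u.
  by apply: le_trans u0; rewrite oppr_le0 divr_ge0 ?sqr_ge0// ltW.
have int0 : (0 <= \int[P]_w (cir_exp a g sigma X u t t0 w)%:E)%E.
  by apply: integral_ge0 => w _; rewrite lee_fin cir_exp_ge0.
case IE : (\int[P]_w (cir_exp a g sigma X u t t0 w)%:E)%E int0 => [J| |]//; last by move=> _; rewrite leey.
rewrite lee_fin => J0.
have mz : Fmeas F t0 (cst 1 : T -> R) by exact: measurable_cst.
rewrite (_ : (\int[P]_w _)%E = (\int[P]_w (1 * cir_exp a g sigma X u t t w)%:E)%E); last first.
  by apply: eq_integral => w _; rewrite cir_exp_end mul1r.
apply: (@cir_exp_supermartingale _ _ _ _ _ _ _ _ _ _ _ hF hW a0 g0 sigma0 hX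
  u t t0 t hu (lexx t0) t0t (lexx t) (cst 1) J mz (fun=> ler01) J0).
by under eq_integral do rewrite mul1r; rewrite IE.
Qed.

(** The submartingale inequality is chained along a grid fine enough for its smallness hypothesis.
    The indicator of [X t0 <= K] is measurable at every grid time, so the same weight and the same
    moment bound serve throughout. *)
Lemma cir_laplace_ge (u t K : R) : 0 <= u -> t0 <= t ->
  (\int[P]_w (\1_(A K) w * cir_exp a g sigma X u t t0 w)%:E
    <= \int[P]_w (\1_(A K) w * expR (- (u * X t w)))%:E)%E.
Proof.
move=> u0 t0t; have hu : - (a / sigma ^+ 2) <= u.
  by apply: le_trans u0; rewrite oppr_le0 divr_ge0 ?sqr_ge0// ltW.
have [C C0 hC] := cir_exp_moment K.
have eta0 : 0 < a / sigma ^+ 2 by rewrite divr_gt0 ?exprn_gt0.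
have /filter_ex[m hm] := inv_natr_near (6 * (2 * u) ^+ 2 * sigma ^+ 2 * (t - t0)) eta0.
have key i : (i <= m.+1)%N ->
  (\int[P]_w (\1_(A K) w * cir_exp a g sigma X u t t0 w)%:E
   <= \int[P]_w (\1_(A K) w * cir_exp a g sigma X u t (ugrid t0 t m.+1 i) w)%:E)%E.
  elim: i => [|i IH] im; first by rewrite ugrid0.
  apply: (le_trans (IH (ltnW im))).
  have /andP[_ it] := ugrid_bounds t0t (ltn0Sn m) im.
  have t0i : t0 <= ugrid t0 t m.+1 i by exact: ugrid_ge.
  apply: (@cir_exp_submartingale _ _ _ _ _ _ _ _ _ _ _ hF hW a0 g0 sigma0 hX
    u t _ _ hu t0i _ it (\1_(A K)) C) => //.
  - exact: ugrid_leS.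
  - exact: mA.
  - move=> w; rewrite indicE; by case: (_ \in _); rewrite ?lexx ?ler01.
  - rewrite ugrid_step (_ : _ + _ - _ = (t - t0) / m.+1%:R); last by ring.
    by rewrite mulrA.
have := key m.+1 (leqnn _); rewrite ugridn//.
move=> /le_trans; apply; rewrite le_eqVlt; apply/orP; left; apply/eqP.
by apply: eq_integral => w _; rewrite cir_exp_end.
Qed.

End cir_laplace_bounds.

(** * Inverse moments through the Gamma integral *)

Lemma measurable_invr (R : realType) : measurable_fun setT (fun x : R => x^-1).
Proof.
rewrite (_ : (fun x : R => x^-1) =
    fun x => if 0 <= x then x `^ (- 1) else - ((- x) `^ (- 1))).
  apply: measurable_fun_ifT.
  - exact: measurable_fun_ler.
  - exact: measurable_powR.
  - apply: measurable_funN; apply: (@measurableT_comp _ _ _ _ _ _ (fun x => x `^ (- 1))).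
      exact: measurable_powR.
    exact: measurable_funN.
apply/funext => x; case: ifPn => [x0|]; first by rewrite powR_inv1.
by rewrite -ltNge => x0; rewrite powR_inv1 ?invrN ?opprK// oppr_ge0 ltW.
Qed.

Section gamma_kernel.
Context (R : realType).
Implicit Types (p x u c y : R).
Local Notation mu := lebesgue_measure.

Definition gamma_kernel p x u : R := u `^ (p - 1) * expR (- (u * x)).

Lemma gamma_kernel_ge0 p x u : 0 <= gamma_kernel p x u.
Proof. by rewrite mulr_ge0 ?powR_ge0 ?expR_ge0. Qed.

Lemma powR_within_continuous (q : R) : 0 <= q ->
  {within `[0, +oo[, continuous (fun u : R => u `^ q)}.
Proof.
rewrite le_eqVlt => /predU1P[<-|q0].
  rewrite (_ : (fun u => _) = cst 1); last by apply/funext => u; rewrite powRr0.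
  by apply: continuous_subspaceT => u; exact: cvg_cst.
apply/continuous_within_itvcyP; split; last first.
  by rewrite powR0 ?gt_eqF//; exact: powR_cvg0.
move=> u; rewrite in_itv/= andbT => u0.
apply: differentiable_continuous; apply/derivable1_diffP.
by apply: derivable_powR; rewrite in_itv/= u0.
Qed.

Lemma gamma_kernel_continuous p x : 1 <= p ->
  {within `[0, +oo[, continuous (gamma_kernel p x)}.
Proof.
move=> p1 u; apply: (@cvgM R).
  by apply: powR_within_continuous; rewrite subr_ge0.
have ce : continuous (fun u : R => expR (- (u * x))).
  move=> v; apply: continuous_comp; last exact: continuous_expR.
  by apply: cvgN; apply: cvgM; [exact: cvg_id|exact: cvg_cst].
exact: (continuous_subspaceT ce).
Qed.

Lemma measurable_gamma_kernel p x : measurable_fun setT (gamma_kernel p x).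
Proof.
apply: measurable_funM; first exact: measurable_powR.
apply: measurableT_comp => //; apply: measurable_funN.
exact: measurable_funM.
Qed.

Lemma gamma_kernel_scale p x : 1 <= p -> 0 < x ->
  (\int[mu]_(u in `[0%R, +oo[) (gamma_kernel p 1 u)%:E
   = (x `^ p)%:E * \int[mu]_(u in `[0%R, +oo[) (gamma_kernel p x u)%:E)%E.
Proof.
move=> p1 x0.
have dF (v : R) : is_derive v 1 (fun u : R => x * u) x.
  have -> : (fun u : R => x * u) = (x \*: id) by [].
  by apply: is_derive_eq; rewrite /GRing.scale/= mulr1.
have F'E : (fun u : R => x * u)^`()%classic = cst x.
  by apply/funext => v; rewrite derive1E; exact: (derive_val (is_derive := dF v)).
have := @increasing_ge0_integration_by_substitutiony R (fun u => x * u)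
  (gamma_kernel p 1) 0.
rewrite mulr0 => ->.
- rewrite -ge0_integralZl_EFin ?powR_ge0//; last 2 first.
  + by move=> u _; rewrite lee_fin gamma_kernel_ge0.
  + apply/measurable_EFinP; apply: measurable_funTS; exact: measurable_gamma_kernel.
  apply: eq_integral => u; rewrite inE/= in_itv/= andbT => u0.
  rewrite F'E -EFinM; congr EFin; rewrite /gamma_kernel !fctE.
  rewrite powRM// ?(ltW x0)// mulr1 (mulrC u x).
  rewrite -(mulr_powRB1 (ltW x0) (lt_le_trans ltr01 p1)).
  ring.
- by move=> u v _ _ uv; rewrite ltr_pM2l.
- by rewrite F'E => u _; exact: cvg_cst.
- by rewrite F'E; exact: is_cvg_cst.
- by rewrite F'E; exact: is_cvg_cst.
- split; first by move=> u _; have [] := dF u.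
  apply: cvg_at_right_filter; apply: cvgM; [exact: cvg_cst|exact: cvg_id].
- by apply/gt0_cvgMry => //; exact: cvg_id.
- exact: gamma_kernel_continuous.
- by move=> u _; exact: gamma_kernel_ge0.
Qed.

(** For [u >= 1] the power is bounded by an integer power, which is controlled by a single term of
    the exponential series at [u / 2]; for [u < 1] it is at most 1. *)
Lemma powR_expR_bound (q : R) : 0 <= q -> exists2 C : R, 0 < C &
  forall u : R, 0 <= u -> u `^ q <= C * expR (u / 2).
Proof.
move=> q0; set n := Num.bound q.
have qn : q <= n.+1%:R.
  by apply: (le_trans (ltW (archi_boundP q0))); rewrite ler_nat leqnSn.
pose C : R := 1 + 2 ^+ n.+1 * (n.+1)`!%:R.
have C0 : 0 < 2 ^+ n.+1 * (n.+1)`!%:R :> R by rewrite mulr_gt0 ?exprn_gt0 ?ltr0n ?fact_gt0.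
exists C; first by rewrite /C; lra.
move=> u u0; have e0 := expR_gt0 (u / 2).
have [u1|u1] := leP 1 u.
  apply: (@le_trans _ _ (u ^+ n.+1)); first by rewrite -powR_mulrn// ler_powR.
  have h := @expR_ge1Dxn _ (u / 2) n (divr_ge0 u0 (ler0n _ 2)).
  apply: (@le_trans _ _ (2 ^+ n.+1 * (n.+1)`!%:R * expR (u / 2))); last first.
    by rewrite ler_pM2r// /C lerDr.
  have f0 : 0 < (n.+1)`!%:R :> R by rewrite ltr0n fact_gt0.
  have -> : u ^+ n.+1 = 2 ^+ n.+1 * (n.+1)`!%:R * ((u / 2) ^+ n.+1 / (n.+1)`!%:R).
    rewrite expr_div_n; field.
    by rewrite gt_eqF//= expf_neq0.
  by rewrite ler_pM2l//; lra.
have e1 : 1 <= expR (u / 2) by rewrite -expR0 ler_expR divr_ge0.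
apply: (@le_trans _ _ 1).
  have [u00|u00] := eqVneq u 0.
    have [->|q00] := eqVneq q 0; first by rewrite powRr0.
    by rewrite u00 powR0.
  have up : 0 < u by rewrite lt_neqAle eq_sym u00.
  by rewrite -(powRr0 u); apply: ger_powR => //; rewrite up ltW.
by rewrite -[leLHS]mulr1; apply: ler_pM => //; rewrite /C; lra.
Qed.

Lemma gamma_kernel_lty p : 1 <= p ->
  (\int[mu]_(u in `[0%R, +oo[) (gamma_kernel p 1 u)%:E < +oo)%E.
Proof.
move=> p1; have p10 : 0 <= p - 1 by rewrite subr_ge0.
have [C C0 hC] := powR_expR_bound p10.
apply: (@le_lt_trans _ _ ((2 * C)%:E
    * \int[mu]_u (exponential_pdf (1 / 2) u)%:E)%E); last first.
  by rewrite integral_exponential_pdf ?divr_gt0// mule1 ltry.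
rewrite integral_mkcond -ge0_integralZl_EFin//; last 3 first.
- by move=> u _; rewrite lee_fin exponential_pdf_ge0// ltW.
- by apply/measurable_EFinP; exact: measurable_exponential_pdf.
- by rewrite mulr_ge0// ltW.
apply: ge0_le_integral => //.
- by move=> u _; rewrite patchE; case: ifPn => // _; rewrite lee_fin gamma_kernel_ge0.
- apply/(measurable_restrictT _ _).1 => //; apply/measurable_EFinP.
  by apply: measurable_funTS; exact: measurable_gamma_kernel.
- apply: measurable_funeM; apply/measurable_EFinP.
  exact: measurable_exponential_pdf.
move=> u _; rewrite patchE; case: ifPn; last first.
  move=> _; rewrite -EFinM lee_fin mulr_ge0// ?exponential_pdf_ge0//; last by rewrite mulr_ge0// ltW.
rewrite inE/= in_itv/= andbT => u0.
rewrite exponential_pdfE// -EFinM lee_fin /gamma_kernel mulr1.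
apply: (le_trans (ler_wpM2r (expR_ge0 _) (hC u u0))).
rewrite -mulrA -expRD le_eqVlt; apply/orP; left; apply/eqP.
rewrite (_ : u / 2 - u = - (1 / 2) * u); last by field.
by field.
Qed.

Lemma gamma_kernel_gt0 p : 1 <= p ->
  (0 < \int[mu]_(u in `[0%R, +oo[) (gamma_kernel p 1 u)%:E)%E.
Proof.
move=> p1; have e2 : 0 < expR (- 2) :> R by exact: expR_gt0.
apply: (@lt_le_trans _ _ (\int[mu]_(u in `[1%R, 2%R]) (expR (- 2))%:E)%E).
  rewrite integral_cst//= lebesgue_measure_itv/= lte_fin ltr1n.
  by rewrite -EFinB -EFinM lte_fin mulr_gt0//; lra.
apply: (@le_trans _ _ (\int[mu]_(u in `[1%R, 2%R]) (gamma_kernel p 1 u)%:E)%E).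
  apply: ge0_le_integral => //.
  - apply/measurable_EFinP; apply: measurable_funTS; exact: measurable_gamma_kernel.
  move=> u /=; rewrite in_itv/= => /andP[u1 u2]; rewrite lee_fin /gamma_kernel mulr1.
  rewrite -[leLHS]mul1r; apply: ler_pM; rewrite ?expR_ge0//.
    by rewrite -[leLHS](powRr0 u); apply: ler_powR => //; rewrite subr_ge0.
  by rewrite ler_expR lerN2.
apply: ge0_subset_integral => //.
- by apply/measurable_EFinP; apply: measurable_funTS; exact: measurable_gamma_kernel.
- by move=> u _; rewrite lee_fin gamma_kernel_ge0.
- by move=> u /=; rewrite !in_itv/= => /andP[u1 _]; rewrite andbT; lra.
Qed.

(** [Gamma] is a real-valued integral, which would read 0 if the integral were infinite; finiteness
    makes the two notions agree. *)
Lemma GammaE p : 1 <= p ->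
  (Gamma p)%:E = (\int[mu]_(u in `[0%R, +oo[) (gamma_kernel p 1 u)%:E)%E.
Proof.
move=> p1; rewrite /Gamma /Rintegral.
rewrite integral_itv_obnd_cbnd; last first.
  apply/measurable_EFinP; apply: measurable_funTS; apply: measurable_funM.
    exact: measurable_powR.
  by apply: measurableT_comp => //; exact: measurable_funN.
have -> : (\int[mu]_(u in `[0%R, +oo[) (u `^ (p - 1) * expR (- u))%:E
    = \int[mu]_(u in `[0%R, +oo[) (gamma_kernel p 1 u)%:E)%E.
  by apply: eq_integral => u _; rewrite /gamma_kernel mulr1.
by rewrite fineK// ge0_fin_numE ?gamma_kernel_lty// ltW ?gamma_kernel_gt0.
Qed.

Lemma Gamma_gt0 p : 1 <= p -> 0 < Gamma p.
Proof. by move=> p1; rewrite -lte_fin GammaE ?gamma_kernel_gt0. Qed.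

(* At [x = 0] both sides are infinite. *)
Lemma gamma_kernel_integral p x : 1 <= p -> 0 <= x ->
  (\int[mu]_(u in `[0%R, +oo[) (gamma_kernel p x u)%:E
   = (Gamma p)%:E * ((x `^ p)%:E)^-1)%E.
Proof.
move=> p1; have p0 : p != 0 by rewrite gt_eqF//; lra.
rewrite le_eqVlt => /predU1P[<-|x0]; last first.
  have xp : 0 < x `^ p by exact: powR_gt0.
  rewrite GammaE// (gamma_kernel_scale p1 x0) muleC muleA.
  by rewrite inver gt_eqF// -EFinM mulVf ?gt_eqF// mul1e.
rewrite powR0// inver eqxx gt0_muley ?lte_fin ?Gamma_gt0//.
apply/eqP; rewrite -leye_eq.
apply: (@le_trans _ _ (\int[mu]_(u in `[1%R, +oo[) (1%:E))%E).
  by rewrite integral_cst//= lebesgue_measure_itv/= ltry mul1e.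
apply: (@le_trans _ _ (\int[mu]_(u in `[1%R, +oo[) (gamma_kernel p 0 u)%:E)%E).
  apply: ge0_le_integral => //.
  - apply/measurable_EFinP; apply: measurable_funTS; exact: measurable_gamma_kernel.
  move=> u /=; rewrite in_itv/= andbT => u1; rewrite lee_fin /gamma_kernel.
  rewrite mulr0 oppr0 expR0 mulr1 -[leLHS](powRr0 u); apply: ler_powR => //.
  by rewrite subr_ge0.
apply: ge0_subset_integral => //.
- by apply/measurable_EFinP; apply: measurable_funTS; exact: measurable_gamma_kernel.
- by move=> u _; rewrite lee_fin gamma_kernel_ge0.
- by move=> u /=; rewrite !in_itv/= !andbT; lra.
Qed.

End gamma_kernel.

(** * Estimates of the kernel integrals *)

Section gamma_substitution.
Context (R : realType) (c p y : R).
Hypotheses (c0 : 0 <= c) (p1 : 1 <= p).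
Local Notation mu := lebesgue_measure.

Local Notation v := (fun u : R => u / (1 + c * u)).

Let den_gt0 (u : R) : 0 <= u -> 0 < 1 + c * u.
Proof. by move=> u0; have := mulr_ge0 c0 u0; lra. Qed.

Let is_derive_v (u : R) : 0 < 1 + c * u -> is_derive u 1 v ((1 + c * u) ^- 2).
Proof.
move=> u0; have dn : 1 + c * u != 0 by rewrite gt_eqF.
have d1 : is_derive u 1 (fun u : R => 1 + c * u) c.
  have -> : (fun u : R => 1 + c * u) = cst 1 + (c \*: id) by [].
  by apply: is_derive_eq; rewrite /GRing.scale/= mulr1 add0r.
have d2 := @is_deriveV R (fun u => 1 + c * u) _ _ _ dn d1.
have -> : v = id * (fun u => (1 + c * u)^-1) by [].
apply: is_derive_eq; rewrite /GRing.scale/=; field.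
by rewrite dn.
Qed.

Let continuous_derive_v (u : R) : 0 <= u -> {for u, continuous (v^`()%classic)}.
Proof.
move=> u0; have du := den_gt0 u0.
have cd : {for u, continuous (fun u : R => 1 + c * u)}.
  by apply: cvgD; [exact: cvg_cst|apply: cvgM; [exact: cvg_cst|exact: cvg_id]].
have near_d : \forall x \near u, (1 + c * x) ^- 2 = (v^`()%classic) x.
  have : \forall x \near u, 0 < 1 + c * x by exact: (cvgr_gt _ cd).
  apply: filterS => x dx; rewrite derive1E.
  by have dv := is_derive_v dx; rewrite (derive_val (is_derive := dv)).
have vu : (v^`()%classic) u = (1 + c * u) ^- 2.
  by rewrite derive1E; have dv := is_derive_v du; rewrite (derive_val (is_derive := dv)).
suff : (v^`()%classic) x @[x --> u] --> (1 + c * u) ^- 2 by rewrite -vu.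
apply: (cvg_trans (near_eq_cvg near_d)).
apply: cvgV; first by rewrite expf_neq0// gt_eqF.
by apply: (@cvg_comp _ _ _ _ (fun z => z ^+ 2) _ _ _ cd); exact: sqr_continuous.
Qed.

Lemma measurable_gamma_kernel_substitution : measurable_fun setT
  (fun u : R => gamma_kernel p y (u / (1 + c * u)) * (1 + c * u) ^- 2).
Proof.
have mden : measurable_fun setT (fun u : R => (1 + c * u)^-1).
  apply: (measurableT_comp (@measurable_invr R)).
  by apply: measurable_funD => //; exact: measurable_funM.
apply: measurable_funM.
  apply: measurableT_comp; first exact: measurable_gamma_kernel.
  exact: measurable_funM.
under eq_fun do rewrite -exprVn.
exact: measurable_funX.
Qed.

(** Change of variables [v = u / (1 + c u)], whose derivative is [(1 + c u)^(-2)]. It is only an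
    inequality because for [c > 0] the image stops short of [1 / c]. The substitution is made on
    each segment from 0 to [n], and monotone convergence concludes. *)
Lemma gamma_kernel_substitution_le :
  (\int[mu]_(u in `[0%R, +oo[) (gamma_kernel p y (u / (1 + c * u)) * (1 + c * u) ^- 2)%:E
   <= \int[mu]_(u in `[0%R, +oo[) (gamma_kernel p y u)%:E)%E.
Proof.
pose f (u : R) := (gamma_kernel p y (u / (1 + c * u)) * (1 + c * u) ^- 2)%:E.
have f0 u : 0 <= u -> (0 <= f u)%E.
  by move=> u0; rewrite lee_fin mulr_ge0 ?gamma_kernel_ge0// invr_ge0 sqr_ge0.
have mf : measurable_fun setT f.
  by apply/measurable_EFinP; exact: measurable_gamma_kernel_substitution.
have bounded (n : nat) : (\int[mu]_(u in `[0%R, n%:R]) f u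
   <= \int[mu]_(u in `[0%R, +oo[) (gamma_kernel p y u)%:E)%E.
  have vmono : {in `[0%R, n%:R] &, {homo v : x z / x < z}}.
    move=> x z; rewrite !in_itv/= => /andP[x0 _] /andP[z0 _] xz.
    have dx := den_gt0 x0; have dz := den_gt0 z0.
    rewrite ltr_pdivrMr// mulrAC ltr_pdivlMr//; lra.
  have := @integration_by_substitution_increasing R v (gamma_kernel p y) 0 n%:R (ler0n _ n) vmono.
  have cv' (x : R) : 0 <= x -> (v^`()%classic) z @[z --> x] --> (v^`()%classic) x.
    by move=> x0; exact: continuous_derive_v.
  have cF (x : R) : 0 <= x -> {for x, continuous v}.
    move=> x0; apply: differentiable_continuous; apply/derivable1_diffP.
    by have [] := is_derive_v (den_gt0 x0).
  move=> subst.
  rewrite (_ : \int[mu]_(u in _) f u = \int[mu]_(u in `[0%R, n%:R]) (((gamma_kernel p y \o v) * (v^`()%classic)) u)%:E)%E; last first.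
    apply: eq_integral => u; rewrite inE/= in_itv/= => /andP[u0 _].
    rewrite /f !fctE derive1E; have dv := is_derive_v (den_gt0 u0).
    by rewrite (derive_val (is_derive := dv)).
  rewrite -subst.
  - apply: ge0_subset_integral => //.
    + by apply/measurable_EFinP; apply: measurable_funTS; exact: measurable_gamma_kernel.
    + by move=> u _; rewrite lee_fin gamma_kernel_ge0.
    + by move=> u /=; rewrite mul0r !in_itv/= => /andP[-> _].
  - by move=> x; rewrite in_itv/= => /andP[/ltW x0 _]; exact: cv'.
  - by apply/cvg_ex; exists ((v^`()%classic) 0); apply: cvg_at_right_filter; exact: cv'.
  - by apply/cvg_ex; exists ((v^`()%classic) n%:R); apply: cvg_at_left_filter; exact: cv'.
  - split.
    + move=> x; rewrite in_itv/= => /andP[/ltW x0 _].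
      by have [] := is_derive_v (den_gt0 x0).
    + by apply: cvg_at_right_filter; exact: (cF 0 (lexx 0)).
    + by apply: cvg_at_left_filter; exact: (cF n%:R (ler0n R n)).
  - have sub : `[0 / (1 + c * 0), n%:R / (1 + c * n%:R)] `<=` `[0, +oo[.
      by move=> u /=; rewrite mul0r !in_itv/= => /andP[-> _].
    exact: (@continuous_subspaceW _ _ _ _ _ sub (@gamma_kernel_continuous R p y p1)).
have UE : `[0, +oo[%classic = \bigcup_n `[0, (n%:R : R)]%classic.
  apply/seteqP; split => u /=.
    rewrite in_itv/= andbT => u0; exists (Num.bound u) => //=.
    by rewrite in_itv/= u0 ltW// archi_boundP.
  by move=> [n _]; rewrite /= !in_itv/= => /andP[-> _].
have cvg : (fun n : nat => \int[mu]_(u in `[0%R, n%:R]) f u)%E @ \oo -->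
    (\int[mu]_(u in \bigcup_n `[0%R, n%:R]%classic) f u)%E.
  apply: ge0_nondecreasing_set_cvg_integral.
  - move=> m n mn; apply/subsetPset => u /=; rewrite !in_itv/= => /andP[-> um].
    by rewrite (le_trans um)// ler_nat.
  - by move=> n; exact: measurable_itv.
  - by move=> n; exact: measurable_funTS.
  - by move=> n u /=; rewrite in_itv/= => /andP[u0 _]; exact: f0.
rewrite -/f [in leLHS]UE.
by apply: (cvge_le _ cvg); apply: nearW => n; exact: bounded.
Qed.

End gamma_substitution.

Section cir_kernel.
Context (R : realType) (c p theta : R).
Hypotheses (c0 : 0 <= c) (p1 : 1 <= p).
Local Notation mu := lebesgue_measure.

Definition cir_kernel (y u : R) : R :=
  u `^ (p - 1) * expR (- (u / (1 + c * u) * y + theta * ln (1 + c * u))).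

Lemma cir_kernel_ge0 y u : 0 <= cir_kernel y u.
Proof. by rewrite mulr_ge0 ?powR_ge0 ?expR_ge0. Qed.

Lemma measurable_cir_kernel y : measurable_fun setT (cir_kernel y).
Proof.
have md : measurable_fun setT (fun u : R => 1 + c * u).
  by apply: measurable_funD => //; exact: measurable_funM.
apply: measurable_funM; first exact: measurable_powR.
apply: measurableT_comp => //; apply: measurable_funN; apply: measurable_funD.
  apply: measurable_funM => //; apply: measurable_funM => //.
  exact: (measurableT_comp (@measurable_invr R)).
by apply: measurable_funM => //; exact: measurableT_comp.
Qed.

Let b_ge1 u : 0 <= u -> 1 <= 1 + c * u.
Proof. by move=> u0; have := mulr_ge0 c0 u0; lra. Qed.

Lemma cir_kernelE y u : 0 <= u -> cir_kernel y u
  = gamma_kernel p y (u / (1 + c * u)) * (1 + c * u) `^ (p - 1 - theta).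
Proof.
move=> u0; have b1 := b_ge1 u0; have b0 : 0 < 1 + c * u by lra.
rewrite /cir_kernel /gamma_kernel opprD expRD.
have {1}-> : u = u / (1 + c * u) * (1 + c * u) by rewrite divfK// gt_eqF.
rewrite powRM ?divr_ge0 ?(ltW b0)//.
have -> : expR (- (theta * ln (1 + c * u))) = (1 + c * u) `^ (- theta).
  by rewrite /powR gt_eqF// mulNr.
rewrite (powRD (r := p - 1)); last by rewrite (gt_eqF b0) implybT.
ring.
Qed.

(** Once the Jacobian [(1 + c u)^(-2)] is set apart, the sign of the remaining exponent
    [p + 1 - theta] separates the constant 1 from the constant [cir_Lp]. *)
Lemma cir_kernelE' y u : 0 <= u -> cir_kernel y u
  = gamma_kernel p y (u / (1 + c * u)) * (1 + c * u) ^- 2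
    * (1 + c * u) `^ (p + 1 - theta).
Proof.
move=> u0; have b1 := b_ge1 u0; have b0 : 0 < 1 + c * u by lra.
rewrite cir_kernelE// -mulrA; congr (_ * _).
have -> : (1 + c * u) ^- 2 = (1 + c * u) `^ (- 2%:R).
  by rewrite powR_invn// ltW.
rewrite -powRD; last by rewrite (gt_eqF b0) implybT.
by congr powR; ring.
Qed.

Let f (y u : R) : R := gamma_kernel p y (u / (1 + c * u)) * (1 + c * u) ^- 2.

Let f0 y u : 0 <= f y u.
Proof. by rewrite mulr_ge0 ?gamma_kernel_ge0// invr_ge0 sqr_ge0. Qed.

Lemma cir_kernel_le_Gamma y : 0 <= y -> p + 1 <= theta ->
  (\int[mu]_(u in `[0%R, +oo[) (cir_kernel y u)%:E
    <= (Gamma p)%:E * ((y `^ p)%:E)^-1)%E.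
Proof.
move=> y0 pt; rewrite -gamma_kernel_integral//.
apply: le_trans (gamma_kernel_substitution_le y c0 p1).
apply: ge0_le_integral => //.
- by move=> u _; rewrite lee_fin cir_kernel_ge0.
- by apply/measurable_EFinP; apply: measurable_funTS; exact: measurable_cir_kernel.
- by apply/measurable_EFinP; apply: measurable_funTS; exact: measurable_gamma_kernel_substitution.
move=> u /=; rewrite in_itv/= andbT => u0; rewrite lee_fin cir_kernelE'//.
rewrite ler_piMr//; first exact: f0.
by rewrite -[leRHS](powRr0 (1 + c * u)); apply: ler_powR; [exact: b_ge1|lra].
Qed.

(** On [u >= 1] one has [1 + c u <= (1 + c) u], so the integrand dominates a constant times
    [u^(p - 1 - theta)], hence a constant times [1 / u]. The number [k] stands for a bound on the
    term [u y / (1 + c u)], which stays below [y / c]. *)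
Lemma cir_kernel_diverges (k : R) : theta <= p -> 0 <= theta ->
  (\int[mu]_(u in `[0%R, +oo[)
    (u `^ (p - 1) * expR (- (k + theta * ln (1 + c * u))))%:E = +oo)%E.
Proof.
move=> tp theta0; pose K := expR (- k) * (1 + c) `^ (- theta).
have c10 : 0 < 1 + c by rewrite ltr_pwDl.
have K0 : 0 < K by rewrite mulr_gt0 ?expR_gt0 ?powR_gt0.
have mh : measurable_fun setT (fun u : R => u `^ (p - 1) * expR (- (k + theta * ln (1 + c * u)))).
  apply: measurable_funM; first exact: measurable_powR.
  apply: measurableT_comp => //; apply: measurable_funN; apply: measurable_funD => //.
  apply: measurable_funM => //; apply: measurableT_comp => //.
  by apply: measurable_funD => //; exact: measurable_funM.
have lower u : 1 <= u -> K * u^-1 <= u `^ (p - 1) * expR (- (k + theta * ln (1 + c * u))).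
  move=> u1; have u0 : 0 < u by lra.
  have b0 : 0 < 1 + c * u by have := b_ge1 (ltW u0); lra.
  rewrite opprD expRD /K -mulrA [leRHS]mulrCA; apply: ler_wpM2l; first exact: expR_ge0.
  have -> : expR (- (theta * ln (1 + c * u))) = (1 + c * u) `^ (- theta).
    by rewrite /powR gt_eqF// mulNr.
  have h1 : ((1 + c) * u) `^ (- theta) <= (1 + c * u) `^ (- theta).
    rewrite !powRN lef_pV2 ?posrE ?powR_gt0 ?mulr_gt0//.
    by apply: ge0_ler_powR; rewrite ?nnegrE ?mulr_ge0 ?(ltW c10) ?(ltW b0) ?(ltW u0)//; lra.
  apply: le_trans (ler_wpM2l (powR_ge0 _ _) h1).
  rewrite powRM ?(ltW c10) ?(ltW u0)// [leRHS]mulrCA; apply: ler_wpM2l; first exact: powR_ge0.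
  rewrite -powRD; last by rewrite (gt_eqF u0) implybT.
  by rewrite -powR_inv1 ?(ltW u0)//; apply: ler_powR => //; lra.
apply/eqP; rewrite -leye_eq.
apply: (@le_trans _ _ (\int[mu]_(u in `[1%R, +oo[) (K * u^-1)%:E)%E); last first.
  apply: (@le_trans _ _ (\int[mu]_(u in `[1%R, +oo[)
      (u `^ (p - 1) * expR (- (k + theta * ln (1 + c * u))))%:E)%E).
    apply: ge0_le_integral => //.
    - move=> u /=; rewrite in_itv/= andbT => u1.
      by rewrite lee_fin mulr_ge0 ?invr_ge0 ?(ltW K0)//; lra.
    - apply/measurable_EFinP; apply: measurable_funTS; apply: measurable_funM => //.
      exact: measurable_invr.
    - by apply/measurable_EFinP; exact: measurable_funTS.
    - by move=> u /=; rewrite in_itv/= andbT => u1; rewrite lee_fin lower.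
  apply: ge0_subset_integral => //.
  - by apply/measurable_EFinP; exact: measurable_funTS.
  - by move=> u _; rewrite lee_fin mulr_ge0 ?powR_ge0 ?expR_ge0.
  - by move=> u /=; rewrite !in_itv/= !andbT; lra.
(* Each dyadic block [`]2^n, 2^(n+1)]] contributes at least [K / 2]. *)
have mi : measurable_fun setT (fun u : R => (K * u^-1)%:E).
  by apply/measurable_EFinP; apply: measurable_funM => //; exact: measurable_invr.
have i0 (u : R) : 0 < u -> (0 <= (K * u^-1)%:E)%E.
  by move=> u0; rewrite lee_fin mulr_ge0 ?invr_ge0 ?(ltW K0) ?(ltW u0).
have dyadic (n : nat) : ((K * n%:R / 2)%:E <= \int[mu]_(u in `[1%R, (2 ^+ n)%R]) (K * u^-1)%:E)%E.
  elim: n => [|n IH].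
    by rewrite mulr0 mul0r; apply: integral_ge0 => u /=; rewrite in_itv/= => /andP[u1 _]; apply: i0; lra.
  have p2 : 0 < 2 ^+ n :> R by exact: exprn_gt0.
  have p21 : 1 <= 2 ^+ n :> R by rewrite exprn_ege1// ler1n.
  rewrite (@itv_bndbnd_setU _ _ _ (BRight (2 ^+ n))) ?bnd_simp//; last first.
    by rewrite exprS ler_pMl// ler1n.
  rewrite ge0_integral_setU//=; last 3 first.
  - exact: measurable_funTS.
  - by move=> u [|]/=; rewrite in_itv/= => /andP[u1 _]; apply: i0; lra.
  - rewrite disj_set2E; apply/eqP/seteqP; split => // u [] /=.
    rewrite !in_itv/= => /andP[_ h] /andP[h' _].
    by move: (le_lt_trans h h'); rewrite ltxx.
  rewrite (_ : (K * n.+1%:R / 2)%:E = ((K * n%:R / 2)%:E + (K / 2)%:E)%E); last first.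
    by rewrite -EFinD -natr1; congr EFin; ring.
  apply: leeD => //.
  apply: (@le_trans _ _ (\int[mu]_(u in `](2 ^+ n)%R, (2 ^+ n.+1)%R]) (K / 2 ^+ n.+1)%:E)%E).
    rewrite integral_cst//= lebesgue_measure_itv/= lte_fin.
    rewrite (_ : 2 ^+ n < 2 ^+ n.+1); last by rewrite exprS ltr_pMl// ltr1n.
    rewrite -EFinB -EFinM lee_fin le_eqVlt; apply/orP; left; apply/eqP.
    by rewrite exprS; field; rewrite gt_eqF.
  apply: ge0_le_integral => //.
  - by move=> u _; rewrite lee_fin divr_ge0 ?(ltW K0) ?exprn_ge0.
  - exact: measurable_funTS.
  - move=> u /=; rewrite in_itv/= => /andP[u1 u2]; rewrite lee_fin ler_pM2l//.
    by rewrite lef_pV2 ?posrE ?exprn_gt0//; lra.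
have le_n (n : nat) : ((K * n%:R / 2)%:E <= \int[mu]_(u in `[1%R, +oo[) (K * u^-1)%:E)%E.
  apply: (le_trans (dyadic n)); apply: ge0_subset_integral => //.
  - exact: measurable_funTS.
  - by move=> u /=; rewrite in_itv/= andbT => u1; apply: i0; lra.
  - by move=> u /=; rewrite !in_itv/= andbT => /andP[].
case IE : (\int[mu]_(u in _) _)%E le_n => [J| |] le_n; [|by []|by have := le_n 0%N].
exfalso; have := le_n (Num.bound (2 * `|J| / K)).+1; rewrite lee_fin leNgt => /negP; apply.
have KJ : 2 * `|J| / K < (Num.bound (2 * `|J| / K)).+1%:R.
  apply: (lt_trans (archi_boundP _)); last by rewrite ltr_nat.
  by apply: divr_ge0; [exact: mulr_ge0|exact: ltW].
move: KJ; rewrite ltr_pdivrMr// => KJ; have := ler_norm J.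
rewrite [K * _]mulrC; lra.
Qed.

End cir_kernel.

(* The maximum over [z > 0] of the left-hand side is attained at [z = 2 p]. *)
Lemma powR_expR_max (R : realType) (p z : R) : 0 < p -> 0 < z ->
  z `^ p * expR (- (z / 2)) <= 2 `^ p * (p `^ p * expR (- p)).
Proof.
move=> p0 z0; rewrite mulrA -powRM// ?(ltW p0)//.
have p20 : 0 < 2 * p by rewrite mulr_gt0.
rewrite /powR !gt_eqF// -!expRD ler_expR.
have h := expR_ge1Dx (ln z - ln (2 * p)).
rewrite expRD expRN !lnK ?posrE// in h.
have h2 : z / (2 * p) * p = z / 2 by field; rewrite gt_eqF.
have h3 : (1 + (ln z - ln (2 * p))) * p <= z / 2 by rewrite -h2 ler_pM2r.
lra.
Qed.

Section cir_kernel_bound.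
Context (R : realType) (c p theta y : R).
Hypotheses (c0 : 0 < c) (p1 : 1 <= p) (pt : p < theta) (tp : theta - 1 < p)
  (y0 : 0 < y).
Local Notation mu := lebesgue_measure.

Let b_gt0 (u : R) : 0 <= u -> 0 < 1 + c * u.
Proof. by move=> u0; have := mulr_ge0 (ltW c0) u0; lra. Qed.

Local Notation q := (theta - p).

Let q0 : 0 < q. Proof. by rewrite subr_gt0. Qed.

Let exponent_ge0 : 0 <= p + 1 - theta. Proof. by rewrite subr_ge0 -lerBlDr ltW. Qed.

(** An antiderivative of [(1 + c u)^(p - 1 - theta)], normalised to vanish at infinity, which uses
    [p < theta]. *)
Let primitive (u : R) : R := - ((c * q)^-1 * (1 + c * u) `^ (- q)).

Let is_derive_primitive (u : R) : 0 < 1 + c * u ->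
  is_derive u 1 primitive ((1 + c * u) `^ (p - 1 - theta)).
Proof.
move=> b0.
have d1 : is_derive u 1 (fun u : R => 1 + c * u) c.
  have -> : (fun u : R => 1 + c * u) = cst 1 + (c \*: id) by [].
  by apply: is_derive_eq; rewrite /GRing.scale/= mulr1 add0r.
have d2 : is_derive u 1 (fun u : R => (1 + c * u) `^ (- q))
   ((- q * (1 + c * u) `^ (- q - 1)) * c).
  apply: (@is_derive1_comp R (fun x => x `^ (- q)) (fun u => 1 + c * u)).
  exact: is_derive1_powR.
have -> : primitive = - ((c * q)^-1 \*: (fun u : R => (1 + c * u) `^ (- q))) by [].
apply: is_derive_eq; rewrite /GRing.scale/= (_ : - q - 1 = p - 1 - theta); last first.
  by ring.
by field; rewrite !gt_eqF.
Qed.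

Let primitive_cvg0 : primitive u @[u --> (+oo)%R] --> (0 : R).
Proof.
suff h : (1 + c * u) `^ (- q) @[u --> (+oo)%R] --> (0 : R).
  have := cvgN (cvgM (cvg_cst (c * q)^-1) h).
  rewrite mulr0 oppr0; exact.
apply/cvgrPdist_lt => e e0; near=> u.
rewrite sub0r normrN ger0_norm ?powR_ge0//.
have u0 : 0 < u by near: u; apply: nbhs_pinfty_gt; exact: num_real.
have b0 := b_gt0 (ltW u0).
(* Writing [e] as a power of exponent [- q] reduces the limit to the comparison of two bases. *)
have -> : e = (e `^ (- q^-1)) `^ (- q).
  by rewrite -powRrM mulrNN mulVf ?gt_eqF// powRr1// ltW.
rewrite !powRN ltf_pV2 ?posrE ?powR_gt0 ?invr_gt0 ?powR_gt0//.
rewrite gt0_ltr_powR// ?nnegrE ?invr_ge0 ?powR_ge0// ?(ltW b0)//.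
have : e `^ (- q^-1) / c < u by near: u; apply: nbhs_pinfty_gt; exact: num_real.
by rewrite ltr_pdivrMr// powRN mulrC => h; apply: (lt_trans h); rewrite ltrDr.
Unshelve. all: by end_near. Qed.

Lemma integral_powR_tail :
  (\int[mu]_(u in `[c^-1%R, +oo[) ((1 + c * u) `^ (p - 1 - theta))%:E
   = (2 `^ (- q) / (c * q))%R%:E)%E.
Proof.
have ci0 : 0 < c^-1 by rewrite invr_gt0.
have bgt u : c^-1 <= u -> 0 < 1 + c * u.
  by move=> cu; apply: b_gt0; exact: le_trans (ltW ci0) cu.
have cts (f : R -> R) (df : R -> R) : (forall u, c^-1 <= u -> is_derive u 1 f (df u)) ->
    forall u, c^-1 <= u -> {for u, continuous f}.
  move=> hf u cu; apply: differentiable_continuous; apply/derivable1_diffP.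
  by have [] := hf u cu.
have cpow u : c^-1 <= u -> {for u, continuous (fun u : R => (1 + c * u) `^ (p - 1 - theta))}.
  apply: (cts _ (fun u => (p - 1 - theta) * (1 + c * u) `^ (p - 1 - theta - 1) * c)).
  move=> {}u cu; apply: (@is_derive1_comp R (fun x => x `^ (p - 1 - theta)) (fun u => 1 + c * u)).
    by apply: is_derive1_powR; exact: bgt.
  have -> : (fun u : R => 1 + c * u) = cst 1 + (c \*: id) by [].
  by apply: is_derive_eq; rewrite /GRing.scale/= mulr1 add0r.
rewrite (@ge0_continuous_FTC2y R _ primitive c^-1 0).
- rewrite /primitive divff ?gt_eqF// -EFinB; congr EFin.
  by rewrite sub0r opprK mulrC.
- by move=> u _; exact: powR_ge0.
- apply/continuous_within_itvcyP; split.
    by move=> u; rewrite in_itv/= andbT => /ltW cu; exact: cpow.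
  by apply: cvg_at_right_filter; exact: (cpow _ (lexx _)).
- exact: primitive_cvg0.
- by move=> u /ltW cu; have [] := is_derive_primitive (bgt _ cu).
- apply: cvg_at_right_filter.
  apply: (cts _ (fun u => (1 + c * u) `^ (p - 1 - theta)) _ c^-1 (lexx _)) => u cu.
  exact: is_derive_primitive (bgt _ cu).
- move=> u; rewrite in_itv/= andbT => /ltW cu; rewrite derive1E.
  by have dv := is_derive_primitive (bgt _ cu); rewrite (derive_val (is_derive := dv)).
Qed.

(** The result must not depend on [c]. Below the cut, [c] disappears with the substitution; above
    it, the bound depends on [c] only through [z = y / c], and the maximum of [z^p exp(- z / 2)]
    removes it. That maximum is the source of [p^p e^(-p)] in the constant. *)
Lemma cir_kernel_le_Lp :
  (\int[mu]_(u in `[0%R, +oo[) (cir_kernel c p theta y u)%:E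
    <= (Gamma p * cir_Lp theta p / y `^ p)%:E)%E.
Proof.
have ci0 : 0 < c^-1 by rewrite invr_gt0.
have p0 : 0 < p by exact: lt_le_trans ltr01 p1.
have mk : measurable_fun setT (fun u : R => (cir_kernel c p theta y u)%:E).
  by apply/measurable_EFinP; exact: measurable_cir_kernel.
have k0 (u : R) : (0 <= (cir_kernel c p theta y u)%:E)%E.
  by rewrite lee_fin cir_kernel_ge0.
pose f (u : R) := gamma_kernel p y (u / (1 + c * u)) * (1 + c * u) ^- 2.
have f0 u : 0 <= f u by rewrite mulr_ge0 ?gamma_kernel_ge0// invr_ge0 sqr_ge0.
have mf : measurable_fun setT f by exact: measurable_gamma_kernel_substitution.
have A0 : 0 <= 2 `^ (p + 1 - theta) by exact: powR_ge0.
have near : (\int[mu]_(u in `[0%R, c^-1%R]) (cir_kernel c p theta y u)%:E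
    <= (2 `^ (p + 1 - theta) * (Gamma p / y `^ p))%:E)%E.
  apply: (@le_trans _ _ ((2 `^ (p + 1 - theta))%:E
     * \int[mu]_(u in `[0%R, +oo[) (f u)%:E)%E); last first.
    rewrite EFinM; apply: lee_wpmul2l; first by rewrite lee_fin.
    apply: (le_trans (gamma_kernel_substitution_le y (ltW c0) p1)).
    rewrite gamma_kernel_integral ?(ltW y0)// inver gt_eqF ?powR_gt0//.
  rewrite -ge0_integralZl_EFin//; last 2 first.
  - by move=> u _; rewrite lee_fin.
  - by apply/measurable_EFinP; exact: measurable_funTS.
  apply: (@le_trans _ _ (\int[mu]_(u in `[0%R, c^-1%R])
      ((2 `^ (p + 1 - theta))%:E * (f u)%:E))%E).
    apply: ge0_le_integral => //.
    - exact: measurable_funTS.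
    - apply: measurable_funTS; apply: measurable_funeM.
      exact/measurable_EFinP.
    move=> u /=; rewrite in_itv/= => /andP[u0 uc].
    rewrite -EFinM lee_fin cir_kernelE'?(ltW c0)// mulrC; apply: (ler_wpM2r (f0 u)).
    have bu := b_gt0 u0.
    apply: ge0_ler_powR; rewrite ?nnegrE ?exponent_ge0 ?(ltW bu)//.
    by have := ler_wpM2l (ltW c0) uc; rewrite divff ?gt_eqF//; lra.
  apply: ge0_subset_integral => //.
  - apply: measurable_funTS; apply: measurable_funeM; exact/measurable_EFinP.
  - by move=> u _; rewrite -EFinM lee_fin mulr_ge0.
  - by move=> u /=; rewrite !in_itv/= => /andP[-> _].
pose k := (c^-1) `^ (p - 1) * expR (- (c^-1 / 2 * y)).
have kk0 : 0 <= k by rewrite mulr_ge0 ?powR_ge0 ?expR_ge0.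
have far : (\int[mu]_(u in `[c^-1%R, +oo[) (cir_kernel c p theta y u)%:E
    <= (k * (2 `^ (- q) / (c * q)))%:E)%E.
  rewrite EFinM -integral_powR_tail.
  have mpow : measurable_fun setT (fun u : R => ((1 + c * u) `^ (p - 1 - theta))%:E).
    apply/measurable_EFinP.
    apply: (@measurableT_comp _ _ _ _ _ _ (fun x => x `^ (p - 1 - theta))); first exact: measurable_powR.
    by apply: measurable_funD => //; exact: measurable_funM.
  rewrite -ge0_integralZl_EFin//; last 2 first.
  - by move=> u _; rewrite lee_fin powR_ge0.
  - exact: measurable_funTS.
  apply: ge0_le_integral => //.
  - exact: measurable_funTS.
  - by apply: measurable_funTS; exact: measurable_funeM.
  move=> u /=; rewrite in_itv/= andbT => cu; have u0 := le_trans (ltW ci0) cu.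
  have bu := b_gt0 u0.
  rewrite -EFinM lee_fin cir_kernelE ?(ltW c0)//; apply: ler_wpM2r; first exact: powR_ge0.
  have cu1 : 1 <= c * u by have := ler_wpM2l (ltW c0) cu; rewrite divff ?gt_eqF.
  have v1 : u / (1 + c * u) <= c^-1.
    by rewrite ler_pdivrMr// mulrDr mulKf ?gt_eqF// mulr1 lerDr ltW.
  (* The two bounds play different roles: the upper one controls the power in the kernel, this lower
     one the exponential decay. *)
  have v2 : c^-1 / 2 <= u / (1 + c * u).
    rewrite ler_pdivlMr// mulrDr mulr1 -mulrA [2^-1 * _]mulrC !mulrA mulVf ?gt_eqF//.
    have := ler_wpM2l (ltW ci0) cu1; rewrite mulKf ?gt_eqF// mulr1; lra.
  apply: ler_pM; rewrite ?powR_ge0 ?expR_ge0//.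
    apply: ge0_ler_powR; rewrite ?nnegrE ?subr_ge0 ?(ltW ci0)//.
    by rewrite divr_ge0// ltW.
  by rewrite ler_expR lerN2 ler_pM2r.
apply: (@le_trans _ _ (\int[mu]_(u in `[0%R, c^-1%R]) (cir_kernel c p theta y u)%:E
    + \int[mu]_(u in `[c^-1%R, +oo[) (cir_kernel c p theta y u)%:E)%E).
  rewrite (@itv_bndbnd_setU _ _ _ (BRight c^-1)) ?bnd_simp ?(ltW ci0)//.
  rewrite ge0_integral_setU//=; last 2 first.
  - exact: measurable_funTS.
  - rewrite disj_set2E; apply/eqP/seteqP; split => // u [] /=.
    rewrite !in_itv/= andbT => /andP[_ h] h'.
    by move: (le_lt_trans h h'); rewrite ltxx.
  apply: leeD => //; apply: ge0_subset_integral => //.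
  - exact: measurable_funTS.
  - by move=> u /=; rewrite !in_itv/= !andbT => /ltW.
apply: (le_trans (leeD near far)); rewrite -EFinD lee_fin.
have yp : 0 < y `^ p by exact: powR_gt0.
have G0 := Gamma_gt0 p1.
have kE : k / c = ((y / c) `^ p * expR (- (y / c / 2))) / y `^ p.
  rewrite /k powRM ?(ltW y0) ?(ltW ci0)// -(mulr_powRB1 (ltW ci0) p0).
  rewrite (_ : c^-1 / 2 * y = y / c / 2); last by ring.
  by field; rewrite !gt_eqF.
have := powR_expR_max p0 (divr_gt0 y0 c0) => hmax.
have kle : k / c <= 2 `^ p * (p `^ p * expR (- p)) / y `^ p.
  by rewrite kE ler_pM2r ?invr_gt0.
(* On the right, [2^p] comes from the maximum and [2^(- q)] from the tail integral at [1 + c u = 2];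
   on the left is the grouping of [cir_Lp]. *)
have E1 : 2 `^ (p + 1 - theta) * 2 `^ (p - 1) = 2 `^ p * 2 `^ (- q) :> R.
  rewrite -!powRD ?pnatr_eq0/= ?implybT//; congr powR; by ring.
rewrite /cir_Lp.
have -> : Gamma p * (2 `^ (p + 1 - theta) * (1 + 2 `^ (p - 1) * p `^ p * expR (- p)
      / (Gamma p * (theta - p)))) / y `^ p
   = 2 `^ (p + 1 - theta) * (Gamma p / y `^ p)
     + (2 `^ (p + 1 - theta) * 2 `^ (p - 1)) * (p `^ p * expR (- p) / y `^ p) / q.
  rewrite /q; field; rewrite !gt_eqF//; exact: q0.
rewrite lerD2l E1.
have -> : k * (2 `^ (- q) / (c * q)) = (k / c) * (2 `^ (- q) / q).
  by field; rewrite !gt_eqF.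
have -> : 2 `^ p * 2 `^ (- q) * (p `^ p * expR (- p) / y `^ p) / q
    = (2 `^ p * (p `^ p * expR (- p)) / y `^ p) * (2 `^ (- q) / q) by ring.
by apply: ler_wpM2r => //; rewrite divr_ge0 ?powR_ge0// ltW.
Qed.

End cir_kernel_bound.

(** Covers the initial time: there [cir_var] is 0, the cut at [1 / c] makes no sense, and the bound
    reduces to the constant being at least 1. *)
Lemma cir_Lp_ge1 (R : realType) (theta p : R) :
  1 <= p -> p < theta -> theta - 1 < p -> 1 <= cir_Lp theta p.
Proof.
move=> p1 pt tp; rewrite /cir_Lp -[leLHS]mul1r; apply: ler_pM => //.
  rewrite -[leLHS](powRr0 (2 : R)); apply: ler_powR; first by rewrite ler1n.
  by lra.
rewrite lerDl divr_ge0// ?mulr_ge0 ?powR_ge0 ?expR_ge0 ?subr_ge0 ?(ltW pt)//.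
exact/ltW/Gamma_gt0.
Qed.

(** The inverse is the extended one, so the case where [x] raised to [p] is 0 is included, both
    sides being infinite. *)
Lemma inve_powR_scale (R : realType) (p k x : R) : 0 < k -> 0 <= x ->
  ((((k * x) `^ p)%:E)^-1 = (k `^ (- p))%:E * ((x `^ p)%:E)^-1)%E.
Proof.
move=> k0 x0; rewrite powRM ?(ltW k0)// !inver mulf_eq0 powRN gt_eqF ?powR_gt0//=.
case: ifPn => [_|xp]; first by rewrite gt0_muley// lte_fin invr_gt0 powR_gt0.
by rewrite -EFinM invfM.
Qed.

Section inverse_moments.
Context d (T : measurableType d) (R : realType) (P : probability T R).
Local Notation mu := lebesgue_measure.
Implicit Types (Y : T -> R) (p : R).

Lemma inve_powR_ge0 p (x : R) : (0 <= ((x `^ p)%:E)^-1)%E.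
Proof. by rewrite inver; case: ifPn => // _; rewrite lee_fin invr_ge0 powR_ge0. Qed.

Lemma measurable_inve_powR Y p : measurable_fun setT Y ->
  measurable_fun setT (fun w => ((Y w `^ p)%:E)^-1)%E.
Proof.
move=> mY; have mYp : measurable_fun setT (fun w => Y w `^ p).
  by apply: (@measurableT_comp _ _ _ _ _ _ (fun x : R => x `^ p)).
under eq_fun do rewrite inver.
apply: measurable_fun_ifT => //; first exact: measurable_fun_eqr.
by apply/measurable_EFinP; apply: measurableT_comp => //; exact: measurable_invr.
Qed.

Lemma eq_inverse_moment Y Y' p : measurable_fun setT Y -> measurable_fun setT Y' ->
  {ae P, forall w, Y w = Y' w} -> inverse_moment P Y p = inverse_moment P Y' p.
Proof.
move=> mY mY' YY'; apply: ge0_ae_eq_integral => //.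
- exact: measurable_inve_powR.
- exact: measurable_inve_powR.
- by move=> w _; exact: inve_powR_ge0.
- by move=> w _; exact: inve_powR_ge0.
- by apply: filterS YY' => w YwE _; rewrite YwE.
Qed.

Section tonelli_half_line.
Context (f : T -> R -> R).
Hypotheses (mf : measurable_fun setT (fun z : T * R => f z.1 z.2))
  (f0 : forall w u, 0 <= f w u).

Let h (z : T * R) : \bar R := (f z.1 z.2 * \1_(`[0%R, +oo[%classic) z.2)%:E.

Let mh : measurable_fun setT h.
Proof.
apply/measurable_EFinP; apply: measurable_funM => //.
by apply: measurableT_comp => //; exact: measurable_indic.
Qed.

Let h0 z : (0 <= h z)%E. Proof. by rewrite lee_fin mulr_ge0. Qed.

Let hE w : (\int[mu]_u h (w, u) = \int[mu]_(u in `[0%R, +oo[) (f w u)%:E)%E.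
Proof.
rewrite [RHS]integral_mkcond; apply: eq_integral => u _.
by rewrite /h patchE indicE/=; case: ifPn => _; rewrite ?mulr1 ?mulr0.
Qed.

Lemma tonelli_half_line :
  (\int[P]_w \int[mu]_(u in `[0%R, +oo[) (f w u)%:E
   = \int[mu]_(u in `[0%R, +oo[) \int[P]_w (f w u)%:E)%E.
Proof.
have := @fubini_tonelli _ _ _ _ R P mu h mh h0.
have -> : (\int[P]_x \int[mu]_y h (x, y)
    = \int[P]_w \int[mu]_(u in `[0%R, +oo[) (f w u)%:E)%E.
  by apply: eq_integral => w _; exact: hE.
move=> ->; rewrite [RHS]integral_mkcond; apply: eq_integral => u _.
rewrite patchE; case: ifPn => uD; rewrite /h/=.
  by apply: eq_integral => w _; rewrite indicE uD mulr1.
by rewrite integral0_eq// => w _; rewrite indicE (negbTE uD) mulr0.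
Qed.

Lemma measurable_integral_half_line :
  measurable_fun setT (fun w => \int[mu]_(u in `[0%R, +oo[) (f w u)%:E)%E.
Proof.
rewrite (_ : (fun w => _) = fubini_F mu h); last first.
  by apply/funext => w; rewrite -hE.
exact: measurable_fun_fubini_tonelli_F.
Qed.

Lemma measurable_integral_param :
  measurable_fun setT (fun u => \int[P]_w (f w u)%:E)%E.
Proof.
apply: (@measurable_fun_fubini_tonelli_G _ _ _ _ R P (fun z => (f z.1 z.2)%:E)).
  exact/measurable_EFinP.
by move=> z; rewrite lee_fin.
Qed.

End tonelli_half_line.

Lemma measurable_gamma_kernel_param Y p : measurable_fun setT Y ->
  measurable_fun setT (fun z : T * R => gamma_kernel p (Y z.1) z.2).
Proof.
move=> mY; apply: measurable_funM.
  by apply: (@measurableT_comp _ _ _ _ _ _ (fun u : R => u `^ (p - 1))).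
apply: measurableT_comp => //; apply: measurable_funN; apply: measurable_funM => //.
exact: measurableT_comp.
Qed.

(** Turns an inverse moment into an integral of Laplace transforms, the only information on [X t]
    that is available. *)
Lemma inverse_moment_Gamma Y p : 1 <= p -> measurable_fun setT Y ->
  (forall w, 0 <= Y w) ->
  ((Gamma p)%:E * inverse_moment P Y p
   = \int[mu]_(u in `[0%R, +oo[) \int[P]_w (gamma_kernel p (Y w) u)%:E)%E.
Proof.
move=> p1 mY Y0; rewrite -tonelli_half_line; last first.
- by move=> w u; exact: gamma_kernel_ge0.
- exact: measurable_gamma_kernel_param.
rewrite -ge0_integralZl_EFin//.
- by apply: eq_integral => w _; rewrite gamma_kernel_integral.
- by move=> w _; exact: inve_powR_ge0.
- exact: measurable_inve_powR.
- exact/ltW/Gamma_gt0.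
Qed.

End inverse_moments.

(** * Inverse moments of the CIR process *)

Section cir_inverse_moments.
Context d (T : measurableType d) (R : realType) (P : probability T R) (t0 : R)
  (F : R -> set (set T)) (W : R -> T -> R) (a g sigma : R) (X : R -> T -> R) (p : R).
Hypotheses (hF : filtration t0 F) (hW : brownian_motion P t0 F W)
  (a0 : 0 < a) (g0 : 0 < g) (sigma0 : 0 < sigma) (p1 : 1 <= p)
  (hX : cir_core P t0 F W a g sigma X).
Local Notation mu := lebesgue_measure.
Local Notation theta := (2 * a * g / sigma ^+ 2).

Let X0 s w : 0 <= X s w. Proof. by case: hX. Qed.

Let mX s : t0 <= s -> measurable_fun setT (X s).
Proof. by move=> t0s; apply: (Fmeas_measurable hF t0s); case: hX => _ _ + _; exact. Qed.

Let mexp u t : t0 <= t -> measurable_fun setT (cir_exp a g sigma X u t t0).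
Proof. by move=> t0t; exact: (Fmeas_measurable hF (lexx t0) (Fmeas_cir_exp hX u t (lexx t0))). Qed.

Let mlap u t : t0 <= t -> measurable_fun setT (fun w => expR (- (u * X t w))).
Proof.
move=> t0t; apply: measurableT_comp => //; apply: measurable_funN.
by apply: measurable_funM => //; exact: mX.
Qed.

Let kernelE u t w : u `^ (p - 1) * cir_exp a g sigma X u t t0 w
  = cir_kernel (cir_var a sigma (t - t0)) p theta (expR (- (a * (t - t0))) * X t0 w) u.
Proof.
rewrite /cir_kernel /cir_exp /cir_psi /cir_phi (mulrC u (cir_var _ _ _)).
by rewrite (mulrAC u) -(mulrA (u / _)).
Qed.

(** Reduces the moment bound to a deterministic estimate of the kernel for each [y]. The exponential
    rate comes from [y = e^(-a (t - t0)) X(t0)] raised to the power [- p]. *)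
Lemma inverse_moment_cir_le (L t : R) : 0 < L -> t0 <= t ->
  (forall y, 0 <= y ->
    (\int[mu]_(u in `[0%R, +oo[) (cir_kernel (cir_var a sigma (t - t0)) p theta y u)%:E
     <= (Gamma p * L)%:E * ((y `^ p)%:E)^-1)%E) ->
  (inverse_moment P (X t) p
   <= L%:E * (expR (a * p * (t - t0)))%:E * inverse_moment P (X t0) p)%E.
Proof.
move=> L0 t0t hL; have G0 := Gamma_gt0 p1.
set c := cir_var a sigma (t - t0) in hL *.
have c0 : 0 <= c by apply: cir_var_ge0 => //; rewrite subr_ge0.
have mY : measurable_fun setT (fun w => expR (- (a * (t - t0))) * X t0 w).
  by apply: measurable_funM => //; exact: mX.
have mk : measurable_fun setT (fun z : T * R =>
    cir_kernel c p theta (expR (- (a * (t - t0))) * X t0 z.1) z.2).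
  have md : measurable_fun setT (fun z : T * R => 1 + c * z.2).
    by apply: measurable_funD => //; exact: measurable_funM.
  apply: measurable_funM.
    by apply: (@measurableT_comp _ _ _ _ _ _ (fun u : R => u `^ (p - 1))).
  apply: measurableT_comp => //; apply: measurable_funN; apply: measurable_funD.
    apply: measurable_funM; last exact: (measurableT_comp mY).
    apply: measurable_funM => //; exact: (measurableT_comp (@measurable_invr R)).
  apply: measurable_funM => //; apply: measurableT_comp md; exact: measurable_ln.
suff h : ((Gamma p)%:E * inverse_moment P (X t) p
    <= (Gamma p)%:E * (L%:E * (expR (a * p * (t - t0)))%:E * inverse_moment P (X t0) p))%E.
  by rewrite lee_pmul2l in h.
rewrite inverse_moment_Gamma//; last exact: mX.
apply: (@le_trans _ _ (\int[mu]_(u in `[0%R, +oo[) \int[P]_w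
    (cir_kernel c p theta (expR (- (a * (t - t0))) * X t0 w) u)%:E)%E).
  apply: ge0_le_integral => //.
  - by move=> u _; apply: integral_ge0 => w _; rewrite lee_fin gamma_kernel_ge0.
  - apply: measurable_funTS; apply: measurable_integral_param.
      by apply: measurable_gamma_kernel_param; exact: mX.
    by move=> w u; exact: gamma_kernel_ge0.
  - apply: measurable_funTS; apply: measurable_integral_param => //.
    by move=> w u; exact: cir_kernel_ge0.
  move=> u /=; rewrite in_itv/= andbT => u0.
  rewrite (_ : \int[P]_w _ = (u `^ (p - 1))%:E * \int[P]_w (expR (- (u * X t w)))%:E)%E; last first.
    by rewrite -ge0_integralZl_real ?powR_ge0//; exact: mlap.
  rewrite (_ : \int[P]_w (cir_kernel c p theta
      (expR (- (a * (t - t0))) * X t0 w) u)%:E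
      = (u `^ (p - 1))%:E * \int[P]_w (cir_exp a g sigma X u t t0 w)%:E)%E; last first.
    rewrite -(ge0_integralZl_real P (mexp u t0t) (cir_exp_ge0 a g sigma X u t t0)
      (powR_ge0 u (p - 1))).
    by apply: eq_integral => w _; rewrite kernelE.
  apply: lee_wpmul2l; first by rewrite lee_fin powR_ge0.
  exact: (cir_laplace_le hF hW a0 g0 sigma0 hX u0 t0t).
rewrite -tonelli_half_line//; last by move=> w u; exact: cir_kernel_ge0.
rewrite !muleA -!EFinM /inverse_moment -ge0_integralZl_EFin//; last 3 first.
- by move=> w _; exact: inve_powR_ge0.
- by apply: measurable_inve_powR; exact: mX.
- by rewrite !mulr_ge0 ?expR_ge0// ltW.
apply: ge0_le_integral => //.
- by move=> w _; apply: integral_ge0 => u _; rewrite lee_fin cir_kernel_ge0.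
- by apply: measurable_integral_half_line => // w u; exact: cir_kernel_ge0.
- by apply: measurable_funeM; apply: measurable_inve_powR; exact: mX.
move=> w _; apply: (le_trans (hL _ _)); first by rewrite mulr_ge0 ?expR_ge0.
rewrite inve_powR_scale ?expR_gt0// muleA -EFinM.
have -> : expR (- (a * (t - t0))) `^ (- p) = expR (a * p * (t - t0)).
  by rewrite /powR gt_eqF ?expR_gt0// expRK; congr expR; ring.
by [].
Qed.

Lemma inverse_moment_cir_le_low (t : R) : t0 <= t -> p <= theta - 1 ->
  (inverse_moment P (X t) p
   <= 1%:E * (expR (a * p * (t - t0)))%:E * inverse_moment P (X t0) p)%E.
Proof.
move=> t0t ptheta; apply: inverse_moment_cir_le => // y y0.
rewrite mulr1; apply: cir_kernel_le_Gamma => //.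
  by apply: cir_var_ge0 => //; rewrite subr_ge0.
by rewrite -lerBrDr.
Qed.

Lemma inverse_moment_cir_le_high (t : R) : t0 <= t -> p < theta -> theta - 1 < p ->
  (inverse_moment P (X t) p
   <= (cir_Lp theta p)%:E * (expR (a * p * (t - t0)))%:E * inverse_moment P (X t0) p)%E.
Proof.
move=> + pt tp; have L1 := cir_Lp_ge1 p1 pt tp.
have L0 : 0 < cir_Lp theta p by exact: lt_le_trans ltr01 L1.
rewrite le_eqVlt => /predU1P[<-|t0t].
  rewrite subrr mulr0 expR0 mule1 -[leLHS]mul1e; apply: lee_wpmul2r => //.
  by apply: integral_ge0 => w _; exact: inve_powR_ge0.
apply: inverse_moment_cir_le (ltW t0t) _ => // y.
have c0 : 0 < cir_var a sigma (t - t0) by apply: cir_var_gt0; rewrite ?subr_gt0.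
have G0 := Gamma_gt0 p1.
(* At [y = 0] the right-hand side is infinite; the kernel bound itself requires [y > 0]. *)
rewrite le_eqVlt => /predU1P[<-|y0].
  have p0 : p != 0 by rewrite gt_eqF// (lt_le_trans ltr01 p1).
  by rewrite powR0// inver eqxx gt0_muley ?leey// lte_fin mulr_gt0.
apply: (le_trans (cir_kernel_le_Lp c0 p1 pt tp y0)).
by rewrite inver gt_eqF ?powR_gt0.
Qed.

(** These events cover the whole space, so they cannot all be null. *)
Let initial_bounded_with_positive_probability :
  exists2 n : nat, (0 < P [set w | X t0 w <= n%:R]%R)%E
    & measurable [set w | X t0 w <= n%:R]%R.
Proof.
have mA (n : nat) : measurable [set w | X t0 w <= n%:R]%R.
  rewrite (_ : [set w | _] = (X t0) @^-1` `]-oo, n%:R]); last by rewrite preimage_itvNyc.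
  by rewrite -[_ @^-1` _]setTI; apply: mX.
apply: contrapT => H.
have : P.-negligible (\bigcup_n [set w | X t0 w <= n%:R]%R).
  apply: negligible_bigcup => n; apply/negligibleP; first exact: mA.
  apply/eqP; rewrite eq_le measure_ge0 andbT leNgt; apply/negP => PA.
  by apply: H; exists n.
rewrite (_ : \bigcup_n _ = setT); last first.
  apply/seteqP; split => // w _; exists (Num.bound (X t0 w)) => //=.
  by rewrite ltW// archi_boundP.
move=> /(negligibleP _ measurableT) PT0; have := etrans (esym PT0) (@probability_setT _ _ _ P).
by move/eqP; rewrite eq_sym onee_eq0.
Qed.

(** On an event of positive probability [X t0] is bounded by some [n]. There [psi <= 1 / c] makes
    the Laplace transform at least a constant times [(1 + c u)^(- theta)], uniformly in [u], and the
    Gamma integral diverges. *)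
Lemma inverse_moment_cir_infinite (t : R) : theta <= p -> t0 < t ->
  inverse_moment P (X t) p = +oo%E.
Proof.
move=> tp t0t; have G0 := Gamma_gt0 p1.
have tau0 : 0 < t - t0 by rewrite subr_gt0.
have theta0 : 0 < theta by rewrite divr_gt0 ?exprn_gt0 ?mulr_gt0.
set c := cir_var a sigma (t - t0).
have c0 : 0 < c by exact: cir_var_gt0.
have [n PA mA] := initial_bounded_with_positive_probability.
set A := [set w | _] in PA mA.
have [q q0 PAE] : exists2 q : R, 0 < q & P A = q%:E.
  have PAf : P A \is a fin_num by exact: fin_num_measure.
  by exists (fine (P A)); rewrite ?fineK// -lte_fin fineK.
(* [Gamma p] is finite and positive, so an infinite product forces an infinite moment. *)
suff : ((Gamma p)%:E * inverse_moment P (X t) p = +oo)%E.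
  case: (inverse_moment P (X t) p) => [r| |]//=.
  by rewrite gt0_muleNy.
rewrite inverse_moment_Gamma//; last by apply: mX; exact: ltW.
pose f (u : R) := u `^ (p - 1) * expR (- (n%:R / c + theta * ln (1 + c * u))).
have f0 u : 0 <= f u by rewrite mulr_ge0 ?powR_ge0 ?expR_ge0.
have mf : measurable_fun setT f.
  apply: measurable_funM; first exact: measurable_powR.
  apply: measurableT_comp => //; apply: measurable_funN; apply: measurable_funD => //.
  apply: measurable_funM => //; apply: measurableT_comp => //.
  by apply: measurable_funD => //; exact: measurable_funM.
apply/eqP; rewrite -leye_eq.
rewrite (_ : +oo%E = (q%:E * \int[mu]_(u in `[0%R, +oo[) (f u)%:E)%E); last first.
  by rewrite (cir_kernel_diverges (ltW c0) _ tp (ltW theta0)) gt0_muley.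
rewrite -ge0_integralZl_EFin ?(ltW q0)//; last 2 first.
- by move=> u _; rewrite lee_fin.
- by apply/measurable_EFinP; exact: measurable_funTS.
apply: ge0_le_integral => //.
- by move=> u _; rewrite -EFinM lee_fin mulr_ge0// ltW.
- by apply: measurable_funTS; apply: measurable_funeM; exact/measurable_EFinP.
- apply: measurable_funTS; apply: measurable_integral_param.
    by apply: measurable_gamma_kernel_param; apply: mX; exact: ltW.
  by move=> w u; exact: gamma_kernel_ge0.
move=> u /=; rewrite in_itv/= andbT => u0.
have lap0 w : 0 <= expR (- (u * X t w)) by exact: expR_ge0.
rewrite (ge0_integralZl_real P (mlap u (ltW t0t)) lap0 (powR_ge0 u (p - 1))).
rewrite -EFinM /f mulrCA EFinM; apply: lee_wpmul2l; first by rewrite lee_fin powR_ge0.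
apply: (@le_trans _ _ (\int[P]_w (\1_A w * expR (- (u * X t w)))%:E)%E); last first.
  apply: ge0_le_integral_EFin.
  - by apply: measurable_funM; [exact: measurable_indic|apply: mlap; exact: ltW].
  - by apply: mlap; exact: ltW.
  - by move=> w; rewrite mulr_ge0 ?expR_ge0.
  by move=> w; rewrite ler_piMl ?expR_ge0// indicE; case: (_ \in _).
apply: (le_trans _ (cir_laplace_ge hF hW a0 g0 sigma0 hX n%:R u0 (ltW t0t))).
set C := expR _.
rewrite (_ : (q * C)%:E = \int[P]_w (\1_A w * C)%:E)%E; last first.
  transitivity (\int[P]_w (C * \1_A w)%:E)%E; last first.
    by apply: eq_integral => w _; rewrite mulrC.
  have mi : measurable_fun setT (\1_A : T -> R) by exact: measurable_indic.
  have i0 w : 0 <= (\1_A w : R) by [].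
  rewrite (ge0_integralZl_real P mi i0 (expR_ge0 _)).
  by rewrite integral_indic_setT// PAE -EFinM mulrC.
apply: ge0_le_integral_EFin.
- by apply: measurable_funM => //; exact: measurable_indic.
- by apply: measurable_funM; [exact: measurable_indic|apply: mexp; exact: ltW].
- by move=> w; rewrite mulr_ge0// expR_ge0.
move=> w; rewrite indicE; have [/= wA|wA] := boolP (w \in A); last by rewrite !mul0r.
move: wA; rewrite inE /A/= => Xn; rewrite !mul1r /C /cir_exp ler_expR lerN2.
rewrite /cir_phi -/c (mulrC u c) lerD2r /cir_psi -/c.
have e1 : expR (- (a * (t - t0))) <= 1.
  by rewrite -expR0 ler_expR oppr_le0 mulr_ge0// ltW.
have d0 : 0 < 1 + u * c by have := mulr_ge0 u0 (ltW c0); lra.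
apply: (@le_trans _ _ (c^-1 * X t0 w)); last by rewrite mulrC ler_pM2r ?invr_gt0.
apply: ler_wpM2r => //; rewrite ler_pdivrMr//.
apply: (@le_trans _ _ (u * 1)); first exact: ler_wpM2l.
by rewrite mulr1 mulrDr mulr1 mulrCA mulVf ?gt_eqF// mulr1 lerDr invr_ge0 ltW.
Qed.

End cir_inverse_moments.

(** The estimates hold with the elapsed time [t - t0] in the exponent; [0 <= t0] weakens this to
    [t]. *)
Lemma ge0_rate_le_time (R : realType) (L b t0 t : R) (m m' : \bar R) :
  0 <= L -> 0 <= b -> 0 <= t0 -> (0 <= m')%E ->
  (m <= L%:E * (expR (b * (t - t0)))%:E * m' ->
   m <= L%:E * (expR (b * t))%:E * m')%E.
Proof.
move=> L0 b0 t00 m0 /le_trans; apply; apply: lee_wpmul2r => //.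
by rewrite -!EFinM lee_fin ler_wpM2l// ler_expR ler_wpM2l// gerBl.
Qed.

Theorem lemma6p1 (d : measure_display) (T : measurableType d) (R : realType)
    (P : probability T R) (t0 : R) (F : R -> set (set T)) (W : R -> T -> R)
    (a g sigma : R) (X0 : T -> R) (X : R -> T -> R) (p : R)
    (ht0 : 0 <= t0)
    (hF : filtration t0 F) (hFu : usual_conditions P t0 F)
    (hW : brownian_motion P t0 F W)
    (ha : 0 < a) (hg : 0 < g) (hsigma : 0 < sigma)
    (hX0m : g_sigma_algebra_preimage X0 `<=` F t0)
    (hX0pos : {ae P, forall w, 0 < X0 w})
    (hX0W : independent_systems P (g_sigma_algebra_preimage X0)
       (sigma_of_process t0 W))
    (hX : cir_process P t0 F W a g sigma X0 X)
    (hFeller : 1 < 2 * a * g / sigma ^+ 2) :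
  let theta := 2 * a * g / sigma ^+ 2 in
  let bound (L : R) := forall t, t0 <= t ->
    (inverse_moment P (X t) p
       <= L%:E * (expR (a * p * t))%:E * inverse_moment P X0 p)%E in
  (theta <= p -> forall t, t0 < t -> inverse_moment P (X t) p = +oo%E) /\
  (1 <= p -> p < theta -> (inverse_moment P X0 p < +oo)%E ->
    [/\ exists L : R, bound L,
        2 <= theta -> p <= theta - 1 -> bound 1,
        2 <= theta -> theta - 1 < p -> bound (cir_Lp theta p)
      & theta < 2 -> bound (cir_Lp theta p)]).

Proof.
move=> theta bound.
have [X' hX' X'X] := cir_core_version hF hFu hW hX.
have [Xad _ _ XX0 _] := hX.
have mF (Y : T -> R) t : t0 <= t -> g_sigma_algebra_preimage Y `<=` F t ->
    measurable_fun setT Y.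
  by move=> t0t YF; apply: (Fmeas_measurable hF t0t); exact/(FmeasP hF Y t0t).
have mX t : t0 <= t -> measurable_fun setT (X t).
  by move=> t0t; apply: (mF _ _ t0t); exact: Xad.
have mX' t : t0 <= t -> measurable_fun setT (X' t).
  by move=> t0t; apply: (Fmeas_measurable hF t0t); case: hX' => _ _ + _; exact.
have imX t : t0 <= t -> inverse_moment P (X t) p = inverse_moment P (X' t) p.
  move=> t0t; apply: eq_inverse_moment; [exact: mX|exact: mX'|].
  by apply: filterS X'X => w ->.
have imX0 : inverse_moment P X0 p = inverse_moment P (X' t0) p.
  rewrite -(imX _ (lexx t0)).
  apply: eq_inverse_moment; [exact: (mF _ _ (lexx t0) hX0m)|exact: (mX _ (lexx t0))|].
  by apply: filterS XX0 => w ->.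
split=> [thetap t t0t|p1 ptheta _].
  rewrite (imX _ (ltW t0t)).
  apply: (inverse_moment_cir_infinite hF hW ha hg hsigma _ hX' thetap t0t).
  (* The Gamma representation needs [1 <= p], which here follows from [1 < theta <= p]. *)
  exact: ltW (lt_le_trans hFeller thetap).
have im0 : (0 <= inverse_moment P (X' t0) p)%E.
  by apply: integral_ge0 => w _; exact: inve_powR_ge0.
have ap0 : 0 <= a * p by rewrite mulr_ge0 ?(ltW ha) ?(le_trans ler01 p1).
have bound1 : p <= theta - 1 -> bound 1.
  move=> ptheta1 t t0t; rewrite (imX _ t0t) imX0.
  apply: (ge0_rate_le_time ler01 ap0 ht0 im0).
  exact: (inverse_moment_cir_le_low hF hW ha hg hsigma p1 hX' t0t ptheta1).
have boundL : theta - 1 < p -> bound (cir_Lp theta p).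
  move=> thetap t t0t; rewrite (imX _ t0t) imX0.
  have L0 := le_trans ler01 (cir_Lp_ge1 p1 ptheta thetap).
  apply: (ge0_rate_le_time L0 ap0 ht0 im0).
  exact: (inverse_moment_cir_le_high hF hW ha hg hsigma p1 hX' t0t ptheta thetap).
(* When [p <= theta - 1], the assumption [1 <= p] forces [2 <= theta], so the last item is vacuous;
   in the other case the constant [cir_Lp] serves whether or not [theta] reaches 2. *)
have [p_le|p_gt] := leP p (theta - 1); split.
- by exists 1; exact: bound1.
- by move=> _ _; exact: bound1.
- by [].
- by move=> theta2; exfalso; lra.
- by exists (cir_Lp theta p); exact: boundL.
- by [].
- by move=> _ _; exact: boundL.
- by move=> _; exact: boundL.
Qed.
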